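(* For a positive integer $d$, let $N(d)$ denote the set of all integers $n$ for which there exists a $d$-regular nut graph of order $n$ (i.e. with exactly $n$ vertices). Then the following holds: \begin{itemize} \item $N(5) = \{2k : k \geq 5\}$; \item $N(6) = \{k : k \geq 12\}$; \item $N(7) = \{2k : k \geq 6\}$; \item $N(8) = \{12\} \cup \{k : k \geq 14\}$; \item $N(9) = \{2k : k \geq 8\}$; \item $N(10) = \{k : k \geq 15\}$; \item $N(11) = \{2k : k \geq 8\}$; \end{itemize} where $k$ ranges over integers.
   Context: All graphs are finite and simple (no loops, no multiple edges). For a graph $G$ of order $n$ (on $n$ vertices), $\mathbf{A}(G)$ denotes its $n \times n$ $0$-$1$ adjacency matrix. A nut graph is a graph $G$ with $n>1$ vertices such that the kernel of $\mathbf{A}(G)$ (over $\mathbb{R}$) is one-dimensional and is spanned by a vector with no zero entries. (The single isolated vertex, the trivial case, is not counted as a nut graph.) A graph is $d$-regular if every vertex has exactly $d$ neighbours. *)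

(* Defs.v *)
From HB Require Import structures.
From mathcomp Require Import all_boot all_order all_algebra.
From mathcomp Require Import classical_sets reals.

Set Implicit Arguments.
Unset Strict Implicit.
Unset Printing Implicit Defensive.

Import GRing.Theory.

Record sgraph := SGraph {
  vertex :> finType;
  adj : rel vertex;
  adj_sym : symmetric adj;
  adj_irr : irreflexive adj
}.

Definition regular (d : nat) (G : sgraph) : Prop :=
  forall x : G, #|[pred y : G | adj x y]| = d.

Definition adjmx (R : realType) (G : sgraph) : 'M[R]_#|G| :=
  \matrix_(i, j) ((adj (enum_val i) (enum_val j))%:R)%R.

Lemma adjmx_tr (R : realType) (G : sgraph) : (adjmx R G)^T%R = adjmx R G.
Proof. by apply/matrixP => i j; rewrite !mxE adj_sym. Qed.

(* [kermx A] is the left kernel of [A]; it is the kernel of the adjacency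
   matrix because that matrix is symmetric ([adjmx_tr]). *)
Definition nut_graph (R : realType) (G : sgraph) : Prop :=
  [/\ 1 < #|G|,
      \rank (kermx (adjmx R G)) = 1
    & exists v : 'rV[R]_#|G|,
        (forall i, v ord0 i != 0%R) /\ (kermx (adjmx R G) :=: v)%MS].

Definition nut_orders (R : realType) (d : nat) : set nat :=
  [set n | exists G : sgraph,
     [/\ #|G| = n, regular d G & nut_graph R G]]%classic.

(* Main.v *)
Require Import Defs.
From Stdlib Require Import ZArith.
From HB Require Import structures.
From mathcomp Require Import all_boot all_order all_algebra.
From mathcomp Require Import classical_sets reals.
From mathcomp Require Import zify ssrZ ring.

(** Nonexistence. A [d]-regular graph [G] on [n] vertices is a nut graph iff [B = A(H) + I] has
    nullity one with a kernel vector without zeros, where [H] is the complement of [G], which is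
    [k]-regular for [k = n - 1 - d]; in all the cases to exclude [k <= 4]. Scale the kernel
    vector to a primitive integral one and let [S] be the set of vertices where it is odd.
    Every closed neighbourhood of [H] meets [S] in an even number of vertices, so the vertices
    of [S] have degree 1 or 3 inside [S]; reading [Bx = 0] modulo 8 shows that the number [a] of
    the former is even and the number [b] of the latter divisible by 4. For each possible
    [(a, b)] an exhaustive search builds the graph induced on [S], then the neighbourhoods of
    the vertices of [S], then the rest of [H], and expresses the kernel vector by linear forms
    in few parameters. A branch is cut when a form vanishes, or when the rows of [B] known so
    far are dependent: [B] being symmetric, a dependency is a kernel vector with zeros.

    Existence. The construction of Fowler turns a [d]-regular nut graph of order [n] into one
    of order [n + 2d], so that finitely many explicit graphs suffice. That their kernels
    are lines is checked modulo 13: a second rational kernel vector could be chosen to vanish at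
    a vertex where the known one is nonzero modulo 13, and scaled to be integral and nonzero
    modulo 13. *)

(** Both [A(G)] and [B = J - A(G)], with [J] the all-one matrix, have the all-one vector as left
    eigenvector, for the nonzero eigenvalues [d] and [k + 1]. Their kernel vectors therefore sum to
    zero, [J] kills them, and the two kernels coincide. Passing to [B] leaves at most five nonzero
    entries in a row. A dependency among fewer than all rows is fatal because the kernel is a line
    without zeros: any [n - 1] rows of [B] are independent. Soundness is not proved by describing
    the enumeration. One hypothetical graph is fixed, its vertices are listed in the order in which
    the search labels them, and at every branching one child is shown to be still realized by the
    list; a relabelling only permutes that list. The program works on bare [nat], [N], [Z] and lists
    because it is run by the virtual machine. Evaluation there is strict, which is why many tests
    are nested conditionals where a Boolean connective would do. *)

Set Implicit Arguments.
Unset Strict Implicit.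
Unset Printing Implicit Defensive.

(** * The search program *)

(* The entry of a label is the list of its known neighbours, flagged once that list is complete.
   Out of range, [vx] is complete without neighbours. *)
Definition pvertex := (bool * seq nat)%type.
Definition pgraph := seq pvertex.
Definition vx (g : pgraph) i : pvertex := nth (true, [::]) g i.
Definition full g i := (vx g i).1.
Definition nbr g i := (vx g i).2.

Fixpoint memn (x : nat) (l : seq nat) : bool :=
  if l is y :: l' then eqn x y || memn x l' else false.

Fixpoint subsets (m : nat) (l : seq nat) : seq (seq nat) :=
  match m, l with
  | 0, _ => [:: [::]]
  | _, [::] => [::]
  | m'.+1, x :: l' => map (cons x) (subsets m' l') ++ subsets m l'
  end.

Fixpoint link (i : nat) (X Y : seq nat) (j : nat) (g : pgraph) : pgraph :=
  if g is v :: g' then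
    (if eqn i j then (true, Y ++ v.2)
     else if memn j X then (v.1, i :: v.2) else v) :: link i X Y j.+1 g'
  else [::].

(* Completes the neighbourhood of [i] with the old labels [X] and [nn] new ones. *)
Definition extend (g : pgraph) (i nn : nat) (X : seq nat) : pgraph :=
  link i X (X ++ iota (size g) nn) 0 g ++ nseq nn (false, [:: i]).

Fixpoint firstopen (j : nat) (g : pgraph) : option nat :=
  if g is v :: g' then if v.1 then firstopen j.+1 g' else Some j else None.

(* [bs] is one more than the number of known neighbours of the best label [bj] so far. *)
Fixpoint pick_from (j bj bs : nat) (g : pgraph) : option nat :=
  if g is v :: g' then
    if v.1 then pick_from j.+1 bj bs g' else
    if Nat.ltb bs (size v.2).+1 then pick_from j.+1 j (size v.2).+1 g'
    else pick_from j.+1 bj bs g'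
  else if bs is 0 then None else Some bj.

Fixpoint nfull (g : pgraph) : nat :=
  if g is v :: g' then (if v.1 then (nfull g').+1 else nfull g') else 0.

(* [tgt] gives the degrees of the labels, those below [lo] being excluded as new neighbours;
   [n] bounds the number of labels. *)
Section Extensions.
Variables (tgt : nat -> nat) (lo n : nat).

Fixpoint cand_from (i j : nat) (g : pgraph) : seq nat :=
  if g is v :: g' then
    let r := cand_from i j.+1 g' in
    if v.1 then r
    else if Nat.ltb j lo then r
    else if Nat.leb (tgt j) (size v.2) then r
    else if eqn i j then r
    else if memn i v.2 then r
    else j :: r
  else [::].

(** Of the missing neighbours of [i], [nn] are vertices without label and the others are chosen in
    [c]. *)
Definition exts_with (c : seq nat) (fresh : nat) (g : pgraph) (i : nat) : seq (nat * pgraph) :=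
  let need := Nat.sub (tgt i) (size (nbr g i)) in
  flatten (map (fun nn =>
      if Nat.leb nn fresh
      then map (fun X => (nn, extend g i nn X)) (subsets (Nat.sub need nn) c)
      else [::])
    (iota 0 need.+1)).

Definition exts (g : pgraph) (i : nat) :=
  exts_with (cand_from i 0 g) (Nat.sub n (size g)) g i.

Fixpoint unsat (j : nat) (g : pgraph) : seq (nat * nat * seq nat) :=
  if g is v :: g' then
    let r := unsat j.+1 g' in
    if v.1 then r else
    match Nat.sub (tgt j) (size v.2) with 0 => r | m => (j, m, v.2) :: r end
  else [::].

Fixpoint count_far (nb : seq nat) (u : seq (nat * nat * seq nat)) (acc : nat) : nat :=
  if u is x :: u' then count_far nb u' (if memn x.1.1 nb then acc else acc.+1) else acc.

(** A missing neighbour of an open label is an unlabelled vertex or another unsaturated label not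
    yet adjacent to it. [count_far] also counts the label itself, which the strict inequality makes
    up for. *)
Definition feasible (g : pgraph) : bool :=
  let u := unsat 0 g in
  let fresh := Nat.sub n (size g) in
  all (fun x => Nat.ltb x.1.2 (count_far x.2 u fresh)) u.
End Extensions.

(** * Integral linear forms and fraction-free elimination *)

Fixpoint addf (f g : seq Z) : seq Z :=
  match f, g with
  | x :: f', y :: g' => Z.add x y :: addf f' g'
  | [::], _ => g
  | _, [::] => f
  end.

Fixpoint zerof (f : seq Z) : bool :=
  if f is x :: f' then (if x is Z0 then zerof f' else false) else true.

Fixpoint unitpos (f : seq Z) (i : nat) : option nat :=
  if f is x :: f' then
    match x with Zpos xH | Zneg xH => Some i | _ => unitpos f' i.+1 end
  else None.
Fixpoint nzpos (f : seq Z) (i : nat) : option nat :=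
  if f is x :: f' then if x is Z0 then nzpos f' i.+1 else Some i else None.
(** A coefficient 1 or -1 is preferred: then no parameter has to be rescaled. *)
Definition pivot f := if unitpos f 0 is Some i then Some i else nzpos f 0.

Fixpoint dropnth {A} (q : nat) (l : seq A) {struct l} : seq A :=
  if l is x :: l' then if q is q'.+1 then x :: dropnth q' l' else l' else [::].

Section Red.
Variable red : Z -> Z.

(** For the pivot coefficient [c] and another coefficient [cj], a pair [u], [w] with
    [u * cj = w * c] and [u] nonzero. Dividing the parameter of [cj] by [u] keeps the substituted
    forms integral; the gcd keeps the factors small. *)
Definition mults (c cj : Z) : Z * Z :=
  match cj with
  | Z0 => ((Zpos xH), Z0)
  | _ => match c with
         | Zpos xH => ((Zpos xH), cj)
         | Zneg xH => ((Zpos xH), Z.opp cj)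
         | _ => (Z.ggcd c cj).2
         end
  end.

Definition comb1 (d x : Z) (uw : Z * Z) : Z :=
  match uw.2 with
  | Z0 => x
  | w => match uw.1 with
         | Zpos xH => red (Z.sub x (Z.mul w d))
         | u => red (Z.sub (Z.mul u x) (Z.mul w d))
         end
  end.

Fixpoint comb (d : Z) (f : seq Z) (m : seq (Z * Z)) : seq Z :=
  match f, m with
  | x :: f', uw :: m' => comb1 d x uw :: comb d f' m'
  | _, _ => [::]
  end.

(** For a unit pivot all multipliers [u] are 1, so that a form without the eliminated parameter only
    loses a zero; otherwise it has to follow the rescaling of the remaining parameters. *)
Definition subst1 (q : nat) (m : seq (Z * Z)) (unit : bool) (f : seq Z) : seq Z :=
  match nth Z0 f q with
  | Z0 => if unit then dropnth q f else comb Z0 (dropnth q f) m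
  | d => comb d (dropnth q f) m
  end.

Definition multl (q : nat) (c : seq Z) := map (mults (nth Z0 c q)) (dropnth q c).

Definition unitz (c : Z) : bool := match c with Zpos xH | Zneg xH => true | _ => false end.

(* Solves [c . t = 0] for the [q]-th parameter and substitutes. *)
Definition eliminate (c : seq Z) (fs : seq (seq Z)) : option (seq (seq Z)) :=
  if pivot c is Some q then
    let m := multl q c in
    let un := unitz (nth Z0 c q) in
    Some (map (subst1 q m un) fs)
  else None.
End Red.

(** The reduction map of the exact computation; the check of the base graphs uses [red13] in its
    place. *)
Definition idZ (z : Z) := z.

Definition rowsum (fs : seq (seq Z)) (i : nat) (nb : seq nat) : seq Z :=
  foldr (fun j acc => addf (nth [::] fs j) acc) (nth [::] fs i) nb.

Definition unitf (np nn i : nat) : seq Z :=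
  nseq np Z0 ++ map (fun j => if eqn j i then (Zpos xH) else Z0) (iota 0 nn).

Definition padforms (fs : seq (seq Z)) (nn : nat) :=
  if nn is 0 then fs else
  let np := size (head [::] fs) in
  map (fun f => f ++ nseq nn Z0) fs ++ map (unitf np nn) (iota 0 nn).

(* A partial graph with, for each label, the coordinate of the kernel vector as a linear form
   in the remaining parameters. *)
Definition state := (pgraph * seq (seq Z))%type.

(* An incomplete label in the end game, when all vertices are labelled: [need] neighbours are
   missing, and [row_sum] is the form of the sum over the known part of the closed neighbourhood. *)
Record row_rec := RowRec
  { lab : nat; need : nat; nbs : seq nat; row_sum : seq Z; form : seq Z }.

(** Each result carries the row sum of [i], its list of neighbours and the updated rows. A row is
    taken only if it still needs a neighbour and is not adjacent to [i]; the test on [size tl']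
    stops as soon as fewer rows than missing neighbours are left. *)
Fixpoint choose_nbrs (m i : nat) (f r : seq Z) (nb : seq nat) (tl : seq row_rec) :
    seq (seq Z * seq nat * seq row_rec) :=
  match m with
  | 0 => [:: (r, nb, tl)]
  | m'.+1 =>
    if tl is x :: tl' then
      if Nat.leb m' (size tl') then
      let skip := map (fun z => (z.1, x :: z.2)) (choose_nbrs m i f r nb tl') in
      match need x with
      | 0 => skip
      | p.+1 =>
        if memn i (nbs x) then skip else
        let x' := RowRec (lab x) p (i :: nbs x) (addf (row_sum x) f) (form x) in
        map (fun z => (z.1, x' :: z.2)) (choose_nbrs m' i f (addf r (form x)) (lab x :: nb) tl')
        ++ skip
      end else [::]
    else [::]
  end.

(** The end game only updates the forms of the open labels. Once the graph is determined, the rows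
    in [l] are therefore eliminated again, in all the forms. A dependent last row is no
    contradiction, since [B] is singular; an earlier one yields a kernel vector with a zero. *)
Fixpoint dead_complete (fs : seq (seq Z)) (l : seq (nat * seq nat)) : bool :=
  if l is x :: l' then
    match eliminate idZ (rowsum fs x.1 x.2) fs with
    | None => if l' is _ :: _ then true else false
    | Some fs' => if has zerof fs' then true else dead_complete fs' l'
    end
  else false.

Fixpoint insert_by (T : Type) (le : rel T) (x : T) (l : seq T) : seq T :=
  if l is y :: l' then if le x y then x :: l else y :: insert_by le x l' else [:: x].
Definition sort_rows := foldr (insert_by (fun x y => Nat.leb (need y) (need x))) [::].

Fixpoint dead_end (fuel : nat) (fs : seq (seq Z)) (dn : seq (nat * seq nat))
    (us : seq row_rec) : bool :=
  if fuel is fuel'.+1 then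
    if sort_rows us is u :: tl then
      all (fun z =>
        let r := z.1.1 in
        let dn' := (lab u, z.1.2) :: dn in
        match pivot r with
        | None => if z.2 is _ :: _ then true else dead_complete fs dn'
        | Some q =>
          let m := multl q r in
          let un := unitz (nth Z0 r q) in
          if z.2 is _ :: _ then
            let tl2 := map (fun x => RowRec (lab x) (need x) (nbs x)
              (subst1 idZ q m un (row_sum x)) (subst1 idZ q m un (form x))) z.2 in
            if has (fun x => zerof (form x)) tl2 then true else dead_end fuel' fs dn' tl2
          else if zerof (subst1 idZ q m un (form u)) then true else dead_complete fs dn'
        end) (choose_nbrs (need u) (lab u) (form u) (row_sum u) (nbs u) tl)
    else false
  else false.

Fixpoint open_rows k (fs : seq (seq Z)) (j : nat) (g : pgraph) : seq row_rec :=
  if g is v :: g' then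
    if v.1 then open_rows k fs j.+1 g' else
    RowRec j (Nat.sub k (size v.2)) v.2 (rowsum fs j v.2) (nth [::] fs j)
      :: open_rows k fs j.+1 g'
  else [::].

(* The first [s] labels are the vertices of [S], all adjacencies between them being known. *)
Section Search.
Variables (n k s : nat).
Let tgtk (_ : nat) := k.

Definition child (i : nat) (fs : seq (seq Z)) (e : nat * pgraph) : seq state :=
  let fs0 := padforms fs e.1 in
  match eliminate idZ (rowsum fs0 i (nbr e.2 i)) fs0 with
  (* In [e.2] the label [i] already counts as complete: only the very last row may depend on the
     others. *)
  | None => if Nat.ltb (nfull e.2) n then [::] else [:: (e.2, fs0)]
  | Some fs' => if has zerof (drop s fs') then [::] else [:: (e.2, fs')]
  end.

Definition children (ok : pgraph -> bool) (i : nat) (fs : seq (seq Z))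
    (es : seq (nat * pgraph)) : seq state :=
  flatten (map (child i fs) (filter (fun e => ok e.2) es)).

Fixpoint dead (fuel w : nat) (st : state) : bool :=
  if fuel is fuel'.+1 then
    if (if Nat.leb n (size st.1) then Nat.leb (Nat.sub n (nfull st.1)) w else false)
    then dead_end n st.2 [::] (open_rows k st.2 0 st.1)
    else
      if pick_from 0 0 0 st.1 is Some i then
        all (dead fuel' w)
          (children (feasible tgtk n) i st.2 (exts tgtk s n st.1 i))
      else false
  else false.

Fixpoint odds (g : pgraph) : nat :=
  if g is v :: g' then (if odd (size v.2) then (odds g').+1 else odds g') else 0.

(* Every vertex outside [S] has evenly many neighbours in [S], so that a label with an odd number
   of them still needs an incomplete one. *)
Definition parity_ok (g : pgraph) : bool :=
  match filter (fun v : pvertex => ~~ v.1) (take s g) with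
  | [::] => eqn (odds (drop s g)) 0
  | [:: v] => eqn (odds (drop s g)) (Nat.sub k (size v.2))
  | l => Nat.leb (odds (drop s g)) (foldr (fun v m => Nat.sub k (size v.2) + m) 0 l)
  end.

Definition stepS (st : state) : seq state :=
  let g := st.1 in
  if firstopen 0 (take s g) is Some i then
    let c := cand_from tgtk s i 0 g in
    (* The last open vertex of [S] gets no new neighbour, and outside [S] only old ones with an odd
       number of known neighbours: any other vertex would end with an odd number of neighbours in
       [S]. *)
    let es := if filter (fun v : pvertex => ~~ v.1) (take s g) is [:: _]
      then exts_with tgtk (filter (fun j => odd (size (nbr g j))) c) 0 g i
      else exts_with tgtk c (Nat.sub n (size g)) g i in
    children parity_ok i st.2 es
  else if pick_from 0 0 0 g is Some i
    then children (feasible tgtk n) i st.2 (exts tgtk s n g i)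
    else [:: st].
End Search.

(* Relabelling by colour refinement: any bijection is sound, the heuristic only has to
   identify many isomorphic states. *)
Fixpoint low (m : nat) (p : positive) : N :=
  if m is m'.+1 then
    match p with
    | xH => Npos xH
    | xO q => N.double (low m' q)
    | xI q => N.succ_double (low m' q)
    end
  else N0.
(** The colours of neighbours are added in [hsum]; scrambling them first keeps different multisets
    apart in most cases. *)
Definition mix (x : N) : N :=
  if x is Npos p then N.lxor (low 11 (Pos.add p (xO p))) (N.div2 (N.div2 x)) else 5%num.
Fixpoint hsum (hs : seq N) (nb : seq nat) (acc : N) : N :=
  if nb is j :: nb' then hsum hs nb' (N.add (nth N0 hs j) acc) else acc.
Fixpoint refine (r : nat) (g : pgraph) (hs : seq N) : seq N :=
  if r is r'.+1 then
    let ms := map mix hs in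
    refine r' g (map (fun p => hsum ms p.1.2 (N.double p.2)) (zip g hs))
  else hs.
Fixpoint color0 (a s j : nat) (g : pgraph) : seq N :=
  if g is v :: g' then
    N.add (if Nat.ltb j a then 1%num else if Nat.ltb j s then 3%num else 5%num)
      (* There are at most 4 known neighbours, so the last entry is free to mark complete labels. *)
      (nth N0 [:: 0; 16; 32; 48; 64; 96]%num (if v.1 then 5 else size v.2))
    :: color0 a s j.+1 g'
  else [::].
Definition sort_keys (l : seq (N * nat)) : seq nat :=
  map snd (foldr (insert_by (fun x y => N.leb x.1 y.1)) [::] l).
Fixpoint position (j : nat) (p : seq nat) : nat :=
  if p is x :: p' then if eqn x j then 0 else (position j p').+1 else 0.

(* The first of the labels sharing the smallest repeated colour. *)
Fixpoint first_tie (hs : seq N) (i : nat) (best : option (N * nat)) : option (N * nat) :=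
  if hs is h :: hs' then
    first_tie hs' i.+1
      (if (if best is Some b then N.ltb h b.1 else true) then
         (if has (N.eqb h) hs' then Some (h, i) else best)
       else best)
  else best.
Fixpoint bump (hs : seq N) (i : nat) : seq N :=
  if hs is h :: hs' then if i is i'.+1 then h :: bump hs' i' else N.add h 7%num :: hs' else [::].
Fixpoint individualize (m : nat) (g : pgraph) (hs : seq N) : seq N :=
  if m is m'.+1 then
    if first_tie hs 0 None is Some hi then individualize m' g (refine 1 g (bump hs hi.2)) else hs
  else hs.

(** Labels are sorted by colour inside three blocks separately, so that the vertices of degree 1 in
    [S], those of degree 3 in [S] and those outside [S] keep their ranges. The first component is a
    hash that serves as search key. *)
Definition labelling (a s r : nat) (g : pgraph) : N * seq nat :=
  let hs := individualize 2 g (refine r g (color0 a s 0 g)) in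
  let keys := zip hs (iota 0 (size g)) in
  (foldr (fun h acc => N.add (mix h) acc) N0 hs,
   sort_keys (take a keys) ++ sort_keys (take (Nat.sub s a) (drop a keys))
     ++ sort_keys (drop s keys)).

Definition relabel (p : seq nat) (st : state) : state :=
  let q := map (fun j => position j p) (iota 0 (size p)) in
  (map (fun j => let v := vx st.1 j in
     (* Sorted lists of neighbours allow [eq_pgraph] to compare them literally. *)
     (v.1, foldr (fun x acc => insert_by Nat.leb (nth 0 q x) acc) [::] v.2)) p,
   map (fun j => nth [::] st.2 j) p).

Fixpoint eq_seqn (l1 l2 : seq nat) : bool :=
  match l1, l2 with
  | [::], [::] => true
  | x :: l1', y :: l2' => eqn x y && eq_seqn l1' l2'
  | _, _ => false
  end.
Fixpoint eq_pgraph (g1 g2 : pgraph) : bool :=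
  match g1, g2 with
  | [::], [::] => true
  | v :: g1', w :: g2' => Bool.eqb v.1 w.1 && eq_seqn v.2 w.2 && eq_pgraph g1' g2'
  | _, _ => false
  end.

Inductive bst := Leaf | Node (h : N) (b : seq state) (l r : bst).
Fixpoint insert_bst (h : N) (st : state) (t : bst) : bst :=
  match t with
  | Leaf => Node h [:: st] Leaf Leaf
  | Node h' b l r =>
    match N.compare h h' with
    | Eq => if has (fun st' => eq_pgraph st.1 st'.1) b then t else Node h' (st :: b) l r
    | Lt => Node h' b (insert_bst h st l) r
    | Gt => Node h' b l (insert_bst h st r)
    end
  end.
Fixpoint flat_bst (t : bst) (acc : seq state) : seq state :=
  if t is Node _ b l r then flat_bst l (b ++ flat_bst r acc) else acc.
(** Only graphs are compared. States with the same partial graph may carry different forms, but all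
    of them are sound, so any one can stand for the others. *)
Definition dedupe (a s r : nat) (l : seq state) : seq state :=
  flat_bst (foldr (fun st t =>
    let hp := labelling a s r st.1 in insert_bst hp.1 (relabel hp.2 st) t) Leaf l) [::].

Fixpoint levels (n k a s : nat) (fl : seq nat) (l : seq state) : seq state :=
  if fl is r :: fl' then
    let l' := flatten (map (stepS n k s) l) in
    levels n k a s fl' (if r is 0 then l' else dedupe a s r l')
  else l.

Section Start.
Variables (a b : nat).
Definition core_deg (i : nat) := if Nat.ltb i a then 1 else 3.
Definition stepC (st : state) : seq state :=
  if firstopen 0 st.1 is Some i
  then map (fun e => (e.2, [::])) (exts core_deg 0 (a + b) st.1 i)
  else [:: st].
Fixpoint cores (m : nat) (l : seq state) : seq state :=
  if m is m'.+1 then cores m' (dedupe a (a + b) 3 (flatten (map stepC l))) else l.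
Definition core0 : state := (nseq (a + b) (false, [::]), [::]).
Definition all_cores : seq state := cores (a + b) [:: core0].
(** A core is complete only inside [S]: its labels are reopened, each with a parameter of its
    own. *)
Definition init_state (st : state) : state :=
  (map (fun v => (false, v.2)) st.1, map (unitf 0 (a + b)) (iota 0 (a + b))).

(* One step is made for each entry [r] of [fl], followed by [r] rounds of colour refinement to
   merge isomorphic states ([0]: no merging); the end game starts at [w] incomplete labels. *)
Definition refuted (n k w : nat) (fl : seq nat) : bool :=
  let cs := all_cores in
  (* Tested rather than proved: the rounds of [cores] have completed every core and, in the next
     line, [fl] was long enough to complete [S]. *)
  all (fun st => all (fun v => v.1) st.1) cs &&
  all (fun st => all (fun v => v.1) (take (a + b) st.1) && dead n k (a + b) n.+1 w st)
    (levels n k a (a + b) fl (map init_state cs)).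
End Start.

(** * Labelled partial graphs *)

Lemma memnE x l : memn x l = (x \in l).
Proof. by elim: l => //= y l ->; rewrite inE eqnE. Qed.

Lemma lebE m n : Nat.leb m n = (m <= n).
Proof. by apply/idP/idP => [/PeanoNat.Nat.leb_le/leP | /leP/PeanoNat.Nat.leb_le]. Qed.

Lemma ltbE m n : Nat.ltb m n = (m < n).
Proof. by rewrite /Nat.ltb lebE. Qed.

(** With [p] the adjacency in the hypothetical graph, this puts its choice of neighbours among the
    enumerated ones. *)
Lemma mem_subsets (p : pred nat) (l : seq nat) :
  filter p l \in subsets (count p l) l.
Proof.
elim: l => //= x l IH; case: (p x) => /=; first by rewrite add1n mem_cat map_f.
rewrite add0n; case: (count p l) IH => [|m] IH; last by rewrite mem_cat IH orbT.
by case: l IH.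
Qed.

Lemma size_link i X Y j g : size (link i X Y j g) = size g.
Proof. by elim: g j => //= v g IH j; rewrite IH. Qed.

Lemma nth_link i X Y j g p : p < size g ->
  vx (link i X Y j g) p =
  if i == j + p then (true, Y ++ nbr g p)
  else if j + p \in X then (full g p, i :: nbr g p) else vx g p.
Proof.
rewrite /vx /full /nbr /vx.
elim: g j p => // v g IH j [|p] /= pg.
  by rewrite addn0 memnE eqnE; case: ifP => // _; case: ifP.
by rewrite IH // addSnnS.
Qed.

Lemma size_extend g i nn X : size (extend g i nn X) = size g + nn.
Proof. by rewrite size_cat size_link size_nseq. Qed.

Lemma vx_extend g i nn X p : p < size g + nn ->
  vx (extend g i nn X) p =
  if p < size g then
    if i == p then (true, (X ++ iota (size g) nn) ++ nbr g p)
    else if p \in X then (full g p, i :: nbr g p) else vx g p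
  else (false, [:: i]).
Proof.
move=> pg; rewrite /vx nth_cat size_link; case: ifP => pg'; first exact: nth_link.
by rewrite nth_nseq ifT //; lia.
Qed.

Lemma nbr_extend g i nn X p : p < size g + nn ->
  nbr (extend g i nn X) p =
  if p < size g then
    if i == p then (X ++ iota (size g) nn) ++ nbr g p
    else if p \in X then i :: nbr g p else nbr g p
  else [:: i].
Proof. by move=> pg; rewrite /nbr vx_extend //; do 3?case: ifP. Qed.

Lemma full_extend g i nn X p : p < size g + nn ->
  full (extend g i nn X) p = (p < size g) && ((i == p) || full g p).
Proof.
move=> pg; rewrite /full vx_extend //.
by case: ifP => //= _; case: eqP => //= _; case: ifP.
Qed.

Section Realizes.
Variables (V : finType) (e : rel V) (D : {pred V}) (tgt : nat -> nat) (v0 : V).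
Hypotheses (e_sym : symmetric e) (e_irr : irreflexive e).

(** [D] is [S] while the cores are built and the whole vertex set afterwards. *)
Definition deg_in x := #|[pred y | (y \in D) && e x y]|.

(* [l] lists the vertices that the labels [0], [1], ... of [g] stand for. *)
Record realizes (l : seq V) (g : pgraph) : Prop := Realizes {
  rz_uniq : uniq l;
  rz_size : size l = size g;
  rz_dom : {subset l <= D};
  rz_lt : forall i j, i < size g -> j \in nbr g i -> j < size g;
  rz_adj : forall i j, i < size g -> j \in nbr g i -> e (nth v0 l i) (nth v0 l j);
  rz_nuniq : forall i, i < size g -> uniq (nbr g i);
  rz_sym : forall i j, i < size g -> j \in nbr g i -> i \in nbr g j;
  rz_full : forall i, i < size g -> full g i -> tgt i <= size (nbr g i);
  rz_deg : forall i, i < size g -> deg_in (nth v0 l i) = tgt i }.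

Section Theory.
Variables (l : seq V) (g : pgraph).
Hypothesis lg : realizes l g.

Lemma map_nbr_uniq i : i < size g -> uniq (map (nth v0 l) (nbr g i)).
Proof.
move=> ig; rewrite map_inj_in_uniq ?(rz_nuniq lg) // => j j' /(rz_lt lg ig) jg /(rz_lt lg ig) j'g.
by move/eqP; rewrite nth_uniq ?(rz_size lg) ?(rz_uniq lg) // => /eqP.
Qed.

Lemma map_nbr_sub i : i < size g ->
  {subset map (nth v0 l) (nbr g i) <= [pred y | (y \in D) && e (nth v0 l i) y]}.
Proof.
move=> ig _ /mapP[j jn ->]; rewrite inE (rz_adj lg ig jn) andbT.
by apply/(rz_dom lg)/mem_nth; rewrite (rz_size lg) (rz_lt lg ig).
Qed.

Lemma nbr_size_le i : i < size g -> size (nbr g i) <= tgt i.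
Proof.
move=> ig; rewrite -(rz_deg lg ig) -(size_map (nth v0 l)).
rewrite -(card_uniqP (map_nbr_uniq ig)); apply/subset_leq_card/fintype.subsetP; exact: map_nbr_sub.
Qed.

(** The known neighbours form a subset of the true neighbourhood of the same size. *)
Lemma nbr_complete i w : i < size g -> tgt i <= size (nbr g i) -> w \in D ->
  e (nth v0 l i) w -> exists2 j, j \in nbr g i & w = nth v0 l j.
Proof.
move=> ig it wD iw; apply/mapP.
have sub : map (nth v0 l) (nbr g i) \subset [pred y | (y \in D) && e (nth v0 l i) y].
  by apply/fintype.subsetP; apply: map_nbr_sub.
have cardE : #|map (nth v0 l) (nbr g i)| = #|[pred y | (y \in D) && e (nth v0 l i) y]|.
  apply/eqP; rewrite (card_uniqP (map_nbr_uniq ig)) size_map -/(deg_in _) (rz_deg lg ig).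
  by rewrite eqn_leq nbr_size_le.
by rewrite (subset_cardP cardE sub) inE wD.
Qed.

Lemma adj_label i j : i < size g -> tgt i <= size (nbr g i) -> j < size g ->
  e (nth v0 l i) (nth v0 l j) -> j \in nbr g i.
Proof.
move=> ig it jg ij.
have jD : nth v0 l j \in D by apply/(rz_dom lg)/mem_nth; rewrite (rz_size lg).
have [j' j'n /eqP] := nbr_complete ig it jD ij.
by rewrite nth_uniq ?(rz_size lg) ?(rz_uniq lg) ?(rz_lt lg ig j'n) // => /eqP->.
Qed.

Lemma nbr_irr i j : i < size g -> j \in nbr g i -> j != i.
Proof. by move=> ig /(rz_adj lg ig); apply: contraTneq => ->; rewrite e_irr. Qed.
End Theory.

(** The true neighbourhood of the vertex labelled [i] splits into the known neighbours, the old
    labels [X] and the unlabelled vertices [nw], which receive the next labels. This is the branch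
    that the enumeration must contain. *)
Lemma extend_realizes l g i c fresh :
    realizes l g -> i < size g ->
    uniq c -> (forall j, j \in c -> [/\ j < size g, ~~ full g j & j \notin nbr g i]) ->
    (forall j, j < size g -> e (nth v0 l i) (nth v0 l j) -> j \notin nbr g i -> j \in c) ->
    (forall w, w \in D -> e (nth v0 l i) w -> w \notin l -> forall j, deg_in w = tgt j) ->
    #|[pred w | (w \in D) && (e (nth v0 l i) w && (w \notin l))]| <= fresh ->
  exists nw, let nn := size nw in
    let X := [seq j <- c | e (nth v0 l i) (nth v0 l j)] in
    [/\ realizes (l ++ nw) (extend g i nn X),
        (nn, extend g i nn X) \in exts_with tgt c fresh g i &
        forall w, w \in nw = [&& w \in D, e (nth v0 l i) w & w \notin l]].
Proof.
move=> lg ig cU cP cC newdeg freshP; set x := nth v0 l i.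
pose nw := enum [pred w | (w \in D) && (e x w && (w \notin l))]; exists nw => nn X.
have sl := rz_size lg.
have nwE w : w \in nw = [&& w \in D, e x w & w \notin l] by rewrite mem_enum inE.
have nnE : nn = #|[pred w | (w \in D) && (e x w && (w \notin l))]| by rewrite [RHS]cardE.
have XE j : j \in X = (e x (nth v0 l j)) && (j \in c) by rewrite mem_filter.
have XU : uniq X by rewrite filter_uniq.
have Xlt j : j \in X -> j < size g by rewrite XE => /andP[_ /cP[]].
have nth_old j : j < size g -> nth v0 (l ++ nw) j = nth v0 l j by move=> jg; rewrite nth_cat sl jg.
have nth_new j : size g <= j -> j < size g + nn ->
    [&& nth v0 (l ++ nw) j \in D, e x (nth v0 (l ++ nw) j) & nth v0 (l ++ nw) j \notin l].
  by move=> gj jn; rewrite nth_cat sl ltnNge gj -nwE mem_nth // -/nn; lia.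
have iX : i \notin X by rewrite XE /x e_irr.
have nbrE := @nbr_extend g i nn X.
have fullE := @full_extend g i nn X.
have sE : size (extend g i nn X) = size g + nn by rewrite size_extend.
have UlN : uniq (l ++ nw).
  rewrite cat_uniq (rz_uniq lg) enum_uniq andbT -all_predC; apply/allP => w.
  by rewrite nwE => /and3P[].
have newU : uniq ((X ++ iota (size g) nn) ++ nbr g i).
  rewrite cat_uniq cat_uniq XU iota_uniq (rz_nuniq lg ig) !andbT; apply/andP; split.
    by apply/hasP => -[j]; rewrite mem_iota => /andP[gj _] /Xlt; rewrite ltnNge gj.
  apply/hasP => -[j jn]; rewrite mem_cat mem_iota => /orP[]; last first.
    by have := rz_lt lg ig jn; lia.
  by rewrite XE => /andP[_ /cP[_ _]]; rewrite jn.
have newadj j : j \in (X ++ iota (size g) nn) ++ nbr g i ->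
    j < size g + nn /\ e x (nth v0 (l ++ nw) j).
  rewrite !mem_cat mem_iota => /orP[/orP[jX|/andP[gj jn]]|jn].
  - have jg := Xlt _ jX; split; first by lia.
    by rewrite nth_old //; move: jX; rewrite XE => /andP[].
  - by split=> //; have /and3P[] := nth_new _ gj jn.
  - have jg := rz_lt lg ig jn; split; first by lia.
    by rewrite nth_old // (rz_adj lg ig).
(* The three parts exhaust the neighbourhood, so their total size is the degree; this later fixes
   how many old labels are chosen. *)
have newsize : size ((X ++ iota (size g) nn) ++ nbr g i) = tgt i.
  rewrite -(rz_deg lg ig) -(size_map (nth v0 (l ++ nw))).
  have mU : uniq (map (nth v0 (l ++ nw)) ((X ++ iota (size g) nn) ++ nbr g i)).
    rewrite map_inj_in_uniq // => j j' /newadj[jg _] /newadj[j'g _] /eqP.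
    by rewrite nth_uniq ?size_cat ?sl // => /eqP.
  rewrite -(card_uniqP mU); apply: eq_card => w; rewrite inE.
  apply/mapP/idP => [[j /newadj[jg xj] ->]|/andP[wD xw]].
    rewrite xj andbT; case: (ltnP j (size g)) => jg'; last by have /and3P[] := nth_new _ jg' jg.
    by rewrite nth_old //; apply/(rz_dom lg)/mem_nth; rewrite sl.
  case: (boolP (w \in l)) => wl.
    have wlg : index w l < size g by rewrite -sl index_mem.
    exists (index w l); last by rewrite nth_old // nth_index.
    rewrite !mem_cat; case: (boolP (index w l \in nbr g i)) => jn; first by rewrite !orbT.
    rewrite XE nth_index // xw /= (cC (index w l)) //.
    by rewrite nth_index.
  have wn : w \in nw by rewrite nwE wD xw.
  exists (size g + index w nw); last by rewrite nth_cat sl ltnNge leq_addr /= addKn nth_index.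
  by rewrite !mem_cat mem_iota leq_addr ltn_add2l index_mem wn orbT.
split; last exact: nwE.
  split=> //; rewrite ?sE.
  - by rewrite size_cat sl.
  - move=> w; rewrite mem_cat => /orP[/(rz_dom lg)//|]; by rewrite nwE => /and3P[].
  - move=> p j pg; rewrite nbrE //; case: ifP => pg'; last by rewrite inE => /eqP->; lia.
    case: eqP => [<- /newadj[]//|_]; case: ifP => _; rewrite ?inE => jn.
      by case/orP: jn => [/eqP->|/(rz_lt lg pg')]; lia.
    by have := rz_lt lg pg' jn; lia.
  - move=> p j pg; rewrite nbrE //; case: ifP => pg'.
      rewrite [in X in e X _]nth_old //.
      case: eqP => [<- /newadj[]//|_]; case: ifP => pX; rewrite ?inE.
        case/orP => [/eqP->|jn]; last by rewrite nth_old ?(rz_lt lg pg') ?(rz_adj lg pg').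
        by rewrite nth_old // e_sym; move: pX; rewrite XE => /andP[].
      by move=> jn; rewrite nth_old ?(rz_lt lg pg') ?(rz_adj lg pg').
    rewrite inE => /eqP->; rewrite [in X in e _ X]nth_old // e_sym.
    have gp : size g <= p by rewrite leqNgt pg'.
    by have /and3P[] := nth_new _ gp pg.
  - move=> p pg; rewrite nbrE //; case: ifP => // pg'; case: eqP => [<- //|/eqP ip].
    case: ifP => pX; rewrite /= ?(rz_nuniq lg pg') ?andbT //.
    apply/negP => /(rz_sym lg pg') pn.
    by move: pX; rewrite XE => /andP[_ /cP[_ _]]; rewrite pn.
  - move=> p j pg; rewrite nbrE //; case: ifP => pg'.
      case: eqP => [<- jn|/eqP ip].
        have [jg _] := newadj _ jn; rewrite nbrE //; move: jn; rewrite !mem_cat mem_iota.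
        case/orP => [/orP[jX|/andP[gj _]]|jn].
        + rewrite (Xlt _ jX) jX; case: eqP => [ij|_]; last by rewrite inE eqxx.
          by rewrite ij jX in iX.
        + by rewrite ltnNge gj inE.
        + rewrite (rz_lt lg ig jn); case: eqP => [ij|_].
            by have := nbr_irr lg ig jn; rewrite -ij eqxx.
          by case: ifP => _; rewrite ?inE (rz_sym lg ig jn) ?orbT.
      have symold j' : j' \in nbr g p -> p \in nbr (extend g i nn X) j'.
        move=> jn; have jg := rz_lt lg pg' jn; rewrite nbrE ?jg; last by lia.
        case: eqP => [_|_]; first by rewrite mem_cat (rz_sym lg pg' jn) orbT.
        by case: ifP => _; rewrite ?inE (rz_sym lg pg' jn) ?orbT.
      case: ifP => pX; rewrite ?inE; last exact: symold.
      case/orP => [/eqP->|]; last exact: symold.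
      by rewrite nbrE ?ig ?eqxx ?mem_cat ?pX //; lia.
    rewrite inE => /eqP->; rewrite nbrE ?ig ?eqxx; last by lia.
    by rewrite !mem_cat mem_iota pg; move: pg'; lia.
  - move=> p pg; rewrite fullE // nbrE // => /andP[pg']; rewrite pg'.
    case: eqP => [<- _|_ /= fp]; first by rewrite newsize.
    by case: ifP => _ /=; rewrite ?(leqW (rz_full lg pg' fp)) ?(rz_full lg pg' fp).
  - move=> p pg; case: (ltnP p (size g)) => pg'; first by rewrite nth_old // (rz_deg lg).
    by have /and3P[wD xw wl] := nth_new _ pg' pg; apply: newdeg wD xw wl _.
rewrite /exts_with; apply/flattenP; exists (map (fun X => (nn, extend g i nn X)) (subsets (tgt i - size (nbr g i) - nn) c)); last first.
  apply: map_f; have -> : tgt i - size (nbr g i) - nn = count (fun j => e x (nth v0 l j)) c.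
    by rewrite -newsize !size_cat size_iota size_filter; lia.
  exact: mem_subsets.
apply/mapP; exists nn; first by rewrite mem_iota -newsize !size_cat size_iota; lia.
by rewrite lebE nnE freshP.
Qed.
End Realizes.

Import Order.TTheory GRing.Theory Num.Theory.

(** * Rational kernel vectors *)

Local Open Scope ring_scope.

Definition nbr_sum (F : fieldType) (G : sgraph) (v : G -> F) (x : G) : F :=
  \sum_(y | adj x y) v y.

Definition rat_nut (G : sgraph) : Prop :=
  (1 < #|G|)%N /\ exists v : G -> rat,
    [/\ forall x, v x != 0,
        forall x, nbr_sum v x = 0
      & forall z, (forall x, nbr_sum z x = 0) -> exists c, forall x, z x = c * v x].

Definition adj_mx (F : fieldType) (G : sgraph) : 'M[F]_#|G| :=
  \matrix_(i, j) (adj (enum_val i) (enum_val j))%:R.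

Lemma ker_adj_mxP (F : fieldType) (G : sgraph) (u : 'rV[F]_#|G|) :
  reflect (forall x, nbr_sum (fun y => u 0 (enum_rank y)) x = 0)
          (u <= kermx (adj_mx F G))%MS.
Proof.
apply: (iffP sub_kermxP) => [/rowP uA x | uA].
  have := uA (enum_rank x); rewrite !mxE => <-; rewrite /nbr_sum.
  rewrite [RHS](reindex enum_rank) /=; last first.
    by exists enum_val => i _; rewrite ?enum_valK ?enum_rankK.
  rewrite big_mkcond; apply: eq_bigr => y _.
  by rewrite mxE !enum_rankK adj_sym; case: adj; rewrite ?mulr1 ?mulr0.
apply/rowP => i; rewrite !mxE -[RHS](uA (enum_val i)) /nbr_sum.
rewrite (reindex enum_rank) /=; last first.
  by exists enum_val => j _; rewrite ?enum_valK ?enum_rankK.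
rewrite [RHS]big_mkcond; apply: eq_bigr => y _.
by rewrite mxE enum_rankK adj_sym; case: adj; rewrite ?mulr1 ?mulr0.
Qed.

Lemma rank1_eqmx (F : fieldType) m n (K : 'M[F]_(m, n)) (u : 'rV[F]_n) :
  \rank K = 1%N -> (u <= K)%MS -> u != 0 -> (K :=: u)%MS.
Proof.
move=> rkK uK u0; apply: eqmx_sym; apply/eqmxP.
by rewrite -(geq_leqif (mxrank_leqif_eq uK)) rkK rank_rV u0.
Qed.

(** Extension of scalars preserves ranks, so the real kernel is spanned by a rational vector; being
    a nonzero multiple of the given one, it has no zeros either. *)
Lemma nut_graph_rat (R : realType) (G : sgraph) : nut_graph R G <-> rat_nut G.
Proof.
have kE : kermx (adjmx R G) = map_mx ratr (kermx (adj_mx rat G)).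
  rewrite map_kermx; congr kermx.
  by apply/matrixP => i j; rewrite !mxE rmorph_nat.
have card0 : (1 < #|G|)%N -> 'I_#|G| by move=> n1; exact: Ordinal (ltnW n1).
split=> [[n1 rk1 [v [v0 kv]]] | [n1 [v [v0 vA vuniq]]]].
  have rkQ : \rank (kermx (adj_mx rat G)) = 1%N by rewrite -rk1 kE mxrank_map.
  have /rowV0Pn[u uK u0] : kermx (adj_mx rat G) != 0 by rewrite -mxrank_eq0 rkQ.
  have spanE := rank1_eqmx rkQ uK u0.
  split=> //; exists (fun x => u 0 (enum_rank x)); split.
  - move=> x; have : (map_mx ratr u <= v)%MS by rewrite -kv kE map_submx.
    case/sub_rVP => c cE; apply/eqP => ux0.
    have := congr1 (fun w : 'rV[R]__ => w 0 (enum_rank x)) cE.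
    rewrite !mxE ux0 rmorph0 => /esym/eqP; rewrite mulf_eq0 (negPf (v0 _)) orbF => /eqP c0.
    by move: u0; rewrite -(map_mx_eq0 (ratr : {rmorphism rat -> R})) cE c0 scale0r eqxx.
  - exact/ker_adj_mxP.
  - move=> z zA; pose w : 'rV_#|G| := \row_i z (enum_val i).
    have : (w <= kermx (adj_mx rat G))%MS.
      apply/ker_adj_mxP => x; rewrite -[RHS](zA x); apply: eq_bigr => y _.
      by rewrite mxE enum_rankK.
    rewrite spanE => /sub_rVP[c wE]; exists c => x.
    by have := congr1 (fun w : 'rV_ _ => w 0 (enum_rank x)) wE; rewrite !mxE enum_rankK.
pose w : 'rV[rat]_#|G| := \row_i v (enum_val i).
have wK : (w <= kermx (adj_mx rat G))%MS.
  apply/ker_adj_mxP => x; rewrite -[RHS](vA x); apply: eq_bigr => y _.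
  by rewrite mxE enum_rankK.
have w0 : w != 0.
  apply/eqP => /rowP/(_ (card0 n1)); rewrite !mxE => /eqP.
  by rewrite (negPf (v0 _)).
have spanE : (kermx (adj_mx rat G) :=: w)%MS.
  apply: eqmx_sym; apply/eqmxP/andP; split=> //.
  apply/row_subP => i; have /ker_adj_mxP/vuniq[c cE] := row_sub i (kermx (adj_mx rat G)).
  apply/sub_rVP; exists c; apply/rowP => j.
  by have := cE (enum_val j); rewrite enum_valK => ->; rewrite !mxE.
split=> //; first by rewrite kE mxrank_map spanE rank_rV w0.
exists (map_mx ratr w); split; first by move=> i; rewrite !mxE fmorph_eq0.
by rewrite kE; apply: eqmx_trans (eqmx_refl _); apply/eqmxP; rewrite !map_submx; apply/eqmxP.
Qed.

(** * The Fowler construction *)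

Section Fowler.
Variables (G : sgraph) (v0 : G).
Notation N := {y : G | adj v0 y}.
Notation W := (G + (N + N))%type.

(** [v0] is detached from its neighbours and joined to a first copy of [N], each neighbour is joined
    to its own vertex in a second copy, and the two copies span a complete bipartite graph minus a
    perfect matching. *)
Definition fowler_adj (s t : W) : bool :=
  match s, t with
  | inl x, inl y => [&& x != v0, y != v0 & adj x y]
  | inl x, inr (inl _) | inr (inl _), inl x => x == v0
  | inl x, inr (inr i) | inr (inr i), inl x => x == val i
  | inr (inl i), inr (inr j) | inr (inr i), inr (inl j) => i != j
  | _, _ => false
  end.

Fact fowler_sym : symmetric fowler_adj.
Proof.
by case=> [x|[i|i]] [y|[j|j]] //=; rewrite 1?adj_sym 1?andbCA // eq_sym.
Qed.

Fact fowler_irr : irreflexive fowler_adj.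
Proof. by case=> [x|[i|i]] //=; rewrite adj_irr !andbF. Qed.

Definition fowler : sgraph := SGraph fowler_sym fowler_irr.

Lemma card_nbr_sig : #|{: N}| = #|[pred y | adj v0 y]|.
Proof. by rewrite card_sig. Qed.

Lemma nbr_neq (i : N) : (val i == v0) = false.
Proof. by apply/negbTE/eqP => iv; have := valP i; rewrite /= iv adj_irr. Qed.

Lemma sum_except (M : nmodType) (f : G -> M) x :
  \sum_(y | adj x y) f y = \sum_(y | (y != v0) && adj x y) f y + (if adj x v0 then f v0 else 0).
Proof.
case: ifP => xv; last first.
  rewrite addr0; apply: eq_bigl => y; have [->|//] := eqVneq y v0; exact: xv.
by rewrite (bigD1 v0) //= addrC; congr (_ + _); apply: eq_bigl => y; rewrite andbC.
Qed.

Lemma sum_nbr_sig (M : nmodType) (f : G -> M) :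
  \sum_(i : N) f (val i) = \sum_(y | adj v0 y) f y.
Proof.
rewrite [RHS](reindex_omap (val : N -> G) insub) => [|i vi]; last by rewrite insubT.
by apply: eq_bigl => -[i vi] /=; rewrite vi insubT /= eqxx.
Qed.

Lemma sum_eq_val (M : nmodType) (g : N -> M) (f : G -> M) x :
  (forall i, g i = f (val i)) ->
  \sum_(i : N | x == val i) g i = if adj v0 x then f x else 0.
Proof.
move=> gf; case: ifP => xv.
  rewrite (big_pred1 (Sub x xv : N)) => [|i]; first by rewrite gf.
  by rewrite /= -val_eqE /= eq_sym.
by rewrite big_pred0 // => i; apply/eqP => xi; move: xv; rewrite xi (valP i).
Qed.

Lemma fowler_sum (M : nmodType) (f : W -> M) (s : W) :
  \sum_(t | fowler_adj s t) f t =
  match s with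
  | inl x => \sum_(y | [&& x != v0, y != v0 & adj x y]) f (inl y)
      + (\sum_(i | x == v0) f (inr (inl i)) + \sum_(i | x == val i) f (inr (inr i)))
  | inr (inl i) => f (inl v0) + \sum_(j | i != j) f (inr (inr j))
  | inr (inr i) => f (inl (val i)) + \sum_(j | i != j) f (inr (inl j))
  end.
Proof.
rewrite big_sumType big_sumType /=.
case: s => [x|[i|i]] //=.
  by rewrite big_pred1_eq big_pred0_eq add0r.
by rewrite big_pred1_eq big_pred0_eq addr0.
Qed.

Lemma fowler_card d : #|[pred y | adj v0 y]| = d -> #|fowler| = (#|G| + (d + d))%N.
Proof. by move=> vd; rewrite card_sum card_sum card_nbr_sig vd. Qed.

Lemma sum1_N d : #|[pred y | adj v0 y]| = d -> forall i : N, (\sum_(j | i != j) 1 = d.-1)%N.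
Proof.
move=> vd i; rewrite sum1_card -vd -card_nbr_sig [in RHS](cardD1 i) /=.
by apply: eq_card => j; rewrite !inE andbT eq_sym.
Qed.

Lemma fowler_regular d : (0 < d)%N -> regular d G -> regular d fowler.
Proof.
move=> d0 regG s; rewrite -sum1_card.
transitivity (\sum_(t | fowler_adj s t) (fun=> 1%N : nat) t)%R; first exact: eq_bigl.
rewrite fowler_sum; case: s => [x|[i|i]]; last 2 first.
- by rewrite [X in _ + X](sum1_N (regG v0)) -[RHS](prednK d0).
- by rewrite [X in _ + X](sum1_N (regG v0)) -[RHS](prednK d0).
have [->|xv] /= := eqVneq x v0.
  rewrite big_pred0_eq add0r [X in X + _]sum1_card card_nbr_sig regG big_pred0 ?addr0 //.
  by move=> i; rewrite eq_sym nbr_neq.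
rewrite big_pred0_eq add0r (sum_eq_val (f := fun=> 1%N)) // -(regG x) -sum1_card.
transitivity (\sum_(y | adj x y) (fun=> 1%N : nat) y)%R; last exact: eq_bigl.
by rewrite sum_except adj_sym.
Qed.

Lemma sum_ne (M : zmodType) (g : N -> M) i :
  \sum_(j | i != j) g j = \sum_j g j - g i.
Proof.
rewrite [\sum_j g j](bigD1 i) //= addrC addrK.
by apply: eq_bigl => j; rewrite eq_sym.
Qed.

Lemma fowler_rat_nut d : (1 < d)%N -> regular d G -> rat_nut G -> rat_nut fowler.
Proof.
move=> d1 regG [n1 [v [vn0 vA vuniq]]]; have d0 := ltnW d1.
have cN : #|{: N}| = d by rewrite card_nbr_sig regG.
split; first by rewrite (fowler_card (regG v0)) ltn_addr.
(* The rows of the first copy force the factor [1 - d] at [v0]; those of the second copy hold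
   because [v] sums to zero over the neighbours of [v0]. *)
pose w (s : W) : rat := match s with
  | inl x => if x == v0 then (1 - d%:R) * v v0 else v x
  | inr (inl i) => v (val i) | inr (inr i) => v v0 end.
exists w; split.
- case=> [x|[i|i]] //=; case: ifP => // _; rewrite mulf_neq0 // subr_eq0.
  by rewrite eq_sym pnatr_eq1 neq_ltn d1 orbT.
- move=> s; rewrite /nbr_sum (eq_bigl (fun t => fowler_adj s t)) // fowler_sum.
  case: s => [x|[i|i]]; last 2 first.
  + by rewrite /= eqxx sum_ne sumr_const cN -[v v0 *+ d]mulr_natl; ring.
  + by rewrite /= nbr_neq sum_ne sum_nbr_sig [X in X - _]vA sub0r addrN.
  have [->|xv] /= := eqVneq x v0.
    rewrite big_pred0_eq add0r sum_nbr_sig [X in X + _]vA add0r big_pred0 //.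
    by move=> i; rewrite eq_sym nbr_neq.
  rewrite big_pred0_eq add0r (sum_eq_val (f := fun=> v v0)) // adj_sym -[RHS](vA x).
  rewrite /nbr_sum sum_except; congr (_ + _).
  by apply: eq_bigr => y /andP[/negPf->].
move=> z zA.
have eqn s := zA s; rewrite /nbr_sum in eqn.
have {}eqn s := etrans (esym (etrans (eq_bigl (fun t => fowler_adj s t) _ (fun=> erefl)) (fowler_sum z s))) (eqn s).
have eqv : \sum_i z (inr (inl i)) = 0.
  have := eqn (inl v0); rewrite /= eqxx /= big_pred0_eq add0r [X in _ + X]big_pred0 ?addr0 //.
  by move=> i; rewrite eq_sym nbr_neq.
have eqq (i : N) : z (inr (inl i)) = z (inl (val i)).
  by have := eqn (inr (inr i)); rewrite /= sum_ne eqv sub0r => /eqP; rewrite subr_eq0 => /eqP.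
have [i0 _] : exists i : N, true.
  have : (0 < #|{: N}|)%N by rewrite cN.
  by case/card_gt0P => i; exists i.
have eqp i : z (inr (inr i)) = z (inr (inr i0)).
  have := eqn (inr (inl i)); have := eqn (inr (inl i0)); rewrite /= !sum_ne => e1 e2.
  by have /addrI/addrI/oppr_inj-> := etrans e1 (esym e2).
have eqv0 : z (inl v0) = (1 - d%:R) * z (inr (inr i0)).
  have := eqn (inr (inl i0)); rewrite /= sum_ne (eq_bigr _ (fun i _ => eqp i)) sumr_const cN.
  by rewrite -mulr_natl => /eqP; rewrite addr_eq0 => /eqP->; ring.
(* [z] is constant on the second copy. Put at [v0], this constant turns [z] into a kernel vector of
   [G]: the neighbours of [v0] see it through the second copy, and the row of [v0] is the sum over
   the first copy. *)
have [c cE] : exists c, forall x, (if x == v0 then z (inr (inr i0)) else z (inl x)) = c * v x.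
  apply: vuniq => x; rewrite /nbr_sum.
  have [->|xv] := eqVneq x v0.
    rewrite -[RHS]eqv (eq_bigr _ (fun i _ => eqq i)) (sum_nbr_sig (fun y => z (inl y))).
    by apply: eq_bigr => y vy; case: eqP vy => // ->; rewrite adj_irr.
  have := eqn (inl x); rewrite /= xv (negPf xv) big_pred0_eq add0r.
  rewrite (sum_eq_val (f := fun=> z (inr (inr i0)))) // adj_sym => e.
  rewrite -[RHS]e sum_except eqxx; congr (_ + _).
  by apply: eq_bigr => y /andP[/negPf->].
have cv0 : z (inr (inr i0)) = c * v v0 by have := cE v0; rewrite eqxx.
exists c => -[x|[i|i]] /=.
- by case: eqP => [->|/eqP/negPf xv]; [rewrite eqv0 cv0; ring | rewrite -cE xv].
- by rewrite eqq -cE nbr_neq.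
- by rewrite eqp.
Qed.
End Fowler.

(** * Linear forms *)

Section Forms.
Variables (F : fieldType) (phi : Z -> F) (red : Z -> Z).
Hypotheses (phi0 : phi Z0 = 0) (phi1 : phi (Zpos xH) = 1)
  (phiD : forall x y, phi (Z.add x y) = phi x + phi y)
  (phiM : forall x y, phi (Z.mul x y) = phi x * phi y)
  (phi_red : forall x, phi (red x) = phi x).

Lemma phiN x : phi (Z.opp x) = - phi x.
Proof. by apply/eqP; rewrite -addr_eq0 -phiD Z.add_opp_diag_l phi0. Qed.

Lemma phiB x y : phi (Z.sub x y) = phi x - phi y.
Proof. by rewrite -Z.add_opp_r phiD phiN. Qed.

(** [phi] is the embedding [ratZ] in the search and the reduction [F13Z] modulo 13 for the base
    graphs. *)
Fixpoint dot (f : seq Z) (t : nat -> F) : F :=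
  if f is c :: f' then phi c * t 0%N + dot f' (t \o succn) else 0.

Lemma eq_dot f t t' : t =1 t' -> dot f t = dot f t'.
Proof. by elim: f t t' => //= c f IH t t' E; rewrite E (IH _ (t' \o succn)) // => j /=. Qed.

Lemma eq_dot_size f t t' : (forall j, (j < size f)%N -> t j = t' j) -> dot f t = dot f t'.
Proof.
elim: f t t' => //= c f IH t t' E; rewrite E //; congr (_ + _).
by apply: IH => j jf; apply: E.
Qed.

Lemma dot_addf f g t : dot (addf f g) t = dot f t + dot g t.
Proof.
elim: f g t => [|x f IH] [|y g] t; rewrite ?add0r ?addr0 //=.
by rewrite IH phiD; ring.
Qed.

Lemma dot_zerof f t : zerof f -> dot f t = 0.
Proof. by elim: f t => //= -[] //= f IH t /IH->; rewrite phi0 mul0r addr0. Qed.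

Lemma dot_cat f g t : dot (f ++ g) t = dot f t + dot g (fun j => t (size f + j)%N).
Proof.
elim: f t => [|x f IH] t /=; first by rewrite add0r; apply: eq_dot.
by rewrite IH addrA.
Qed.

Lemma dot_nseq0 m t : dot (nseq m Z0) t = 0.
Proof. by elim: m t => //= m IH t; rewrite IH phi0 mul0r addr0. Qed.

Lemma dot_map_red f t : dot (map red f) t = dot f t.
Proof. by elim: f t => //= x f IH t; rewrite IH phi_red. Qed.

Lemma dot_indicator (m j0 i : nat) t :
  dot (map (fun j => if eqn j i then (Zpos xH) else Z0) (iota j0 m)) t =
  if (j0 <= i < j0 + m)%N then t (i - j0)%N else 0.
Proof.
elim: m j0 t => [|m IH] j0 t /=; first by case: ifP => //; lia.
rewrite IH /= eqnE; have [->|ne] := eqVneq j0 i.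
  rewrite phi1 mul1r subnn; case: ifP => [|_]; first by lia.
  by rewrite addr0; case: ifP => //; lia.
rewrite phi0 mul0r add0r.
case: ifP => h1; case: ifP => h2 //; try lia.
by congr t; lia.
Qed.

Lemma dot_unitf np nn i t : (i < nn)%N -> dot (unitf np nn i) t = t (np + i)%N.
Proof.
move=> inn; rewrite dot_cat dot_nseq0 add0r dot_indicator size_nseq ifT; last by lia.
by rewrite subn0.
Qed.

Lemma pivot_some c q : pivot c = Some q -> (q < size c)%N /\ nth Z0 c q <> Z0.
Proof.
have unitP i : unitpos c i = Some q -> (i <= q < i + size c)%N /\ nth Z0 c (q - i) <> Z0.
  elim: c i => //= x c IH i.
  have rec : unitpos c i.+1 = Some q -> (i <= q < i + (size c).+1)%N /\ nth Z0 (x :: c) (q - i) <> Z0.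
    move=> /IH[qi nz]; split; first by lia.
    by have -> : (q - i = (q - i.+1).+1)%N by lia.
  by case: x rec => [|[p|p|]|[p|p|]] // _ [<-]; rewrite subnn; split=> //; lia.
have nzP i : nzpos c i = Some q -> (i <= q < i + size c)%N /\ nth Z0 c (q - i) <> Z0.
  elim: c i {unitP} => //= x c IH i.
  case: x => [/IH[qi nz]|p [<-]|p [<-]]; last 2 first.
  - by rewrite subnn; split=> //; lia.
  - by rewrite subnn; split=> //; lia.
  split; first by lia.
  by have -> : (q - i = (q - i.+1).+1)%N by lia.
rewrite /pivot; case E: unitpos => [i|] => [[iq]|/nzP]; last by rewrite subn0.
by have := unitP 0%N; rewrite E iq subn0; apply.
Qed.

Lemma pivot_none c : pivot c = None -> zerof c.
Proof.
rewrite /pivot; case: unitpos => // H; suff: forall i, nzpos c i = None -> zerof c by move/(_ _ H).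
by elim: c {H} => //= -[] //= c IH i /IH.
Qed.

Lemma size_dropnth A q (f : seq A) : (q < size f)%N -> size (dropnth q f) = (size f).-1.
Proof. by elim: f q => // x f IH [|q] //= qf; rewrite IH //; case: (f) qf. Qed.

Definition skip (q j : nat) := if (j < q)%N then j else j.+1.

Lemma dot_dropnth q f t : (q < size f)%N ->
  dot f t = phi (nth Z0 f q) * t q + dot (dropnth q f) (t \o skip q).
Proof.
elim: f q t => // x f IH [|q] t /= qf; first by [].
rewrite (IH q) // addrCA; congr (_ + (_ + _)).
by apply: eq_dot => j /=; rewrite /skip ltnS; case: ifP.
Qed.

Lemma multsP c cj : phi c != 0 ->
  Z.mul (mults c cj).1 cj = Z.mul (mults c cj).2 c /\ phi (mults c cj).1 != 0.
Proof.
move=> c0.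
have gg : Z.mul (Z.ggcd c cj).2.1 cj = Z.mul (Z.ggcd c cj).2.2 c /\ phi (Z.ggcd c cj).2.1 != 0.
  have := Z.ggcd_correct_divisors c cj; case: Z.ggcd => g [u w] /= [cE cjE].
  split; first by rewrite cE cjE; lia.
  by apply: contraNneq c0 => u0; rewrite cE phiM u0 mulr0.
rewrite /mults; case: cj gg => [|p|p] gg; first by rewrite /= phi1 oner_eq0.
  by case: c c0 gg => [|[c|c|]|[c|c|]] //= c0 gg; rewrite ?phi1 ?oner_eq0; split=> //; lia.
by case: c c0 gg => [|[c|c|]|[c|c|]] //= c0 gg; rewrite ?phi1 ?oner_eq0; split=> //; lia.
Qed.

Lemma mults_zero c cj : phi c != 0 -> (mults c cj).2 = Z0 -> (mults c cj).1 = Zpos xH.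
Proof.
move=> c0 w0; have [uE u0] := multsP cj c0; rewrite w0 in uE.
have [u00|cj0] : (mults c cj).1 = Z0 \/ cj = Z0 by lia.
  by move: u0; rewrite u00 phi0 eqxx.
by rewrite cj0.
Qed.

Lemma mults_unit c cj : unitz c -> (mults c cj).1 = (Zpos xH).
Proof. by case: c => [|[c|c|]|[c|c|]] //=; case: cj. Qed.

Definition scaled (m : seq (Z * Z)) (t : nat -> F) (j : nat) := t j / phi (nth (Zpos xH) (map fst m) j).

(** The factor [u] in the new coefficient cancels against the division of the parameter by [u]. *)
Lemma comb1_mults d x c cj t : phi c != 0 ->
  phi (comb1 red d x (mults c cj)) * (t / phi (mults c cj).1) =
  phi x * t - phi d / phi c * (phi cj * t).
Proof.
move=> c0; have [uE u0] := multsP cj c0; have w0 := @mults_zero c cj c0.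
rewrite /comb1; case: (mults c cj) uE u0 w0 => u w /= uE u0 w0.
have {}uE : phi u * phi cj = phi w * phi c by rewrite -!phiM uE.
have cjE : phi cj = phi w * phi c / phi u by rewrite -uE mulrAC mulfV // mul1r.
have gen : phi (Z.sub (Z.mul u x) (Z.mul w d)) * (t / phi u) =
    phi x * t - phi d / phi c * (phi cj * t).
  by rewrite phiB !phiM cjE; field; rewrite u0 c0.
have unit1 : u = Zpos xH -> phi (Z.sub x (Z.mul w d)) * (t / phi u) =
    phi x * t - phi d / phi c * (phi cj * t).
  by move=> u1; rewrite -gen u1; congr (phi _ * _); lia.
have zero1 : w = Z0 -> phi x * (t / phi u) = phi x * t - phi d / phi c * (phi cj * t).
  by move=> w00; rewrite w0 // phi1 divr1 cjE w00 phi0 !mul0r mulr0 subr0.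
case: w zero1 unit1 gen {cjE uE w0 u0} => [zero1 _ _|p _|p _]; first exact: zero1.
  by case: u => [|[p'|p'|]|p'] unit1 gen; rewrite phi_red ?gen ?unit1.
by case: u => [|[p'|p'|]|p'] unit1 gen; rewrite phi_red ?gen ?unit1.
Qed.

Lemma dot_comb d f (g : seq Z) (c : Z) t : phi c != 0 -> size f = size g ->
  dot (comb red d f (map (mults c) g)) (scaled (map (mults c) g) t) =
  dot f t - phi d / phi c * dot g t.
Proof.
move=> c0; elim: f g t => [|x f IH] [|cj g] t //=; first by rewrite mulr0 subr0.
move=> [fg].
have -> : dot (comb red d f (map (mults c) g)) (scaled (mults c cj :: map (mults c) g) t \o succn) =
          dot f (t \o succn) - phi d / phi c * dot g (t \o succn).
  by rewrite -(IH g _ fg); apply: eq_dot.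
by rewrite /scaled /= comb1_mults //; ring.
Qed.

Lemma size_comb d f m : size f = size m -> size (comb red d f m) = size f.
Proof. by elim: f m => [|x f IH] [|y m] //= [/IH->]. Qed.

Lemma size_subst1 q c un f : (q < size c)%N -> size f = size c ->
  size (subst1 red q (multl q c) un f) = (size c).-1.
Proof.
move=> qc fc; have qf : (q < size f)%N by rewrite fc.
have sc d : size (comb red d (dropnth q f) (multl q c)) = (size c).-1.
  by rewrite size_comb ?size_map ?size_dropnth ?fc.
by rewrite /subst1; case: nth => [|p|p]; rewrite ?sc //; case: un; rewrite ?sc ?size_dropnth ?fc.
Qed.

(** The multipliers depend on [c] alone, so that one rescaled assignment of the parameters serves
    all forms at once. *)
Lemma subst1_sound c q t :
    (q < size c)%N -> phi (nth Z0 c q) != 0 -> dot c t = 0 ->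
  exists t', forall f, size f = size c ->
    dot (subst1 red q (multl q c) (unitz (nth Z0 c q)) f) t' = dot f t.
Proof.
move=> qc cq0 ct0; set m := multl q c.
exists (scaled m (t \o skip q)) => f fc; have qf : (q < size f)%N by rewrite fc.
have tq : t q = - (dot (dropnth q c) (t \o skip q) / phi (nth Z0 c q)).
  have /eqP := ct0; rewrite (dot_dropnth _ qc) addr_eq0 => /eqP/(congr1 (fun z => z / phi (nth Z0 c q))).
  by rewrite mulrAC mulfV // mul1r mulNr.
have main : dot (comb red (nth Z0 f q) (dropnth q f) m) (scaled m (t \o skip q)) = dot f t.
  rewrite dot_comb ?size_dropnth ?fc // (dot_dropnth t qf) tq.
  by ring.
rewrite /subst1; case E: (nth Z0 f q) main => [|p|p] // main.
case: ifP => // un; rewrite (dot_dropnth t qf) E phi0 mul0r add0r.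
apply: eq_dot => j; rewrite /scaled /m /multl -map_comp.
have -> : nth (Zpos xH) (map (fst \o mults (nth Z0 c q)) (dropnth q c)) j = Zpos xH.
  case: (ltnP j (size (dropnth q c))) => jc; last by rewrite nth_default ?size_map.
  by rewrite (nth_map Z0) //= mults_unit.
by rewrite phi1 divr1.
Qed.

(** The first hypothesis is automatic over the rationals; modulo 13 it holds because the
    coefficients of [c] are reduced before a pivot is chosen. *)
Lemma eliminate_sound c fs fs' t :
    (forall i, nth Z0 c i <> Z0 -> phi (nth Z0 c i) != 0) ->
    all (fun f => size f == size c) fs ->
    eliminate red c fs = Some fs' -> dot c t = 0 ->
  [/\ size fs' = size fs, all (fun f => size f == (size c).-1) fs' &
   exists t', forall i, dot (nth [::] fs' i) t' = dot (nth [::] fs i) t].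
Proof.
move=> c0 /allP sfs; rewrite /eliminate; case E: pivot => [q|] // [<-] ct0.
have [qc cq0] := pivot_some E; split; first by rewrite size_map.
  by apply/allP => _ /mapP[f /sfs/eqP fc ->]; rewrite size_subst1.
have [t' t'E] := subst1_sound qc (c0 _ cq0) ct0.
exists t' => i; case: (ltnP i (size fs)) => ifs; last first.
  have sfi : (size (map (subst1 red q (multl q c) (unitz (nth Z0 c q))) fs) <= i)%N by rewrite size_map.
  by rewrite (nth_default _ ifs) (nth_default _ sfi).
by rewrite (nth_map [::]) // t'E // (eqP (sfs _ (mem_nth _ ifs))).
Qed.

Lemma eliminate_none c fs t : eliminate red c fs = None -> dot c t = 0.
Proof. by rewrite /eliminate; case E: pivot => // _; apply/dot_zerof/pivot_none. Qed.

Lemma dot_rowsum fs i nb t :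
  dot (rowsum fs i nb) t = dot (nth [::] fs i) t + \sum_(j <- nb) dot (nth [::] fs j) t.
Proof.
elim: nb => [|j nb IH]; first by rewrite big_nil addr0.
by rewrite big_cons /= dot_addf IH addrCA.
Qed.

Lemma size_addf f g : size (addf f g) = maxn (size f) (size g).
Proof. by elim: f g => [|x f IH] [|y g] //=; rewrite IH maxnSS. Qed.

Lemma size_rowsum fs i nb m : (i < size fs)%N -> (forall j, j \in nb -> (j < size fs)%N) ->
  all (fun f => size f == m) fs -> size (rowsum fs i nb) = m.
Proof.
move=> ifs nbP /allP sfs; have sj j : (j < size fs)%N -> size (nth [::] fs j) = m.
  by move=> jfs; apply/eqP/sfs/mem_nth.
elim: nb nbP => [|j nb IH] nbP /=; first exact: sj.
rewrite size_addf IH ?sj ?nbP ?inE ?eqxx ?maxnn // => j' j'n.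
by apply: nbP; rewrite inE j'n orbT.
Qed.
End Forms.

(** * Closed neighbourhood sums and dependent rows *)

Section ClosedSum.
Variables (F : fieldType) (V : finType) (e : rel V).
Hypotheses (e_sym : symmetric e) (e_irr : irreflexive e).

Definition csum (z : V -> F) (x : V) : F := z x + \sum_(y | e x y) z y.

Definition cl_mx : 'M[F]_#|V| :=
  \matrix_(i, j) ((enum_val i == enum_val j) || e (enum_val i) (enum_val j))%:R.

Lemma csumE z x : csum z x = \sum_j cl_mx (enum_rank x) j * z (enum_val j).
Proof.
rewrite (reindex enum_rank) /=; last by exists enum_val => i _; rewrite ?enum_valK ?enum_rankK.
rewrite (bigD1 x) //= mxE !enum_rankK eqxx mul1r; congr (_ + _).
rewrite big_mkcond [RHS]big_mkcond; apply: eq_bigr => y _.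
rewrite mxE !enum_rankK eq_sym; have [->|_] := eqVneq y x; first by rewrite e_irr.
by case: e; rewrite ?mul1r ?mul0r.
Qed.

Lemma cl_mx_sym i j : cl_mx i j = cl_mx j i.
Proof. by rewrite !mxE eq_sym e_sym. Qed.

(* A dependency between the rows of [P] and [v] is, by symmetry, a kernel vector vanishing
   outside [v |: P]. *)
Lemma dependent_row (P : {set V}) (v : V) : v \notin P ->
    (forall z, (forall u, u \in P -> csum z u = 0) -> csum z v = 0) ->
  exists z, [/\ forall x, csum z x = 0, z v = 1 & forall w, w \notin P -> w != v -> z w = 0].
Proof.
move=> vP dep.
pose M : 'M[F]_#|V| := \matrix_(i, j) if enum_val i \in P then cl_mx i j else 0.
have : (row (enum_rank v) cl_mx <= M)%MS.
  (* A row that kills the cokernel of [M] lies in its row space. The columns of the cokernel are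
     vectors killed by the rows in [P], so [dep] applies to each of them. *)
  rewrite submxE; apply/eqP/rowP => j; rewrite [RHS]mxE [LHS]mxE.
  pose z x := cokermx M (enum_rank x) j.
  rewrite -[RHS](dep z) => [|u uP]; rewrite csumE.
    by apply: eq_bigr => i _; rewrite [row _ _ _ _]mxE /z enum_valK.
  have /matrixP/(_ (enum_rank u) j) := mulmx_coker M; rewrite [RHS]mxE [LHS]mxE => MK.
  by rewrite -[RHS]MK; apply: eq_bigr => i _; rewrite [M _ _]mxE enum_rankK uP /z enum_valK.
case/submxP => w /rowP wE.
pose z x : F := (x == v)%:R - (if x \in P then w 0 (enum_rank x) else 0).
exists z; split; last 2 first.
- by rewrite /z eqxx (negPf vP) subr0.
- by move=> x /negPf xP /negPf xv; rewrite /z xP xv subr0.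
move=> x; rewrite csumE.
rewrite (eq_bigr (fun j => (enum_val j == v)%:R * cl_mx j (enum_rank x) -
    w 0 j * M j (enum_rank x))) => [|j _]; last first.
  rewrite /z mulrBr cl_mx_sym mulrC; congr (_ - _); rewrite [M _ _]mxE enum_valK.
  by case: ifP => _; rewrite ?mulr0 // mulrC.
rewrite sumrB; have := wE (enum_rank x); rewrite [X in _ = X]mxE => <-.
rewrite mxE (bigD1 (enum_rank v)) //= enum_rankK eqxx mul1r big1 ?addr0 ?subrr // => j jv.
suff -> : (enum_val j == v) = false by rewrite mul0r.
by apply: contraNF jv => /eqP<-; rewrite enum_valK.
Qed.
End ClosedSum.

(** * Soundness of the search *)

Definition ratZ (z : Z) : rat := (int_of_Z z)%:~R.
Lemma ratZ0 : ratZ Z0 = 0. Proof. by []. Qed.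
Lemma ratZ1 : ratZ (Zpos xH) = 1. Proof. by []. Qed.
Lemma ratZD x y : ratZ (Z.add x y) = ratZ x + ratZ y.
Proof. by rewrite /ratZ -intrD -rmorphD. Qed.
Lemma ratZM x y : ratZ (Z.mul x y) = ratZ x * ratZ y.
Proof. by rewrite /ratZ -intrM -rmorphM. Qed.
Lemma ratZ_id x : ratZ (idZ x) = ratZ x. Proof. by []. Qed.
Lemma ratZ_neq0 x : x <> Z0 -> ratZ x != 0.
Proof. by move=> x0; rewrite /ratZ intr_eq0; lia. Qed.

Notation rdot := (dot ratZ).

Definition label_eqs (g : pgraph) (y : nat -> rat) : Prop :=
  forall i, (i < size g)%N -> full g i -> y i + \sum_(j <- nbr g i) y j = 0.

Definition well_labelled (g : pgraph) : Prop :=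
  forall i j, (i < size g)%N -> j \in nbr g i -> (j < size g)%N.

Definition uniform (fs : seq (seq Z)) := all (fun f => size f == size (head [::] fs)) fs.

(** All solutions of the equations of the complete labels are values of the forms. The cuts rest on
    this inclusion: a combination of forms that is identically zero vanishes on every solution. *)
Record sound (st : state) : Prop := Sound {
  so_size : size st.2 = size st.1;
  so_unif : uniform st.2;
  so_lab : well_labelled st.1;
  so_forms : forall y, label_eqs st.1 y ->
    exists t, forall i, (i < size st.1)%N -> y i = rdot (nth [::] st.2 i) t }.

Lemma uniformP fs m : all (fun f => size f == m) fs -> uniform fs.
Proof. by case: fs => // f fs /=; rewrite /uniform /= eqxx => /andP[/eqP-> ->]. Qed.

Lemma size_padforms fs nn : size (padforms fs nn) = (size fs + nn)%N.
Proof. by case: nn => [|nn]; rewrite ?addn0 // size_cat !size_map size_iota. Qed.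

Lemma padforms_uniform fs nn : uniform fs ->
  all (fun f => size f == (size (head [::] fs) + nn)%N) (padforms fs nn).
Proof.
case: nn => [|nn]; first by rewrite addn0.
move=> ufs; rewrite all_cat; apply/andP; split; apply/allP => f /mapP[g gin ->].
  by rewrite size_cat size_nseq (eqP (allP ufs _ gin)).
by rewrite size_cat size_nseq size_map size_iota.
Qed.

Lemma padforms_sound fs nn (y : nat -> rat) t : uniform fs ->
    (forall i, (i < size fs)%N -> y i = rdot (nth [::] fs i) t) ->
  exists t', forall i, (i < size fs + nn)%N -> y i = rdot (nth [::] (padforms fs nn) i) t'.
Proof.
move=> ufs yt; case: nn => [|nn]; first by exists t => i; rewrite addn0; apply: yt.
set np := size (head [::] fs).
(* The parameter added for a new label is its coordinate. *)
pose t' j := if (j < np)%N then t j else y (size fs + (j - np))%N.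
have agree f : size f = np -> rdot f t' = rdot f t.
  by move=> fnp; apply: eq_dot_size => j; rewrite /t' fnp => ->.
exists t' => i ilt; rewrite nth_cat size_map; case: ltnP => ifs.
  rewrite (nth_map [::]) // dot_cat dot_nseq0 // addr0 agree ?yt //.
  by apply/eqP; apply: (allP ufs); apply: mem_nth.
rewrite (nth_map 0%N) ?size_iota; last by lia.
rewrite nth_iota ?add0n; last by lia.
rewrite dot_unitf //; last by lia.
by rewrite /t' ifN; [congr y|]; rewrite -/np; lia.
Qed.

Lemma mem_subsetsP m c X j : X \in subsets m c -> j \in X -> j \in c.
Proof.
elim: c m X => [|x c IH] [|m] X /=; rewrite ?inE //; try by move=> /eqP->.
rewrite mem_cat => /orP[/mapP[Y /IH h ->]|/IH h]; last by move=> /h->; rewrite orbT.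
by rewrite inE => /orP[->//|/h->]; rewrite orbT.
Qed.

Lemma exts_withP tgt c fresh g i nn g' : (nn, g') \in exts_with tgt c fresh g i ->
  exists X, [/\ g' = extend g i nn X, {subset X <= c} & (nn <= fresh)%N].
Proof.
case/flattenP => _ /mapP[m _ ->]; rewrite lebE; case: leqP => // mf.
by case/mapP => X Xin [-> ->]; exists X; split=> // j; apply: mem_subsetsP Xin.
Qed.

Lemma extend_well_labelled g i nn (X : seq nat) : (i < size g)%N -> {subset X <= gtn (size g)} ->
  well_labelled g -> well_labelled (extend g i nn X).
Proof.
move=> ig Xg wg p j; rewrite size_extend => pg; rewrite nbr_extend //.
case: ifP => pg'; last by rewrite inE => /eqP->; lia.
have old : j \in nbr g p -> (j < size g + nn)%N by move/(wg _ _ pg'); lia.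
case: eqP => _; first rewrite !mem_cat mem_iota => /orP[/orP[/Xg|]|//]; rewrite ?unfold_in /=; try lia.
by case: ifP => _; rewrite ?inE; [case/orP => [/eqP->|//]; lia|].
Qed.

Lemma extend_eqs g i nn (X : seq nat) y : (i < size g)%N -> ~~ full g i ->
    (forall j, j \in X -> ~~ full g j) ->
    label_eqs (extend g i nn X) y ->
  label_eqs g y /\ y i + \sum_(j <- nbr (extend g i nn X) i) y j = 0.
Proof.
move=> ig fi fX eqs; split; last first.
  apply: eqs; first by rewrite size_extend; lia.
  by rewrite full_extend ?ig ?eqxx //; lia.
move=> p pg fp; have pg' : (p < size g + nn)%N by lia.
have := eqs p; rewrite size_extend full_extend // pg fp orbT nbr_extend // pg => /(_ pg' isT).
case: eqP => [ip|_]; first by rewrite ip fp in fi.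
by case: ifP => // /fX; rewrite fp.
Qed.

(** If the new row becomes the zero form, it holds for all solutions of the earlier equations: this
    is the dependency later handed to [dependent_row]. *)
Lemma elim_sound i g fs nn (X : seq nat) (g' := extend g i nn X) (fs0 := padforms fs nn) :
    sound (g, fs) -> (i < size g)%N -> ~~ full g i ->
    (forall j, j \in X -> (j < size g)%N && ~~ full g j) ->
  if eliminate idZ (rowsum fs0 i (nbr g' i)) fs0 is Some fs' then sound (g', fs')
  else sound (g', fs0) /\
    forall y, label_eqs g y -> y i + \sum_(j <- nbr g' i) y j = 0.
Proof.
move=> sg ig fi Xg.
have Xlt : {subset X <= gtn (size g)} by move=> j /Xg/andP[].
have Xopen j : j \in X -> ~~ full g j by move/Xg/andP => [].
have wg' : well_labelled g' := extend_well_labelled (nn := nn) ig Xlt (so_lab sg).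
have pu : all _ fs0 := padforms_uniform nn (so_unif sg).
have sp : size fs0 = (size g + nn)%N by rewrite size_padforms (so_size sg).
have row_lt j : j \in nbr g' i -> (j < size g + nn)%N.
  by move=> jn; have := wg' i j; rewrite size_extend; apply=> //; lia.
have pad y : label_eqs g y -> exists t, [/\
    forall j, (j < size g + nn)%N -> y j = rdot (nth [::] fs0 j) t &
    rdot (rowsum fs0 i (nbr g' i)) t = y i + \sum_(j <- nbr g' i) y j].
  move=> eqg.
  have [t tE] := so_forms sg eqg; rewrite -(so_size sg) /= in tE.
  have [t' t'E] := padforms_sound nn (so_unif sg) tE; rewrite /= (so_size sg) /= in t'E.
  exists t'; split=> //; rewrite dot_rowsum //; last exact: ratZD.
  rewrite -t'E; last by lia.
  by congr (_ + _); apply: eq_big_seq => j /row_lt jn; rewrite -t'E.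
have split_eqs y : label_eqs g' y -> label_eqs g y /\ y i + \sum_(j <- nbr g' i) y j = 0.
  exact: extend_eqs.
have rs : size (rowsum fs0 i (nbr g' i)) = (size (head [::] fs) + nn)%N.
  by apply: size_rowsum pu; rewrite sp //; lia.
case E: eliminate => [fs'|]; last first.
  split=> [|y /pad[t [_ <-]]]; last exact: (eliminate_none ratZ0 _ E).
  split=> //=; first by rewrite sp size_extend.
    exact: uniformP pu.
  by move=> y /split_eqs[/pad[t [tE _]] _]; exists t => j; rewrite size_extend; apply: tE.
rewrite -rs in pu.
have esound t := eliminate_sound ratZ0 ratZ1 ratZD ratZM ratZ_id (fun j h => ratZ_neq0 h) pu E (t := t).
have [sE ufs'] : size fs' = size fs0 /\ uniform fs'.
  have [|sE /uniformP ufs' _] := esound (fun=> 0); last by split.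
  by elim: (rowsum _ _ _) => //= c f ->; rewrite mulr0 addr0.
split=> //=; first by rewrite sE sp size_extend.
move=> y /split_eqs[/pad[t [tE rt]] y0]; have [|_ _ [t' t'E]] := esound t; first by rewrite rt.
by exists t' => j; rewrite size_extend => jg; rewrite t'E tE.
Qed.

Lemma child_sound n s i g fs nn (X : seq nat) : sound (g, fs) -> (i < size g)%N -> ~~ full g i ->
    (forall j, j \in X -> (j < size g)%N && ~~ full g j) ->
  forall st, st \in child n s i fs (nn, extend g i nn X) -> sound st.
Proof.
move=> sg ig fi Xg st; have := elim_sound nn sg ig fi Xg; rewrite /child /=.
case: eliminate => [fs' so|[so _]]; case: ifP => // _; by rewrite inE => /eqP->.
Qed.

Lemma perm_insert_by (T : eqType) (le : rel T) x l : perm_eq (insert_by le x l) (x :: l).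
Proof.
elim: l => //= y l IH; case: ifP => // _.
by rewrite -[x :: y :: l]/([:: x] ++ [:: y] ++ l) perm_sym perm_catCA /= perm_cons perm_sym.
Qed.

(** Converts a recursion carrying the label of the head of the list into a filter over the
    labels. *)
Lemma suffix_filter (T : Type) (F : nat -> pgraph -> seq T) (f : nat -> T) (p : pred nat) g :
    (forall m, F m [::] = [::]) ->
    (forall m, F m (vx g m :: drop m.+1 g) =
       if p m then f m :: F m.+1 (drop m.+1 g) else F m.+1 (drop m.+1 g)) ->
  F 0%N g = [seq f j | j <- iota 0 (size g) & p j].
Proof.
move=> F0 FS; suff H m : (m <= size g)%N ->
    F (size g - m)%N (drop (size g - m) g) = [seq f j | j <- iota (size g - m) m & p j].
  by have := H _ (leqnn _); rewrite subnn drop0.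
elim: m => [|m IH] mg; first by rewrite subn0 drop_size F0.
have E : (size g - m = (size g - m.+1).+1)%N by rewrite subnSK.
rewrite (drop_nth (true, [::])) -/(vx g _); last by rewrite ltn_subrL (leq_trans _ mg).
by rewrite FS -E IH /= ?E ?(ltnW mg) //; case: (p _).
Qed.

Lemma candE tgt lo i g : cand_from tgt lo i 0 g = [seq j | j <- iota 0 (size g) &
  [&& ~~ full g j, (lo <= j)%N, (size (nbr g j) < tgt j)%N, i != j & i \notin nbr g j]].
Proof.
apply: suffix_filter => // m /=; rewrite ltbE lebE eqnE memnE -/(full g m) -/(nbr g m).
by case: (full g m) => //=; case: ltnP => //= _; case: leqP => //= _; case: eqP => //= _; case: (i \in _).
Qed.

Lemma mem_cand tgt lo i g j : j \in cand_from tgt lo i 0 g =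
  [&& (j < size g)%N, ~~ full g j, (lo <= j)%N, (size (nbr g j) < tgt j)%N,
      i != j & i \notin nbr g j].
Proof. by rewrite candE map_id mem_filter mem_iota andbC. Qed.

Lemma cand_uniq tgt lo i g : uniq (cand_from tgt lo i 0 g).
Proof. by rewrite candE map_id filter_uniq ?iota_uniq. Qed.

Lemma nfullE g : nfull g = size [seq i <- iota 0 (size g) | full g i].
Proof.
rewrite /full /vx size_filter; elim: g => //= v g ->.
rewrite -[1%N in RHS]addn0 iotaDl count_map /= -[in RHS](@eq_count _ (fun i => (nth (true, [::]) g i).1)) //.
by case: v.1; rewrite ?add1n.
Qed.

Section Exts.
Variables (V : finType) (e : rel V) (D : {pred V}) (tgt : nat -> nat) (v0 : V).
Hypotheses (e_sym : symmetric e) (e_irr : irreflexive e).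
Notation realizes := (realizes e D tgt v0).

Lemma cand_complete l g i lo j : realizes l g -> (i < size g)%N -> (lo <= j < size g)%N ->
  e (nth v0 l i) (nth v0 l j) -> j \notin nbr g i -> j \in cand_from tgt lo i 0 g.
Proof.
move=> lg ig /andP[lj jg] ij jn; rewrite mem_cand jg lj /=.
have nj : i \notin nbr g j by apply: contra jn => /(rz_sym lg jg).
have short : (size (nbr g j) < tgt j)%N.
  rewrite ltnNge; apply: contra nj => tj.
  by apply: (adj_label lg jg tj ig); rewrite e_sym.
rewrite short nj andbT /=; apply/andP; split.
  by apply: contraL short => /(rz_full lg jg); rewrite -leqNgt.
by apply: contraTneq ij => ->; rewrite e_irr.
Qed.

Lemma exts_hit l g i lo n : realizes l g -> (i < size g)%N ->
    (forall j, (j < lo)%N -> (j < size g)%N -> e (nth v0 l i) (nth v0 l j) -> j \in nbr g i) ->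
    (forall w, w \in D -> w \notin l -> forall j, deg_in e D w = tgt j) ->
    (#|D| <= n)%N ->
  exists nw X, [/\ realizes (l ++ nw) (extend g i (size nw) X),
    (size nw, extend g i (size nw) X) \in exts tgt lo n g i,
    forall w, w \in nw = [&& w \in D, e (nth v0 l i) w & w \notin l] &
    {subset X <= cand_from tgt lo i 0 g}].
Proof.
move=> lg ig loP newdeg Dn.
have [||||nw [nwr nwin nwE]] := @extend_realizes V e D tgt v0 e_sym e_irr l g i (cand_from tgt lo i 0 g)
   (n - size g) lg ig (cand_uniq _ _ _ _).
- by move=> j; rewrite mem_cand => /and5P[jg fj _ _ /andP[_ nj]]; split=> //; apply: contra nj => /(rz_sym lg ig).
- move=> j jg ij jn; case: (ltnP j lo) => jlo; first by rewrite (loP j) in jn.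
  by apply: (cand_complete lg); rewrite ?jlo.
- by move=> w wD _ wl j; apply: newdeg.
- rewrite -(rz_size lg) -(card_uniqP (rz_uniq lg)).
  have : (#|[pred w in D | w \notin l]| + #|l| <= n)%N.
    rewrite (leq_trans _ Dn) // -(cardID (mem l) D) addnC leq_add //.
      by rewrite leq_eqVlt; apply/orP; left; apply/eqP/eq_card => w; rewrite !inE andbC;
        apply/idP/andP => [wl|[//]]; split=> //; apply: (rz_dom lg).
    by apply/subset_leq_card/fintype.subsetP => w; rewrite !inE andbC.
  move=> le; apply: (@leq_trans #|[pred w in D | w \notin l]|); last by lia.
  by apply/subset_leq_card/fintype.subsetP => w; rewrite !inE => /and3P[-> _ ->].
by exists nw, [seq j <- cand_from tgt lo i 0 g | e (nth v0 l i) (nth v0 l j)]; split=> // j; rewrite mem_filter => /andP[].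
Qed.
End Exts.

(** * The search reaches every graph of the given type *)

Lemma pick_fromP g i : pick_from 0 0 0 g = Some i -> (i < size g)%N && ~~ full g i.
Proof.
suff gen h j bj bs : pick_from j bj bs h = Some i ->
    (i == bj) && (0 < bs)%N || (j <= i < j + size h)%N && ~~ full h (i - j).
  by move/gen; rewrite ltnn andbF /= subn0.
elim: h j bj bs => [|v h IH] j bj bs /=; first by case: bs => //= bs [->]; rewrite eqxx.
have step bj' bs' : pick_from j.+1 bj' bs' h = Some i ->
    (i == bj') && (0 < bs')%N || (j <= i < j + (size h).+1)%N && ~~ full (v :: h) (i - j).
  move/IH => /orP[->//|/andP[il fl]]; apply/orP; right.
  have ij : (i - j = (i - j.+1).+1)%N by lia.
  by rewrite ij /full /vx /= fl andbT; lia.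
case: ifP => [vf /step//|/negbT vf]; case: ifP => _ /step // /orP[/andP[/eqP-> _]|->]; rewrite ?orbT //.
by rewrite subnn /full /vx /= vf andbT orbC; apply/orP; left; lia.
Qed.

Lemma unsatP tgt (g : pgraph) : unsat tgt 0 g =
  [seq (j, (tgt j - size (nbr g j))%N, nbr g j) | j <- iota 0 (size g) &
     ~~ full g j && (size (nbr g j) < tgt j)%N].
Proof.
apply: suffix_filter => // m /=; rewrite -/(full g m) -/(nbr g m); case: (full g m) => //=.
by rewrite -subn_gt0 -[Nat.sub _ _]/(subn _ _); case: (tgt m - _)%N.
Qed.

Lemma count_farE nb u acc : count_far nb u acc = (acc + count (fun x => x.1.1 \notin nb) u)%N.
Proof.
elim: u acc => [|x u IH] acc /=; first by rewrite addn0.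
by rewrite IH memnE; case: (_ \in nb); rewrite ?add0n //= addSnnS.
Qed.
Definition row_code (x : row_rec) := (lab x, need x, nbs x, row_sum x, form x).
Definition row_decode (z : nat * nat * seq nat * seq Z * seq Z) :=
  let: (a, b, c, d, f) := z in RowRec a b c d f.
Lemma row_codeK : cancel row_code row_decode. Proof. by case. Qed.
HB.instance Definition _ := Equality.copy row_rec (can_type row_codeK).

Lemma open_rowsE k fs g : open_rows k fs 0 g =
  [seq RowRec j (k - size (nbr g j)) (nbr g j) (rowsum fs j (nbr g j)) (nth [::] fs j) |
     j <- iota 0 (size g) & ~~ full g j].
Proof.
by apply: suffix_filter => // m /=; rewrite -/(full g m) -/(nbr g m); case: (full g m).
Qed.

Section Choose.
Variables (sel : pred row_rec) (i : nat) (f : seq Z).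

Definition chosen_row r tl := foldl (fun r x => if sel x then addf r (form x) else r) r tl.
Definition chosen_nbs nb tl := foldl (fun nb x => if sel x then lab x :: nb else nb) nb tl.
Definition chosen_tail tl := map (fun x => if sel x then
  RowRec (lab x) (need x).-1 (i :: nbs x) (addf (row_sum x) f) (form x) else x) tl.

(** The branch followed is that of [sel], in the application the missing neighbours in the
    hypothetical graph. Transferring [all P] to it avoids any description of the enumerated list. *)
Lemma choose_all P tl r nb :
    (forall x, x \in tl -> sel x -> (0 < need x)%N && (i \notin nbs x)) ->
    all P (choose_nbrs (count sel tl) i f r nb tl) ->
  P (chosen_row r tl, chosen_nbs nb tl, chosen_tail tl).
Proof.
elim: tl P r nb => [|x tl IH] P r nb selP /=; first by rewrite andbT.
have selP' y : y \in tl -> sel y -> (0 < need y)%N && (i \notin nbs y).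
  by move=> yt; apply: selP; rewrite inE yt orbT.
case: (boolP (sel x)) => [sx|nsx] /=.
  have /andP[n0 ix] := selP _ (mem_head _ _) sx; rewrite add1n memnE (negPf ix) lebE count_size.
  case: (need x) n0 => // p _; rewrite all_cat all_map => /andP[allP _].
  exact: (IH (fun z => P (z.1, RowRec (lab x) p (i :: nbs x) (addf (row_sum x) f) (form x) :: z.2))).
rewrite add0n; case E: (count sel tl) => [|m].
  have /hasPn nosel : ~~ has sel tl by rewrite has_count E.
  have [-> [-> ->]] : chosen_row r tl = r /\ chosen_nbs nb tl = nb /\ chosen_tail tl = tl.
    elim: (tl) r nb nosel => //= z t IHt r nb nosel; rewrite (negPf (nosel z _)) ?mem_head //.
    by have [|-> [-> ->]] := IHt r nb; first by move=> y yt; apply: nosel; rewrite inE yt orbT.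
  by rewrite /= andbT.
have le : (m <= size tl)%N by rewrite ltnW // -E count_size.
rewrite -E => H.
have {}H : all P [seq (z.1, x :: z.2) | z <- choose_nbrs (count sel tl) i f r nb tl].
  by move: H; rewrite E lebE le; case: (need x) => // p; case: ifP => // _; rewrite all_cat => /andP[].
by move: H; rewrite all_map; apply: (IH (fun z => P (z.1, x :: z.2))).
Qed.

Lemma chosen_nbsE nb tl : chosen_nbs nb tl = catrev (map lab (filter sel tl)) nb.
Proof. by elim: tl nb => //= x tl IH nb; rewrite IH; case: (sel x). Qed.

Lemma dot_chosen_row r tl t :
  rdot (chosen_row r tl) t = rdot r t + \sum_(x <- filter sel tl) rdot (form x) t.
Proof.
elim: tl r => [|x tl IH] r /=; first by rewrite big_nil addr0.
by rewrite IH; case: (sel x); rewrite // big_cons dot_addf ?addrA //; apply: ratZD.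
Qed.

Lemma size_chosen_row r tl m : size r = m -> all (fun x => size (form x) == m) tl ->
  size (chosen_row r tl) = m.
Proof.
elim: tl r => //= x tl IH r rm /andP[/eqP xm tlm]; apply: IH => //.
by case: (sel x); rewrite // size_addf rm xm maxnn.
Qed.
End Choose.
Lemma oddsE s g : odds (drop s g) =
  size [seq j <- iota s (size g - s) | odd (size (nbr g j))].
Proof.
have gen h : odds h = count (fun v : pvertex => odd (size v.2)) h.
  by elim: h => //= v h ->; case: odd.
have [sg|gs] := leqP (size g) s.
  by rewrite drop_oversize // (eqP (_ : (size g - s == 0)%N)) // subn_eq0.
have dE : drop s g = map (vx g) (iota s (size g - s)).
  apply: (@eq_from_nth _ (true, [::])) => [|j]; rewrite size_drop ?size_map ?size_iota // => jg.
  by rewrite nth_drop (nth_map 0%N) ?size_iota // nth_iota.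
by rewrite gen dE count_map size_filter.
Qed.

Lemma open_coreE s (g : pgraph) : (s <= size g)%N ->
  [seq v <- take s g | ~~ v.1] = map (vx g) [seq i <- iota 0 s | ~~ full g i].
Proof.
move=> sg; have tE : take s g = map (vx g) (iota 0 s).
  apply: (@eq_from_nth _ (true, [::])) => [|j]; rewrite size_take_min (minn_idPl sg) ?size_map ?size_iota // => js.
  by rewrite nth_take // (nth_map 0%N) ?size_iota // nth_iota.
by rewrite tE filter_map.
Qed.

Lemma firstopenE s g : (s <= size g)%N -> firstopen 0 (take s g) = ohead [seq i <- iota 0 s | ~~ full g i].
Proof.
rewrite /full /vx; suff gen m h : (s <= size h)%N -> firstopen m (take s h) =
    ohead [seq i <- iota m s | ~~ (nth (true, [::]) h (i - m)).1].
  by move/(gen 0%N) ->; congr ohead; apply: eq_filter => i; rewrite subn0.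
elim: s m h => [|s IH] m [|v h] //= sh; rewrite subnn /=.
case: v.1 => //=; rewrite IH //; congr ohead; apply: eq_in_filter => i; rewrite mem_iota => /andP[mi _].
by have -> : (i - m = (i - m.+1).+1)%N by lia.
Qed.
Lemma firstopenP g i : firstopen 0 g = Some i -> (i < size g)%N && ~~ full g i.
Proof.
rewrite /full /vx; suff gen h m : firstopen m h = Some i ->
    (m <= i < m + size h)%N && ~~ (nth (true, [::]) h (i - m)).1 by move/gen; rewrite subn0.
elim: h m => //= v h IH m; case: ifP => vf; last first.
  by case=> <-; rewrite subnn /= vf; lia.
by move/IH => /andP[mi]; rewrite (_ : i - m = (i - m.+1).+1)%N /=; lia.
Qed.

Lemma children_sound n s ok i g fs tgt c fresh : sound (g, fs) -> (i < size g)%N -> ~~ full g i ->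
    (forall j, j \in c -> (j < size g)%N && ~~ full g j) ->
  forall st, st \in children n s ok i fs (exts_with tgt c fresh g i) -> sound st.
Proof.
move=> sg ig fi cg st /flattenP[_ /mapP[[nn g'] + ->]]; rewrite mem_filter => /andP[_].
case/exts_withP => X [-> Xc _]; apply: child_sound => // j /Xc; exact: cg.
Qed.

Lemma stepS_sound n k s st : sound st -> forall st', st' \in stepS n k s st -> sound st'.
Proof.
case: st => g fs sg st'; rewrite /stepS /=.
have cP tgt lo i j : j \in cand_from tgt lo i 0 g -> (j < size g)%N && ~~ full g j.
  by rewrite mem_cand => /and3P[-> ->].
case Ei: firstopen => [i|].
  have /andP[ig fi] := firstopenP Ei; move: ig; rewrite size_take_min leq_min => /andP[il ig].
  have {}fi : ~~ full g i by move: fi; rewrite /full /vx nth_take.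
  case E: [seq v <- _ | _] => [|v [|v' o]]; apply: children_sound => // j; try exact: cP.
  by rewrite mem_filter => /andP[_ /cP].
case E: pick_from => [i|]; last by rewrite inE => /eqP->.
have /andP[ig fi] := pick_fromP E.
by apply: children_sound => // j; apply: cP.
Qed.

Section Search.
Variables (V : finType) (e : rel V) (k : nat) (v0 : V) (S : {pred V}) (s : nat) (x0 : V -> rat).
Hypotheses (e_sym : symmetric e) (e_irr : irreflexive e)
  (e_reg : forall x, #|[pred y | e x y]| = k)
  (ker_full : forall z : V -> rat, (forall x, csum e z x = 0) ->
     (exists x, z x != 0) -> forall x, z x != 0)
  (x0_ker : forall x, csum e x0 x = 0) (x0_full : forall x, x0 x != 0)
  (S_parity : forall x, odd #|[pred y | (y \in S) && e x y]| = (x \in S)).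

Notation n := #|V|.
Notation tgtk := (fun _ : nat => k).
Notation realizes := (realizes e predT tgtk v0).

Record hits (l : seq V) (g : pgraph) : Prop := Hits {
  h_rz : realizes l g;
  h_core : forall i, (i < size g)%N -> (nth v0 l i \in S) = (i < s)%N;
  h_all : forall v, v \in S -> v \in l;
  h_adj : forall i j, (i < s)%N -> (j < s)%N -> e (nth v0 l i) (nth v0 l j) -> j \in nbr g i;
  h_s : (s <= size g)%N }.

Lemma label_csum l g i (z : V -> rat) : realizes l g -> (i < size g)%N -> (k <= size (nbr g i))%N ->
  csum e z (nth v0 l i) = z (nth v0 l i) + \sum_(j <- nbr g i) z (nth v0 l j).
Proof.
move=> lg ig ki; congr (_ + _); rewrite -(big_map (nth v0 l) xpredT).
rewrite big_uniq ?(map_nbr_uniq lg) //; apply: eq_bigl => w.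
apply/idP/mapP => [iw|[j jn ->]]; last exact: (rz_adj lg).
exact: (nbr_complete lg ig ki).
Qed.

Lemma hits_eqs l g (z : V -> rat) : realizes l g ->
  (forall i, (i < size g)%N -> full g i -> csum e z (nth v0 l i) = 0) ->
  label_eqs g (fun i => z (nth v0 l i)).
Proof. by move=> lg zP i ig fi; rewrite -(label_csum _ lg) ?zP ?(rz_full lg). Qed.

Lemma hits_extend l g i c fresh :
    hits l g -> (i < size g)%N ->
    uniq c -> (forall j, j \in c -> [/\ (j < size g)%N, ~~ full g j & j \notin nbr g i]) ->
    (forall j, (j < size g)%N -> e (nth v0 l i) (nth v0 l j) -> j \notin nbr g i -> j \in c) ->
    (#|[pred w | e (nth v0 l i) w && (w \notin l)]| <= fresh)%N ->
  exists nw X, [/\ hits (l ++ nw) (extend g i (size nw) X),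
    (size nw, extend g i (size nw) X) \in exts_with tgtk c fresh g i,
    {subset X <= c} & forall w, w \in nw = (e (nth v0 l i) w && (w \notin l))].
Proof.
move=> lg ig cU cP cC fr; have lr := h_rz lg.
have [||nw [nwr nwin nwE]] := extend_realizes e_sym e_irr lr ig cU cP cC (fresh := fresh).
- by move=> w _ _ _ j; rewrite /deg_in -(e_reg w); apply: eq_card => y; rewrite !inE.
- by rewrite (leq_trans _ fr) //; apply/subset_leq_card/fintype.subsetP => w; rewrite !inE.
exists nw, [seq j <- c | e (nth v0 l i) (nth v0 l j)]; split=> //; last first.
- by move=> j; rewrite mem_filter => /andP[].
split=> //.
- move=> p; rewrite size_extend nth_cat (rz_size lr) => pg.
  case: ifP => pg'; first exact: (h_core lg).
  have gp : (size g <= p)%N by rewrite leqNgt pg'.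
  have : nth v0 nw (p - size g) \in nw by apply: mem_nth; rewrite ltn_subLR.
  rewrite nwE => /and3P[_ _ wl]; rewrite [RHS]ltnNge (leq_trans (h_s lg) gp).
  by apply: contraNF wl => /(h_all lg).
- by move=> v /(h_all lg) vl; rewrite mem_cat vl.
- move=> p q ps qs; have pg := leq_trans ps (h_s lg); have qg := leq_trans qs (h_s lg).
  rewrite !nth_cat (rz_size lr) pg qg => /(h_adj lg ps qs) qn.
  rewrite nbr_extend ?pg; last by lia.
  by case: ifP => _; [|case: ifP => _]; rewrite ?mem_cat ?inE qn ?orbT.
- by rewrite size_extend (leq_trans (h_s lg)) // leq_addr.
Qed.

(** Neither cut can remove the branch of the hypothetical graph. A vanishing form contradicts
    [x0_full], and a dependency gives a kernel vector supported on [i] and the labels complete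
    before it, which has no zeros only if these are all the vertices. *)
Lemma child_hit l g fs i nw (X : seq nat) (g' := extend g i (size nw) X) :
    sound (g, fs) -> hits l g -> (i < size g)%N -> ~~ full g i ->
    (forall j, j \in X -> (j < size g)%N && ~~ full g j) ->
    hits (l ++ nw) g' ->
  exists2 st, st \in child n s i fs (size nw, g') & st.1 = g'.
Proof.
move=> sg lg ig fi Xg lg'; have lr := h_rz lg; have lr' := h_rz lg'.
have ig' : (i < size g')%N by rewrite size_extend; lia.
have old j : (j < size g)%N -> nth v0 (l ++ nw) j = nth v0 l j.
  by move=> jg; rewrite nth_cat (rz_size lr) jg.
have Xopen j : j \in X -> ~~ full g j by case/Xg/andP.
have kill (st : state) : st.1 = g' -> sound st -> has zerof (drop s st.2) = false.
  move=> stE so; apply/negbTE/hasPn => f /(nthP [::])[j]; rewrite size_drop nth_drop => jlt <-.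
  apply/negP => zj.
  have [|t tE] := so_forms so (y := fun i => x0 (nth v0 (l ++ nw) i)).
    by rewrite stE; apply: hits_eqs lr' _ => p _ _; apply: x0_ker.
  have := x0_full (nth v0 (l ++ nw) (s + j)).
  rewrite tE ?(dot_zerof ratZ0) ?eqxx //; last by rewrite -(so_size so) -ltn_subRL.
have := elim_sound (size nw) sg ig fi Xg; rewrite /child /= -/g'.
case: eliminate => [fs' so|[so dep]].
  by rewrite (kill (g', fs') erefl so); exists (g', fs'); rewrite ?inE.
case: ifP => [|_]; last by exists (g', padforms fs (size nw)); rewrite ?inE.
rewrite ltbE nfullE => few.
pose P := [set v in [seq nth v0 l j | j <- iota 0 (size g) & full g j]].
have PE v : v \in P -> exists2 j, (j < size g)%N && full g j & v = nth v0 l j.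
  by rewrite inE => /mapP[j]; rewrite mem_filter mem_iota => /andP[fj /andP[_ jg]] ->; exists j; rewrite // fj andbT.
have viP : nth v0 l i \notin P.
  apply/negP => /PE[j /andP[jg fj] /eqP]; rewrite nth_uniq ?(rz_size lr) ?(rz_uniq lr) // => /eqP ij.
  by rewrite ij fj in fi.
have fi' : full g' i by rewrite full_extend ?ig ?eqxx //; lia.
have [z zP|z [zker z1 zP]] := dependent_row e_sym e_irr viP (F := rat).
  rewrite -old // (label_csum _ lr') ?(rz_full lr') //.
  apply: (dep (fun j => z (nth v0 (l ++ nw) j))) => j jg fj.
  rewrite -[RHS](zP (nth v0 l j)); last first.
    by rewrite inE; apply/mapP; exists j; rewrite // mem_filter fj mem_iota.
  rewrite (label_csum _ lr) ?(rz_full lr) // old //; congr (_ + _).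
  by apply: eq_big_seq => j' /(rz_lt lr jg)/old->.
have zfull : forall w, z w != 0.
  by apply: ker_full zker _; exists (nth v0 l i); rewrite z1 oner_eq0.
exfalso; move: few; apply/negP; rewrite -leqNgt -(size_map (nth v0 (l ++ nw))) cardE.
apply: uniq_leq_size (enum_uniq _) _ => w _; apply/mapP.
have : (w \in P) || (w == nth v0 l i).
  apply: contraT; rewrite negb_or => /andP[wP wi].
  by have := zfull w; rewrite zP ?eqxx.
case/orP => [/PE[j /andP[jg fj] ->]|/eqP->]; [exists j|exists i]; rewrite ?old //.
  by rewrite mem_filter mem_iota size_extend full_extend; rewrite ?jg ?fj ?orbT; lia.
by rewrite mem_filter fi' mem_iota.
Qed.
(** The missing neighbours of [i] are among the unlabelled vertices and the unsaturated labels,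
    other than [i], that are not adjacent to it. *)
Lemma hits_feasible l g : hits l g -> (forall j, (j < s)%N -> full g j) -> feasible tgtk n g.
Proof.
move=> lg Sfull; have lr := h_rz lg; rewrite /feasible unsatP; apply/allP => _ /mapP[i ii ->] /=.
move: ii; rewrite mem_filter mem_iota => /andP[/andP[fi short] /andP[_ ig]].
rewrite ltbE count_farE count_map /=.
set x := nth v0 l i.
pose R := [seq w <- enum [pred w | e x w] | w \notin map (nth v0 l) (nbr g i)].
have sR : (size R = k - size (nbr g i))%N.
  have := count_predC [pred w | w \in map (nth v0 l) (nbr g i)] (enum [pred w | e x w]).
  rewrite -[RHS]cardE e_reg -!size_filter => E.
  suff E2 : size (filter [pred w | w \in map (nth v0 l) (nbr g i)] (enum [pred w | e x w])) = size (nbr g i).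
    by rewrite -E E2 addKn.
  rewrite -(size_map (nth v0 l) (nbr g i)); apply/perm_size/uniq_perm.
  - by rewrite filter_uniq ?enum_uniq.
  - exact: (map_nbr_uniq lr).
  move=> w; rewrite mem_filter mem_enum !inE; case: (boolP (w \in map _ _)) => //= /mapP[j jn ->].
  exact: (rz_adj lr).
rewrite count_filter -size_filter.
set C := filter _ _.
have iC : i \in C by rewrite mem_filter mem_iota /= fi short ig !andbT;
  apply/negP => /(nbr_irr e_irr lr ig); rewrite eqxx.
have Rsub : {subset R <= [seq nth v0 l j | j <- rem i C] ++ enum [pred w | w \notin l]}.
  move=> w; rewrite mem_filter mem_enum inE => /andP[wn xw]; rewrite mem_cat mem_enum inE orbC.
  case: (boolP (w \in l)) => //= wl; apply/mapP; exists (index w l); last by rewrite nth_index.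
  have wg : (index w l < size g)%N by rewrite -(rz_size lr) index_mem.
  have win : index w l \notin nbr g i.
    by apply: contra wn => h; rewrite -[w in w \in _](nth_index v0 wl) map_f.
  have wi : index w l != i.
    by apply: contraTneq xw => h; rewrite -(nth_index v0 wl) h e_irr.
  rewrite mem_rem_uniq ?filter_uniq ?iota_uniq // !inE wi /= mem_filter /= mem_iota wg win /= andbT.
  have cin : index w l \in cand_from tgtk 0 i 0 g.
    by apply: (cand_complete e_sym e_irr lr ig) => //; rewrite nth_index.
  by move: cin; rewrite mem_cand => /and5P[_ -> _ -> _].
have Ru : uniq R by rewrite filter_uniq ?enum_uniq.
have := uniq_leq_size Ru Rsub; rewrite size_cat size_map size_rem // sR -cardE.
have -> : #|[pred w | w \notin l]| = (n - size g)%N.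
  rewrite -(rz_size lr) -(card_uniqP (rz_uniq lr)) -(cardC (mem l)) addKn.
  by apply: eq_card => w; rewrite !inE.
have : (0 < size C)%N by case: (C) iC.
move=> C0 le; apply: leq_ltn_trans le _.
by rewrite addnC ltn_add2l ltn_predL.
Qed.

Lemma phase_step l g fs i : sound (g, fs) -> hits l g -> (i < size g)%N -> ~~ full g i ->
    (forall j, (j < s)%N -> full g j) ->
  exists st l', [/\ st \in children n s (feasible tgtk n) i fs (exts tgtk s n g i),
    sound st, hits l' st.1 & forall j, (j < s)%N -> full st.1 j].
Proof.
move=> sg lg ig fi Sfull; have lr := h_rz lg.
pose c := cand_from tgtk s i 0 g.
have [||||nw [X [lg' gin Xc _]]] := hits_extend lg ig (c := c) (fresh := (n - size g)%N).
- exact: cand_uniq.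
- move=> j; rewrite mem_cand => /and5P[jg fj _ _ /andP[_ nj]]; split=> //.
  by apply: contra nj => /(rz_sym lr ig).
- move=> j jg ij jn; apply: (cand_complete e_sym e_irr lr ig) => //.
  (* A label of [S] is complete, so an edge from it to [i] would be known already. *)
  rewrite jg andbT leqNgt; apply/negP => js; move/negP: jn; apply.
  by apply/(rz_sym lr jg)/(adj_label lr jg) => //; [apply: (rz_full lr jg); apply: Sfull | rewrite e_sym].
- rewrite -(rz_size lr) -(card_uniqP (rz_uniq lr)) -(cardC (mem l)) addKn.
  by apply/subset_leq_card/fintype.subsetP => w; rewrite !inE => /andP[].
have Xok j : j \in X -> (j < size g)%N && ~~ full g j.
  by move/Xc; rewrite mem_cand => /and5P[-> -> _ _ _].
have Sfull' j : (j < s)%N -> full (extend g i (size nw) X) j.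
  move=> js; have jg := leq_trans js (h_s lg).
  by rewrite full_extend ?jg ?Sfull ?orbT //; lia.
have [st stin stE] := child_hit sg lg ig fi Xok lg'.
exists st, (l ++ nw); split.
- apply/flattenP; exists (child n s i fs (size nw, extend g i (size nw) X)) => //.
  by apply/map_f; rewrite mem_filter gin andbT /= (hits_feasible lg').
- exact: child_sound Xok _ stin.
- by rewrite stE.
- by move=> j js; rewrite stE Sfull'.
Qed.

(** * The end game, when every vertex has a label *)

Section End.
Variables (l : seq V) (g : pgraph).
Hypotheses (lg : realizes l g) (gn : size g = n).

Notation vl := (nth v0 l).

Definition complete_list (i : nat) (nb : seq nat) : Prop :=
  [/\ (i < n)%N, uniq nb & forall j, j \in nb = (j < n)%N && e (vl i) (vl j)].

Let sl : size l = n. Proof. by rewrite (rz_size lg). Qed.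

Lemma label_of w : exists2 j, (j < n)%N & vl j = w.
Proof.
have wl : w \in l.
  have E : #|l| = #|V| by rewrite (card_uniqP (rz_uniq lg)) sl.
  by rewrite (subset_cardP E (subset_predT _)).
by exists (index w l); rewrite ?nth_index // -sl index_mem.
Qed.

Lemma vl_inj i j : (i < n)%N -> (j < n)%N -> (vl i == vl j) = (i == j).
Proof. by move=> il jl; rewrite nth_uniq ?sl ?(rz_uniq lg). Qed.

Lemma complete_map i nb : complete_list i nb ->
  uniq (map vl nb) /\ forall w, w \in map vl nb = e (vl i) w.
Proof.
case=> il nbU nbE; split.
  rewrite map_inj_in_uniq // => j j'; rewrite !nbE => /andP[jl _] /andP[j'l _] /eqP.
  by rewrite vl_inj // => /eqP.
move=> w; apply/mapP/idP => [[j]|iw]; first by rewrite nbE => /andP[_ ij] ->.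
by have [j jl jw] := label_of w; exists j; rewrite ?nbE ?jl jw.
Qed.

Lemma complete_csum i nb (z : V -> rat) : complete_list i nb ->
  csum e z (vl i) = z (vl i) + \sum_(j <- nb) z (vl j).
Proof.
move/complete_map => [mU mE]; congr (_ + _); rewrite -(big_map vl xpredT).
by rewrite big_uniq //; apply: eq_bigl => w; rewrite mE.
Qed.

Lemma complete_size i nb : complete_list i nb -> size nb = k.
Proof.
move/complete_map => [mU mE]; rewrite -(size_map vl) -(card_uniqP mU) -(e_reg (vl i)).
by apply: eq_card => w; rewrite inE mE.
Qed.

Definition done_eqs (dn : seq (nat * seq nat)) (y : nat -> rat) : Prop :=
  forall p, p \in dn -> y p.1 + \sum_(j <- p.2) y j = 0.

Definition done_ok (dn : seq (nat * seq nat)) : Prop :=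
  [/\ uniq (map fst dn), forall p, p \in dn -> complete_list p.1 p.2 &
      forall p, p \in dn -> ~~ full g p.1].

Lemma x0_eqs dn : done_ok dn ->
  label_eqs g (fun i => x0 (vl i)) /\ done_eqs dn (fun i => x0 (vl i)).
Proof.
case=> _ cdn _; split; first by apply: hits_eqs lg _ => i _ _; apply: x0_ker.
by move=> p /cdn pc; rewrite -(complete_csum x0 pc) x0_ker.
Qed.

(** The dependency gives a kernel vector supported on [i] and the rows used so far; the open label
    [w] outside them is a zero. *)
Lemma no_dependency dn i nb w : done_ok dn -> complete_list i nb -> ~~ full g i ->
    i \notin map fst dn -> (w < n)%N -> w != i -> ~~ full g w -> w \notin map fst dn ->
    (forall y, label_eqs g y -> done_eqs dn y -> y i + \sum_(j <- nb) y j = 0) -> False.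
Proof.
move=> [dU dC dF] iC fi idn wl wi fw wdn dep; have [il _ _] := iC.
pose P := [set v | [exists j : 'I_n, (vl j == v) && (full g j || (val j \in map fst dn))]].
have PE j : (j < n)%N -> (vl j \in P) = full g j || (j \in map fst dn).
  move=> jl; rewrite inE; apply/existsP/idP => [[j' /andP[]]|h].
    by rewrite vl_inj //= => /eqP->.
  by exists (Ordinal jl); rewrite eqxx.
have [||z [zker z1 zP]] := @dependent_row rat V e e_sym e_irr P (vl i).
- by rewrite PE // (negPf fi) (negPf idn).
- move=> z zP; rewrite (complete_csum _ iC); apply: (dep (fun j => z (vl j))).
    apply: hits_eqs lg _ => j jg fj; apply: zP; rewrite PE ?fj //.
    by rewrite -gn.
  move=> p pdn; rewrite -(complete_csum _ (dC _ pdn)) zP // PE; last by have [] := dC _ pdn.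
  by rewrite map_f ?orbT.
have znz : exists x, z x != 0 by exists (vl i); rewrite z1 oner_eq0.
have := ker_full zker znz (vl w); rewrite zP ?eqxx //.
  by rewrite PE // (negPf fw).
by rewrite vl_inj.
Qed.

Definition forms_for (fs : seq (seq Z)) dn : Prop :=
  [/\ size fs = n, uniform fs & forall y, label_eqs g y -> done_eqs dn y ->
     exists t, forall i, (i < n)%N -> y i = rdot (nth [::] fs i) t].

Lemma forms_nonzero dn fs : done_ok dn -> forms_for fs dn -> has zerof fs = false.
Proof.
move=> ok [sfs _ fE]; have [le de] := x0_eqs ok; have [t tE] := fE _ le de.
apply/negbTE/hasPn => f /(nthP [::])[j jn <-]; apply/negP => zj.
by have := x0_full (vl j); rewrite tE -?sfs // (dot_zerof ratZ0) ?eqxx.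
Qed.

Lemma forms_eliminate dn fs i nb : complete_list i nb -> forms_for fs dn ->
  if eliminate idZ (rowsum fs i nb) fs is Some fs' then forms_for fs' ((i, nb) :: dn)
  else forall y, label_eqs g y -> done_eqs dn y -> y i + \sum_(j <- nb) y j = 0.
Proof.
move=> [il nbU nbE] [sfs ufs fE].
have nblt j : j \in nb -> (j < size fs)%N by rewrite nbE sfs => /andP[].
have rs : size (rowsum fs i nb) = size (head [::] fs) by apply: size_rowsum nblt ufs; rewrite sfs.
have rowE y t : (forall i, (i < n)%N -> y i = rdot (nth [::] fs i) t) ->
    rdot (rowsum fs i nb) t = y i + \sum_(j <- nb) y j.
  move=> tE; rewrite dot_rowsum ?tE //; last exact: ratZD.
  by congr (_ + _); apply: eq_big_seq => j /nblt; rewrite sfs => /tE.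
case E: eliminate => [fs'|]; last first.
  by move=> y /fE h /h[t /rowE<-]; apply: (eliminate_none ratZ0 _ E).
rewrite /uniform -rs in ufs.
have es t := eliminate_sound ratZ0 ratZ1 ratZD ratZM ratZ_id (fun j h => ratZ_neq0 h) ufs E (t := t).
have [sE u'] : size fs' = size fs /\ uniform fs'.
  have [|sE /uniformP u' _] := es (fun=> 0); last by split.
  by elim: (rowsum _ _ _) => //= c f ->; rewrite mulr0 addr0.
split=> //; first by rewrite sE.
move=> y le de; have [|t tE] := fE y le.
  by move=> p pdn; apply: de; rewrite inE pdn orbT.
have [|_ _ [t' t'E]] := es t; first by rewrite (rowE y) // (de (i, nb)) ?mem_head.
by exists t' => j /tE->; rewrite t'E.
Qed.

Lemma done_ok_catl l1 dn : done_ok (l1 ++ dn) -> done_ok dn.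
Proof.
case; rewrite map_cat cat_uniq => /and3P[_ _ U] C F; split=> // p pdn.
  by apply: C; rewrite mem_cat pdn orbT.
by apply: F; rewrite mem_cat pdn orbT.
Qed.

Lemma done_ok_perm dn dn' : perm_eq dn dn' -> done_ok dn -> done_ok dn'.
Proof.
move=> pm [U C F]; split=> [|p|p]; rewrite -?(perm_mem pm); [|exact: C|exact: F].
by rewrite -(perm_uniq (perm_map _ pm)).
Qed.

(** [dn] holds the rows already eliminated in [fs] and [l1] those to come. [done_ok] is kept for
    both together, so that the next row of [l1] can serve as the vertex where a dependency
    vanishes. *)
Lemma dead_completeP fs l1 dn : done_ok (l1 ++ dn) -> forms_for fs dn ->
  dead_complete fs l1 -> False.
Proof.
elim: l1 fs dn => //= -[i nb] l1 IH fs dn ok fE.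
have okdn := @done_ok_catl ((i, nb) :: l1) _ ok.
have ok' : done_ok (l1 ++ (i, nb) :: dn).
  by apply: done_ok_perm ok; rewrite -[_ :: dn]cat1s perm_sym perm_catCA.
have [U C F] := ok.
have iC : complete_list i nb by apply: (C (i, nb)); rewrite mem_head.
have := forms_eliminate iC fE; case: eliminate => [fs' fE'|dep].
  by rewrite (forms_nonzero (done_ok_catl ok') fE'); exact: IH ok' fE'.
case El: l1 => [|[w nbw] l2] // _.
have wl1 : (w, nbw) \in l1 by rewrite El mem_head.
have wok : (w, nbw) \in ((i, nb) :: l1) ++ dn by rewrite mem_cat inE wl1 !orbT.
apply: (no_dependency (w := w) okdn iC _ _ _ _ _ _ dep).
- by apply: (F (i, nb)); rewrite mem_head.
- by move: U; rewrite /= map_cat mem_cat negb_or /= => /andP[/andP[]].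
- by have [] := C _ wok.
- move: U; rewrite /= map_cat mem_cat negb_or /= => /andP[/andP[inl _] _].
  by apply: contraNneq inl => <-; apply: (map_f fst wl1).
- exact: (F (w, nbw)).
- move: U; rewrite /= map_cat cat_uniq => /and4P[_ _ /hasPn h _].
  by apply/negP => /h /negP; apply; apply: (map_f fst wl1).
Qed.

(** [ro_miss] closes the system: a neighbour that an open row still misses is itself an open row. *)
Record rows_ok (dn : seq (nat * seq nat)) (us : seq row_rec) : Prop := RowsOk {
  ro_done : done_ok dn;
  ro_uniq : uniq (map lab us);
  ro_lab : forall x, x \in us -> [/\ (lab x < n)%N, ~~ full g (lab x) & lab x \notin map fst dn];
  ro_nbs : forall x, x \in us -> [/\ uniq (nbs x), (size (nbs x) + need x)%N = k &
     forall j, j \in nbs x -> (j < n)%N && e (vl (lab x)) (vl j)];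
  ro_miss : forall x j, x \in us -> (j < n)%N -> e (vl (lab x)) (vl j) ->
     j \notin nbs x -> j \in map lab us;
  ro_sym : forall x y, x \in us -> y \in us -> lab y \in nbs x -> lab x \in nbs y;
  ro_size : exists m, all (fun x => (size (row_sum x) == m) && (size (form x) == m)) us;
  ro_forms : forall y, label_eqs g y -> done_eqs dn y -> exists t, forall x, x \in us ->
     y (lab x) = rdot (form x) t /\ y (lab x) + \sum_(j <- nbs x) y j = rdot (row_sum x) t }.

Lemma perm_sort_rows us : perm_eq (sort_rows us) us.
Proof. by elim: us => //= x us IH; rewrite (perm_trans (perm_insert_by _ _ _)) // perm_cons. Qed.

Lemma rows_ok_perm dn us us' : perm_eq us us' -> rows_ok dn us -> rows_ok dn us'.
Proof.
move=> pm [h1 h2 h3 h4 h5 h6 [m h7] h8]; have E := perm_mem pm; have El := perm_map lab pm.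
split=> //.
- by rewrite -(perm_uniq El).
- by move=> x; rewrite -E; apply: h3.
- by move=> x; rewrite -E; apply: h4.
- by move=> x j; rewrite -E -(perm_mem El); apply: h5.
- by move=> x y; rewrite -!E; apply: h6.
- by exists m; rewrite -(perm_all _ pm).
- by move=> y le de; have [t tE] := h8 y le de; exists t => x; rewrite -E; apply: tE.
Qed.

Lemma rows_nonzero dn us x : rows_ok dn us -> x \in us -> zerof (form x) = false.
Proof.
move=> ok xus; have [le de] := x0_eqs (ro_done ok).
have [t /(_ x xus)[tE _]] := ro_forms ok le de.
by apply/negP => zx; have := x0_full (vl (lab x)); rewrite tE (dot_zerof ratZ0) ?eqxx.
Qed.

Section Step.
Variables (dn : seq (nat * seq nat)) (u : row_rec) (tl : seq row_rec).
Hypothesis ok : rows_ok dn (u :: tl).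

Definition missing (x : row_rec) := e (vl (lab u)) (vl (lab x)) && (lab x \notin nbs u).
Let R := chosen_row missing (row_sum u) tl.
Let NB := chosen_nbs missing (nbs u) tl.
Let TL := chosen_tail missing (lab u) (form u) tl.

Let uin : u \in u :: tl := mem_head u tl.
Let tlin x : x \in tl -> x \in u :: tl. Proof. by rewrite inE orbC => ->. Qed.

Let u_tl x : x \in tl -> lab x != lab u.
Proof.
have /= /andP[utl _] := ro_uniq ok.
by move=> xtl; apply: contraNneq utl => <-; apply: map_f.
Qed.

Lemma chosen_mem j : j \in NB = (j \in map lab (filter missing tl)) || (j \in nbs u).
Proof. by rewrite /NB chosen_nbsE catrevE mem_cat mem_rev. Qed.

Lemma chosen_complete : complete_list (lab u) NB.
Proof.
have [ul uf _] := ro_lab ok uin; have [nU _ nadj] := ro_nbs ok uin.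
have /= /andP[_ tlU] := ro_uniq ok.
split=> // [|j].
  rewrite /NB chosen_nbsE catrevE cat_uniq rev_uniq nU andbT; apply/andP; split.
    by apply: subseq_uniq tlU; apply/map_subseq/filter_subseq.
  apply/hasP => -[j jn]; rewrite /= mem_rev => /mapP[x]; rewrite mem_filter => /andP[/andP[_ xn] _] jx.
  by rewrite -jx jn in xn.
rewrite chosen_mem; apply/idP/idP => [/orP[/mapP[x]|/nadj//]|/andP[jn uj]].
  by rewrite mem_filter => /andP[/andP[ux _] /tlin/(ro_lab ok)[xl _ _]] ->; rewrite xl.
case: (boolP (j \in nbs u)) => [|jnb]; rewrite ?orbT // orbF.
have := ro_miss ok uin jn uj jnb; rewrite /= inE => /orP[/eqP ju|/mapP[x xtl jx]].
  by rewrite ju e_irr in uj.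
by apply/mapP; exists x; rewrite // mem_filter /missing -jx uj jnb.
Qed.

Lemma count_missing : count missing tl = need u.
Proof.
have := complete_size chosen_complete; rewrite /NB chosen_nbsE catrevE size_cat size_rev.
rewrite size_map size_filter; have [_ <- _] := ro_nbs ok uin.
by rewrite addnC => /addnI.
Qed.

(** A row with nothing missing lists all its neighbours, by counting, and would contain [u]. *)
Lemma missing_need x : x \in tl -> missing x -> (0 < need x)%N && (lab u \notin nbs x).
Proof.
move=> xtl /andP[ux xn]; have xin := tlin xtl.
have unx : lab u \notin nbs x by apply: contra xn => /(ro_sym ok xin uin).
rewrite unx andbT lt0n; apply/eqP => x0'; have [xU xk xadj] := ro_nbs ok xin.
have [xl _ _] := ro_lab ok xin; have [ul _ _] := ro_lab ok uin.
have cx : complete_list (lab x) (nbs x).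
  split=> // j; apply/idP/idP => [/xadj//|/andP[jn xj]].
  have [mU mE] : uniq (map vl (nbs x)) /\
      map vl (nbs x) =i [pred w | e (vl (lab x)) w].
    have mU : uniq (map vl (nbs x)).
      rewrite map_inj_in_uniq // => a b /xadj/andP[an _] /xadj/andP[bn _] /eqP.
      by rewrite vl_inj // => /eqP.
    split=> //; apply/subset_cardP.
      by rewrite (card_uniqP mU) size_map e_reg -xk x0' addn0.
    by apply/fintype.subsetP => w /mapP[a /xadj/andP[_ xa] ->]; rewrite inE.
  have : vl j \in map vl (nbs x) by rewrite mE inE.
  case/mapP => a ax /eqP; have /andP[an _] := xadj _ ax.
  by rewrite vl_inj // => /eqP->.
have [_ _ cE] := cx; move: unx; rewrite cE ul e_sym ux.
by [].
Qed.

Lemma chosen_done : done_ok ((lab u, NB) :: dn).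
Proof.
have [dU dC dF] := ro_done ok; have [ul uf ud] := ro_lab ok uin.
split=> [|p|p]; first by rewrite /= ud.
  by rewrite inE => /orP[/eqP->|/dC//]; apply: chosen_complete.
by rewrite inE => /orP[/eqP->|/dF//].
Qed.

Lemma chosen_row_eq y t : (forall x, x \in u :: tl ->
     y (lab x) = rdot (form x) t /\ y (lab x) + \sum_(j <- nbs x) y j = rdot (row_sum x) t) ->
  rdot R t = y (lab u) + \sum_(j <- NB) y j.
Proof.
move=> tE; rewrite /R dot_chosen_row; have [_ <-] := tE _ uin.
have pm : perm_eq NB (map lab (filter missing tl) ++ nbs u).
  by rewrite /NB chosen_nbsE catrevE perm_cat2r perm_rev.
rewrite -addrA; congr (_ + _); rewrite (perm_big _ pm) big_cat big_map addrC /=; congr (_ + _); apply: eq_big_seq => x.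
by rewrite mem_filter => /andP[_ /tlin/tE[-> _]].
Qed.

(** [f] stands for the substitution of the parameter eliminated by the row of [u]; only its effect
    on sizes and values enters. *)
Lemma chosen_rows f : (forall m, all (fun x => (size (row_sum x) == m) && (size (form x) == m)) (u :: tl) ->
     exists m', forall h, size h = m -> size (f h) = m') ->
   (forall y, label_eqs g y -> done_eqs ((lab u, NB) :: dn) y -> forall t, rdot R t = 0 ->
     exists t', forall h, size h = size R -> rdot (f h) t' = rdot h t) ->
  rows_ok ((lab u, NB) :: dn)
    (map (fun x => RowRec (lab x) (need x) (nbs x) (f (row_sum x)) (f (form x))) TL).
Proof.
move=> fsize fdot.
have labTL : map lab TL = map lab tl.
  by rewrite -map_comp; apply: eq_map => x /=; case: ifP.
have TLP z : z \in TL -> exists2 x, x \in tl & [/\ lab z = lab x,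
    need z = (need x - missing x)%N,
    nbs z = (if missing x then lab u :: nbs x else nbs x),
    row_sum z = (if missing x then addf (row_sum x) (form u) else row_sum x) & form z = form x].
  by case/mapP => x xtl ->; exists x => //; case: ifP => _; split; rewrite ?subn1 ?subn0.
have [m um] := ro_size ok; have [m' fm] := fsize _ um.
have sz z : z \in TL -> size (row_sum z) = m /\ size (form z) = m.
  case/TLP => x /tlin xin [_ _ _ -> ->]; have /andP[/eqP rx /eqP fx] := allP um _ xin.
  have /andP[_ /eqP fu] := allP um _ uin.
  by case: ifP => _; rewrite ?size_addf ?rx ?fx ?fu ?maxnn.
have sR : size R = m.
  move: um => /= /andP[/andP[/eqP rm _] /allP tm]; apply: size_chosen_row rm _.
  by apply/allP => x /tm/andP[].
set us' := map _ TL.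
have usP z : z \in us' -> exists2 x, x \in tl & [/\ lab z = lab x,
    need z = (need x - missing x)%N &
    nbs z = (if missing x then lab u :: nbs x else nbs x)].
  by case/mapP => z' /TLP[x xtl [l1 l2 l3 _ _]] ->; exists x.
have labus : map lab us' = map lab tl by rewrite -labTL -map_comp.
have [ul uf ud] := ro_lab ok uin; have [uU uk uadj] := ro_nbs ok uin.
split.
- exact: chosen_done.
- by rewrite labus; have /= /andP[] := ro_uniq ok.
- move=> z /usP[x xtl [-> _ _]]; have [xl xf xd] := ro_lab ok (tlin xtl).
  by split; rewrite //= inE negb_or (u_tl xtl).
- move=> z /usP[x xtl [-> -> ->]]; have [xU xk xadj] := ro_nbs ok (tlin xtl).
  case: ifP => mx; rewrite ?subn0 //.
  have /andP[x0' unx] := missing_need xtl mx; split; rewrite /= ?unx ?xU //; first by rewrite addSnnS subn1 prednK.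
  move=> j; rewrite inE => /orP[/eqP->|/xadj//]; rewrite ul e_sym.
  by case/andP: mx.
- move=> z j /usP[x xtl [-> _ ->]] jn xj jnb; rewrite labus.
  have := @ro_miss _ _ ok x j (tlin xtl) jn xj; rewrite /= inE.
  have [ju|ju] := eqVneq j (lab u); last first.
    by apply; apply: contra jnb; case: ifP; rewrite ?inE => // _ ->; rewrite orbT.
  exfalso; move/negP: jnb; apply; case: ifP => [_|/negbT]; first by rewrite ju inE eqxx.
  rewrite negb_and -ju e_sym xj negbK /= ju => xn; exact: (ro_sym ok uin (tlin xtl)).
- move=> z w /usP[x xtl [-> _ ->]] /usP[x' x'tl [-> _ ->]].
  have sym := ro_sym ok (tlin xtl) (tlin x'tl).
  have s2 : lab x' \in nbs x -> lab x \in (if missing x' then lab u :: nbs x' else nbs x').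
    by move/sym; case: ifP; rewrite ?inE => // _ ->; rewrite orbT.
  case: ifP => _ //; rewrite inE (negPf (u_tl x'tl)) /=; exact: s2.
- exists m'; apply/allP => _ /mapP[z /sz[rz fz] ->] /=.
  by rewrite !fm ?eqxx.
- move=> y le de; have de' : done_eqs dn y by move=> p pdn; apply: de; rewrite inE pdn orbT.
  have [t tE] := ro_forms ok le de'.
  have Rt : rdot R t = 0 by rewrite (chosen_row_eq tE) (de (lab u, NB)) ?mem_head.
  have [t' t'E] := fdot y le de t Rt; exists t' => _ /mapP[z zTL ->] /=.
  have [rz fz] := sz _ zTL; rewrite !t'E ?rz ?fz ?sR //.
  have [x xtl [-> _ -> -> ->]] := TLP _ zTL; have [xE xrow] := tE _ (tlin xtl); split=> //.
  have [uE _] := tE _ uin.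
  by case: ifP => _ //; rewrite big_cons dot_addf ?addrA; [rewrite -xrow -uE; ring | exact: ratZD].
Qed.
End Step.

(** [fs] stays as it was when the end game began, hence the empty list of rows in [forms_for], while
    the forms inside [us] follow the eliminations of [dn]. *)
Lemma dead_endP fuel fs dn us : forms_for fs [::] -> rows_ok dn us -> dead_end fuel fs dn us -> False.
Proof.
move=> fE; elim: fuel dn us => //= fuel IH dn us ok; have := perm_sort_rows us.
case: (sort_rows us) => [//|u tl]; rewrite perm_sym => /rows_ok_perm/(_ ok) {}ok.
rewrite -(count_missing ok); move/(choose_all (missing_need ok)) => /=.
set R := chosen_row _ _ _; set NB := chosen_nbs _ _ _; set TL := chosen_tail _ _ _ _.
have okd : done_ok ((lab u, NB) :: dn) := chosen_done ok.
have [ul uf ud] := ro_lab ok (mem_head _ _).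
have fin : dead_complete fs ((lab u, NB) :: dn) -> False.
  by apply: (dead_completeP _ fE); rewrite cats0.
have RE y t := @chosen_row_eq u tl y t; rewrite -/R -/NB in RE.
have [m um] := ro_size ok.
have sR : size R = m.
  move: um => /= /andP[/andP[/eqP rm _] /allP tm]; apply: size_chosen_row rm _.
  by apply/allP => x /tm/andP[].
have labTL : map lab TL = map lab tl.
  by rewrite -map_comp; apply: eq_map => x /=; case: ifP.
case E: pivot => [q|]; last first.
  case ETL: TL => [|w TL'] // _.
  have wtl : lab w \in map lab tl by rewrite -labTL ETL mem_head.
  have [w' w'tl w'E] := mapP wtl; have w'in : w' \in u :: tl by rewrite inE w'tl orbT.
  have [wl wf wd] := ro_lab ok w'in; rewrite -w'E in wl wf wd.
  apply: (no_dependency (ro_done ok) (chosen_complete ok) uf ud wl _ wf wd).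
    by have /= /andP[utl _] := ro_uniq ok; apply: contraNneq utl => <-.
  move=> y le de; have [t tE] := ro_forms ok le de.
  by rewrite -(RE _ _ tE); apply/(dot_zerof ratZ0)/pivot_none.
have [qR q0] := pivot_some E.
have sub t := subst1_sound ratZ0 ratZ1 ratZD ratZM ratZ_id qR (ratZ_neq0 q0) (t := t).
set f := subst1 _ _ _ _.
have ok' : rows_ok ((lab u, NB) :: dn)
    (map (fun x => RowRec (lab x) (need x) (nbs x) (f (row_sum x)) (f (form x))) TL).
  apply: (chosen_rows ok).
    move=> m1 /= /andP[/andP[/eqP rm1 _] _]; exists m.-1 => h hm; rewrite -sR; apply: size_subst1 => //.
    by move: um => /= /andP[/andP[/eqP rm _] _]; rewrite hm sR -rm.
  by move=> y le de t /sub.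
case ETL: TL => [|w TL'].
  case: ifP => // zf _; have [le de] := x0_eqs okd.
  have de' : done_eqs dn (fun i => x0 (vl i)) by move=> p pdn; apply: de; rewrite inE pdn orbT.
  have [t tE] := ro_forms ok le de'.
  have Rt : rdot R t = 0 by rewrite (RE _ _ tE) (de (lab u, NB)) ?mem_head.
  have [t' t'E] := sub t Rt; have [uE _] := tE _ (mem_head _ _).
  have := x0_full (vl (lab u)); rewrite uE -t'E ?(dot_zerof ratZ0) ?eqxx //.
  by move: um => /= /andP[/andP[_ /eqP fm] _]; rewrite fm sR.
rewrite -ETL; case: ifP => [/hasP[z zin zz] _|_]; last exact: IH.
by have := rows_nonzero ok' zin; rewrite zz.
Qed.

Lemma mem_open_rows fs x : x \in open_rows k fs 0 g -> [/\ (lab x < size g)%N, ~~ full g (lab x) &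
  x = RowRec (lab x) (k - size (nbr g (lab x)))%N (nbr g (lab x))
        (rowsum fs (lab x) (nbr g (lab x))) (nth [::] fs (lab x))].
Proof.
by rewrite open_rowsE => /mapP[j]; rewrite mem_filter mem_iota => /andP[fj /andP[_ jg]] ->.
Qed.

Lemma lab_open_rows fs : map lab (open_rows k fs 0 g) = [seq j <- iota 0 (size g) | ~~ full g j].
Proof. by rewrite open_rowsE -map_comp; apply: map_id. Qed.

Lemma open_rows_ok fs : sound (g, fs) -> rows_ok [::] (open_rows k fs 0 g).
Proof.
case=> /= sfs ufs _ fE.
have sf j : (j < size g)%N -> size (nth [::] fs j) = size (head [::] fs).
  by move=> jg; apply/eqP/(allP ufs)/mem_nth; rewrite sfs.
split=> //.
- by rewrite lab_open_rows filter_uniq ?iota_uniq.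
- by move=> x /mem_open_rows[xg xf _]; rewrite -gn.
- move=> x /mem_open_rows[xg xf ->] /=; split; first exact: (rz_nuniq lg).
    by rewrite subnKC // (nbr_size_le lg xg).
  by move=> j jn; rewrite -gn (rz_lt lg xg) ?(rz_adj lg xg).
- move=> x j /mem_open_rows[xg xf ->] /= jn xj jx; rewrite lab_open_rows mem_filter mem_iota /= gn jn andbT.
  apply: contra jx => fj; have jg : (j < size g)%N by rewrite gn.
  apply: (rz_sym lg jg); apply: (adj_label lg jg (rz_full lg jg fj) xg); by rewrite e_sym.
- by move=> x y /mem_open_rows[xg xf ->] /mem_open_rows[yg yf ->] /=; apply: (rz_sym lg).
- exists (size (head [::] fs)); apply/allP => x /mem_open_rows[xg xf ->] /=.
  rewrite sf // eqxx andbT; apply/eqP/size_rowsum; rewrite ?sfs //.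
  by move=> j; apply: (rz_lt lg xg).
move=> y /fE[t tE] _; exists t => x /mem_open_rows[xg xf ->] /=; rewrite -tE //; split=> //.
rewrite dot_rowsum -?tE //; last exact: ratZD.
by congr (_ + _); apply: eq_big_seq => j jn; rewrite -tE ?(rz_lt lg xg).
Qed.
End End.

Lemma hits_size l g : hits l g -> (size g <= n)%N.
Proof.
by move/h_rz => lr; rewrite -(rz_size lr) -(card_uniqP (rz_uniq lr)) max_card.
Qed.

Lemma deadP fuel w st l : sound st -> hits l st.1 -> (forall j, (j < s)%N -> full st.1 j) ->
  dead n k s fuel w st -> False.
Proof.
elim: fuel st l => //= fuel IH [g fs] l sg lg Sfull.
case: ifP => [c|_].
  have gn : size g = n by apply/eqP; rewrite eqn_leq (hits_size lg) -lebE /=; move: c; case: Nat.leb.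
  apply: (dead_endP (h_rz lg) gn); last first.
    exact: open_rows_ok (h_rz lg) gn _ sg.
  have [/= sfs ufs _ fE] := sg; split; rewrite ?sfs // => y le _.
  by have [t tE] := fE y le; exists t => i; rewrite -gn; apply: tE.
case E: pick_from => [i|] //; have /andP[ig fi] := pick_fromP E.
have [st [l' [stin sst lst Sst]]] :=
  phase_step sg lg ig fi Sfull.
by move/allP/(_ st stin); apply: IH lst Sst.
Qed.

(** While [S] is being completed, no label outside [S] has been expanded, so that its known
    neighbours all lie in [S]. *)
Definition outer_to_core (g : pgraph) : Prop :=
  forall j i, (s <= j < size g)%N -> i \in nbr g j -> (i < s)%N.

(** * Parity of the neighbourhoods in [S] *)

Section Parity.
Variables (l : seq V) (g : pgraph).
Hypotheses (lg : hits l g) (og : outer_to_core g).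
Notation vl := (nth v0 l).
Let lr := h_rz lg.
Let sg := h_s lg.

Lemma core_count x : #|[pred y | (y \in S) && e x y]| = count (fun i => e x (vl i)) (iota 0 s).
Proof.
rewrite -size_filter -(size_map vl); set m := map vl _.
have mU : uniq m.
  rewrite map_inj_in_uniq ?filter_uniq ?iota_uniq // => i j.
  rewrite !mem_filter !mem_iota => /and3P[_ _ il] /and3P[_ _ jl] /eqP.
  by rewrite nth_uniq ?(rz_size lr) ?(rz_uniq lr) ?(leq_trans _ sg) // => /eqP.
rewrite -(card_uniqP mU); apply: eq_card => y; rewrite inE; apply/andP/mapP => [[yS xy]|[i]].
  have yl := h_all lg yS; exists (index y l); last by rewrite nth_index.
  have yg : (index y l < size g)%N by rewrite -(rz_size lr) index_mem.
  by rewrite mem_filter mem_iota nth_index // xy -(h_core lg yg) nth_index.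
rewrite mem_filter mem_iota => /andP[xi /andP[_ il]] ->; split=> //.
by rewrite (h_core lg) // (leq_trans _ sg).
Qed.

Definition open_core := [seq i <- iota 0 s | ~~ full g i].
Definition missing_edge i j := e (vl i) (vl j) && (i \notin nbr g j).

Lemma missing_open i j : (i < s)%N -> (j < size g)%N -> missing_edge i j -> ~~ full g i.
Proof.
move=> il jg /andP[ij nj]; have ig := leq_trans il sg; apply: contra nj => fi.
apply: (rz_sym lr ig); apply: (adj_label lr ig (rz_full lr ig fi) jg ij).
Qed.

(** A vertex outside [S] has evenly many neighbours in [S], and these are its known neighbours
    together with the ends of its missing edges. *)
Lemma outer_parity j : (s <= j < size g)%N ->
  odd (size (nbr g j)) = odd (count (missing_edge^~ j) open_core).
Proof.
move=> /andP[sj jg].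
have : ~~ odd #|[pred y | (y \in S) && e (vl j) y]|.
  by rewrite S_parity (h_core lg) // -leqNgt.
rewrite core_count.
have -> : count (fun i => e (vl j) (vl i)) (iota 0 s) =
    (count (mem (nbr g j)) (iota 0 s) + count (missing_edge^~ j) (iota 0 s))%N.
  rewrite -count_predUI [X in (_ + X)%N](_ : _ = 0%N) ?addn0.
    apply: eq_in_count => i; rewrite mem_iota /= /missing_edge => il.
    by case: (boolP (i \in nbr g j)) => [/(rz_adj lr jg)|] /=; rewrite // andbT e_sym.
  apply/eqP; rewrite eqn0Ngt -has_count; apply/hasPn => i _ /=.
  by rewrite /missing_edge; case: (i \in nbr g j); rewrite ?andbF.
have -> : count (mem (nbr g j)) (iota 0 s) = size (nbr g j).
  rewrite -size_filter; apply/perm_size/uniq_perm; rewrite ?filter_uniq ?iota_uniq ?(rz_nuniq lr) //.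
  move=> i; rewrite mem_filter mem_iota /=; case: (boolP (i \in nbr g j)) => //= ij.
  by apply: og ij; rewrite sj.
have -> : count (missing_edge^~ j) open_core = count (missing_edge^~ j) (iota 0 s).
  rewrite count_filter; apply: eq_in_count => i; rewrite mem_iota /= => il.
  by case: (boolP (missing_edge i j)) => //= /(missing_open il jg)->.
by rewrite oddD negb_add => /eqP.
Qed.

Lemma missing_count i : (i < s)%N ->
  (count (missing_edge i) (iota s (size g - s)) <= k - size (nbr g i))%N.
Proof.
move=> il; have ig := leq_trans il sg.
rewrite leq_subRL; last exact: (nbr_size_le lr ig).
rewrite -size_filter -size_cat -(size_map vl) -(e_reg (vl i)).
have inP j : j \in nbr g i ++ [seq j <- iota s (size g - s) | missing_edge i j] ->
    (j < size g)%N /\ e (vl i) (vl j).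
  rewrite mem_cat mem_filter mem_iota => /orP[ij|/and3P[/andP[ij _] sj jg]].
    by rewrite (rz_lt lr ig ij) (rz_adj lr ig ij).
  by rewrite ij; split=> //; lia.
rewrite cardE; apply: uniq_leq_size.
  rewrite map_inj_in_uniq => [|a b /inP[ag _] /inP[bg _] /eqP]; last first.
    by rewrite nth_uniq ?(rz_size lr) ?(rz_uniq lr) // => /eqP.
  rewrite cat_uniq (rz_nuniq lr ig) filter_uniq ?iota_uniq // andbT.
  apply/hasP => -[j]; rewrite mem_filter => /andP[/andP[_ nj] _] /(rz_sym lr ig) /=.
  by rewrite (negPf nj).
by move=> w /mapP[j /inP[_ ij] ->]; rewrite mem_enum inE.
Qed.

(** Double counting of missing edges: an odd label misses at least one edge to an open vertex of
    [S], and such a vertex misses no more edges than its degree allows. *)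
Lemma odds_le : (odds (drop s g) <= \sum_(i <- open_core) (k - size (nbr g i)))%N.
Proof.
rewrite oddsE; apply: (@leq_trans (\sum_(i <- open_core) count (missing_edge i) (iota s (size g - s)))); last first.
  rewrite !big_seq; apply: leq_sum => i; rewrite mem_filter mem_iota => /andP[_ /andP[_ il]].
  exact: missing_count.
under eq_bigr => i _ do rewrite -sum1_count big_mkcond.
rewrite exchange_big /= size_filter -sum1_count big_mkcond big_seq [X in (_ <= X)%N]big_seq.
apply: leq_sum => j; rewrite mem_iota => jl.
rewrite outer_parity; last by lia.
by rewrite -big_mkcond sum1_count /=; case: (count _ _) => // c; case: ifP.
Qed.

(** All other vertices of [S] being complete, a neighbour without label would have [i] as its only
    neighbour in [S]; a labelled one not yet joined to [i] misses exactly one edge to [S], hence is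
    odd. *)
Lemma last_open i w : (i < s)%N -> (forall i', (i' < s)%N -> i' != i -> full g i') ->
    e (vl i) w -> w \notin S ->
  exists2 j, (s <= j < size g)%N && ((i \in nbr g j) || odd (size (nbr g j))) & w = vl j.
Proof.
move=> il fl iw wS; have ig := leq_trans il sg.
have wl : w \in l.
  apply: contraT => wl; suff E : #|[pred y | (y \in S) && e w y]| = 1%N.
    by have := S_parity w; rewrite E (negPf wS).
  rewrite core_count -(@eq_in_count _ (pred1 i)) => [|i']; last first.
    rewrite mem_iota /= => i'l; have [->|ne] := eqVneq i' i; first by rewrite e_sym iw.
    apply/esym/negbTE; apply: contra wl; rewrite e_sym => i'w.
    have i'g := leq_trans i'l sg.
    have [j jn ->] := nbr_complete lr i'g (rz_full lr i'g (fl _ i'l ne)) isT i'w.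
    by apply/mem_nth; rewrite (rz_size lr) (rz_lt lr i'g).
  by rewrite count_uniq_mem ?iota_uniq // mem_iota il.
have jg : (index w l < size g)%N by rewrite -(rz_size lr) index_mem.
have jw : vl (index w l) = w by apply: nth_index.
have sj : (s <= index w l)%N by move: wS; rewrite -{1}jw (h_core lg) // -leqNgt.
exists (index w l) => //; rewrite sj jg /=; case: (boolP (i \in nbr g (index w l))) => //= inn.
rewrite outer_parity ?sj // /open_core count_filter.
rewrite (@eq_in_count _ _ (pred1 i)) ?count_uniq_mem ?iota_uniq ?mem_iota ?il // => i'.
rewrite mem_iota /= => i'l; have [->|ne] := eqVneq i' i; last by rewrite fl // andbF.
have mis : missing_edge i (index w l) by rewrite /missing_edge jw iw.
by rewrite mis (missing_open il jg mis).
Qed.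

Lemma open_coreP i : open_core = [:: i] ->
  (i < s)%N /\ forall i', (i' < s)%N -> i' != i -> full g i'.
Proof.
move=> oE; have : i \in open_core by rewrite oE mem_head.
rewrite mem_filter mem_iota => /andP[_ il]; split=> // i' i'l ne; apply: contraT => fi'.
have : i' \in open_core by rewrite mem_filter fi' mem_iota.
by rewrite oE inE (negPf ne).
Qed.

Lemma parity_okP : parity_ok k s g.
Proof.
have := odds_le; rewrite /parity_ok open_coreE // -/open_core.
have -> : (\sum_(i <- open_core) (k - size (nbr g i)))%N =
    foldr (fun v m => (k - size v.2 + m)%N) 0%N (map (vx g) open_core).
  by rewrite -(big_map (vx g) xpredT (fun v => k - size v.2)%N) unlock.
case E: open_core => [|i [|i' o]] /=; rewrite ?eqnE.
- by rewrite leqn0.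
- rewrite addn0 => le; rewrite eqn_leq le /=; have [il fl] := open_coreP E.
  rewrite leq_subLR oddsE -/(nbr g i) -size_cat -(size_map vl) -[X in (X <= _)%N](e_reg (vl i)) cardE.
  apply: uniq_leq_size (enum_uniq _) _ => w; rewrite mem_enum inE => iw.
  rewrite map_cat mem_cat; case: (boolP (w \in S)) => wS.
    have wl := h_all lg wS; have wg : (index w l < size g)%N by rewrite -(rz_size lr) index_mem.
    apply/orP; left; apply/mapP; exists (index w l); last by rewrite nth_index.
    by apply: (h_adj lg) => //; rewrite -?(h_core lg) ?nth_index.
  have [j /andP[jl /orP[ij|jo]] ->] := last_open il fl iw wS; apply/orP; [left|right]; apply: map_f.
    by apply: (rz_sym lr _ ij); case/andP: jl.
  by rewrite mem_filter jo mem_iota; lia.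
by rewrite lebE.
Qed.
End Parity.

Definition reached (st : state) : Prop :=
  sound st /\ exists2 l, hits l st.1 &
    (forall j, (j < s)%N -> full st.1 j) \/ outer_to_core st.1.

Lemma core_step l g fs i c fresh : sound (g, fs) -> hits l g -> outer_to_core g ->
    (i < s)%N -> ~~ full g i -> uniq c -> {subset c <= cand_from tgtk s i 0 g} ->
    (forall j, (j < size g)%N -> e (nth v0 l i) (nth v0 l j) -> j \notin nbr g i -> j \in c) ->
    (#|[pred w | e (nth v0 l i) w && (w \notin l)]| <= fresh)%N ->
  exists2 st, st \in children n s (parity_ok k s) i fs (exts_with tgtk c fresh g i) & reached st.
Proof.
move=> sg lg og il fi cU cc cC fr; have lr := h_rz lg; have ig := leq_trans il (h_s lg).
have ccP j : j \in c -> [/\ (j < size g)%N, ~~ full g j & j \notin nbr g i].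
  move/cc; rewrite mem_cand => /and5P[jg fj _ _ /andP[_ nj]]; split=> //.
  by apply: contra nj => /(rz_sym lr ig).
have [nw [X [lg' gin Xc nwE]]] := hits_extend lg ig cU ccP cC fr.
have Xok j : j \in X -> (j < size g)%N && ~~ full g j by move/Xc/ccP => [-> ->].
have og' : outer_to_core (extend g i (size nw) X).
  move=> j p /andP[sj]; rewrite size_extend => jg; rewrite nbr_extend //.
  case: ifP => jg'; last by rewrite inE => /eqP->.
  case: eqP => [ij|_]; first by lia.
  have old : p \in nbr g j -> (p < s)%N by apply: og; rewrite sj.
  by case: ifP => _ //; rewrite inE => /orP[/eqP->|].
have [st stin stE] := child_hit sg lg ig fi Xok lg'.
exists st.
  apply/flattenP; exists (child n s i fs (size nw, extend g i (size nw) X)) => //.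
  by apply/map_f; rewrite mem_filter gin andbT (parity_okP lg' og').
split; first exact: child_sound Xok _ stin.
by exists (l ++ nw); rewrite stE //; right.
Qed.

Lemma stepS_reached st : reached st -> exists2 st', st' \in stepS n k s st & reached st'.
Proof.
case: st => g fs [sg [l /= lg phase]]; have lr := h_rz lg; rewrite /stepS /=.
have fresh_le i : (#|[pred w | e (nth v0 l i) w && (w \notin l)]| <= n - size g)%N.
  rewrite -(rz_size lr) -(card_uniqP (rz_uniq lr)) -(cardC (mem l)) addKn.
  by apply/subset_leq_card/fintype.subsetP => w; rewrite !inE => /andP[].
have coreE := open_coreE (h_s lg); rewrite (firstopenE (h_s lg)).
case Ei: ohead => [i|]; last first.
  have Sfull j : (j < s)%N -> full g j.
    move=> js; apply: contraT => fj; have : j \in [seq i <- iota 0 s | ~~ full g i].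
      by rewrite mem_filter fj mem_iota.
    by case: filter Ei.
  case E: pick_from => [i|]; last by exists (g, fs); [rewrite mem_head | split=> //; exists l].
  have /andP[ig fi] := pick_fromP E.
  have [st [l' [stin sst lst Sst]]] :=
    phase_step sg lg ig fi Sfull.
  by exists st => //; split=> //; exists l' => //; left.
have : i \in [seq i <- iota 0 s | ~~ full g i] by case: filter Ei => //= a o [->]; rewrite mem_head.
rewrite mem_filter mem_iota => /andP[fi /andP[_ il]]; have ig := leq_trans il (h_s lg).
have og : outer_to_core g by case: phase => // /(_ i il); rewrite (negPf fi).
have complete j : (j < size g)%N -> e (nth v0 l i) (nth v0 l j) -> j \notin nbr g i ->
    j \in cand_from tgtk s i 0 g.
  move=> jg ij nj; apply: (cand_complete e_sym e_irr lr ig) => //; rewrite jg andbT leqNgt.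
  by apply: contra nj => js; apply: (h_adj lg).
have gen : exists2 st, st \in children n s (parity_ok k s) i fs
      (exts_with tgtk (cand_from tgtk s i 0 g) (n - size g) g i) & reached st.
  exact: (core_step sg lg og il fi (cand_uniq _ _ _ _)).
case E: [seq v <- take s g | ~~ v.1] => [|v [|v' o]]; [exact: gen| |exact: gen].
have oE : open_core g = [:: i].
  move: E Ei; rewrite coreE -/(open_core g).
  by case: (open_core g) => [|a [|]] //= _ [->].
have [_ fl] := open_coreP oE.
have last w : e (nth v0 l i) w -> w \notin S -> exists2 j,
    (s <= j < size g)%N && ((i \in nbr g j) || odd (size (nbr g j))) & w = nth v0 l j.
  exact: (last_open lg og il fl).
apply: (core_step sg lg og il fi).
- by rewrite filter_uniq ?cand_uniq.
- by move=> j; rewrite mem_filter => /andP[].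
- move=> j jg ij nj; rewrite mem_filter complete // andbT.
  have [|j' /andP[j'g oj] /eqP] := last _ ij.
    by rewrite (h_core lg) //; apply: contra nj => js; apply: (h_adj lg).
  have /andP[_ j'l] := j'g; rewrite nth_uniq ?(rz_size lr) ?(rz_uniq lr) // => /eqP jj; subst j'.
  by case/orP: oj => // /(rz_sym lr jg); rewrite (negPf nj).
rewrite leqn0; apply/eqP/eq_card0 => w; rewrite inE; apply/negbTE; rewrite negb_and negbK orbC.
rewrite -implyNb; apply/implyP => wl; apply: contra wl => iw; case: (boolP (w \in S)) => [|wS].
  exact: (h_all lg).
by have [j /andP[/andP[_ jg] _] ->] := last _ iw wS; rewrite mem_nth // (rz_size lr).
Qed.
End Search.

(** * Relabelling and merging of states *)

Definition relabel_graph p (g : pgraph) : pgraph := (relabel p (g, [::])).1.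

Lemma relabel1 p st : (relabel p st).1 = relabel_graph p st.1. Proof. by []. Qed.

Lemma positionE j p : position j p = index j p.
Proof. by elim: p => //= x p ->; rewrite eqnE. Qed.

Section Relabel.
Variables (p : seq nat) (g : pgraph).
Hypothesis pP : perm_eq p (iota 0 (size g)).

Let pU : uniq p. Proof. by rewrite (perm_uniq pP) iota_uniq. Qed.
Let psz : size p = size g. Proof. by rewrite (perm_size pP) size_iota. Qed.
Let pmem j : (j \in p) = (j < size g)%N. Proof. by rewrite (perm_mem pP) mem_iota. Qed.
Let plt j : (j < size g)%N -> (nth 0%N p j < size g)%N.
Proof. by move=> jg; rewrite -pmem mem_nth ?psz. Qed.
Let ilt j : (j < size g)%N -> (index j p < size g)%N.
Proof. by move=> jg; rewrite -psz index_mem pmem. Qed.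

Lemma size_relabel : size (relabel_graph p g) = size g.
Proof. by rewrite size_map psz. Qed.

Lemma full_relabel j : (j < size g)%N -> full (relabel_graph p g) j = full g (nth 0%N p j).
Proof. by move=> jg; rewrite /full /vx (nth_map 0%N) ?psz. Qed.

Lemma nbr_relabel j : well_labelled g -> (j < size g)%N ->
  perm_eq (nbr (relabel_graph p g) j) [seq index x p | x <- nbr g (nth 0%N p j)].
Proof.
move=> wg jg; rewrite /nbr /vx (nth_map 0%N) ?psz //= -/(nbr g _) -/(vx g _) -/(nbr g _).
have : all (fun x => x < size g)%N (nbr g (nth 0%N p j)).
  by apply/allP => x; apply: wg; apply: plt.
elim: (nbr g _) => //= x r IH /andP[xg rg].
rewrite (perm_trans (perm_insert_by _ _ _)) //= (nth_map 0%N) ?size_iota ?psz // nth_iota ?psz //.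
by rewrite positionE perm_cons IH.
Qed.

Lemma mem_nbr_relabel i j : well_labelled g -> (i < size g)%N -> (j < size g)%N ->
  (j \in nbr (relabel_graph p g) i) = (nth 0%N p j \in nbr g (nth 0%N p i)).
Proof.
move=> wg ig jg; rewrite (perm_mem (nbr_relabel wg ig)); apply/mapP/idP => [[x xn jx]|jn].
  by rewrite jx nth_index // pmem; apply: wg xn; apply: plt.
by exists (nth 0%N p j) => //; rewrite index_uniq ?psz.
Qed.

Lemma relabel_lt i j : well_labelled g -> (i < size g)%N -> j \in nbr (relabel_graph p g) i ->
  (j < size g)%N.
Proof.
move=> wg ig; rewrite (perm_mem (nbr_relabel wg ig)) => /mapP[x xn ->].
by apply: ilt; apply: wg xn; apply: plt.
Qed.

Lemma relabel_well_labelled : well_labelled g -> well_labelled (relabel_graph p g).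
Proof. by move=> wg i j; rewrite size_relabel; apply: relabel_lt. Qed.

Lemma relabel_sound fs : sound (g, fs) -> sound (relabel p (g, fs)).
Proof.
case=> /= sfs ufs wg fE; split=> /=.
- by rewrite !size_map.
- apply: (@uniformP _ (size (head [::] fs))); apply/allP => _ /mapP[j jp ->].
  by apply: (allP ufs); apply: mem_nth; rewrite sfs -pmem.
- exact: relabel_well_labelled.
move=> y; rewrite -/(relabel_graph p g) => le.
have [|t tE] := fE (fun j => y (index j p)).
  move=> i ig fi; have := le (index i p); rewrite size_relabel ilt // full_relabel ?ilt //.
  rewrite nth_index ?pmem // => /(_ isT fi); rewrite (perm_big _ (nbr_relabel wg (ilt ig))) big_map.
  by rewrite nth_index ?pmem.
exists t => i; rewrite size_map psz => ig; rewrite (nth_map 0%N) ?psz // -tE ?plt //.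
by rewrite index_uniq ?psz.
Qed.

Section Realizes.
Variables (V : finType) (e : rel V) (D : {pred V}) (tgt : nat -> nat) (v0 : V) (l : seq V).
Hypothesis lg : realizes e D tgt v0 l g.

Let l' := [seq nth v0 l j | j <- p].

Lemma relabel_vl j : (j < size g)%N -> nth v0 l' j = nth v0 l (nth 0%N p j).
Proof. by move=> jg; rewrite (nth_map 0%N) ?psz. Qed.

Lemma relabel_mem : l' =i l.
Proof.
move=> w; apply/mapP/idP => [[j jp ->]|wl]; first by rewrite mem_nth // (rz_size lg) -pmem.
by exists (index w l); rewrite ?nth_index // pmem -(rz_size lg) index_mem.
Qed.

Lemma relabel_realizes : (forall j, (j < size g)%N -> tgt (nth 0%N p j) = tgt j) ->
  realizes e D tgt v0 l' (relabel_graph p g).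
Proof.
move=> ptgt; have wg : well_labelled g by move=> i j; apply: (rz_lt lg).
split; rewrite ?size_relabel.
- rewrite map_inj_in_uniq // => a b; rewrite !pmem => ag bg /eqP.
  by rewrite nth_uniq ?(rz_size lg) ?(rz_uniq lg) // => /eqP.
- by rewrite size_map.
- by move=> w; rewrite relabel_mem; apply: (rz_dom lg).
- by move=> i j; apply: relabel_lt.
- move=> i j ig jn; have jg := relabel_lt wg ig jn.
  rewrite !relabel_vl //; apply: (rz_adj lg); rewrite ?plt //.
  by move: jn; rewrite mem_nbr_relabel.
- move=> i ig; rewrite (perm_uniq (nbr_relabel wg ig)) map_inj_in_uniq ?(rz_nuniq lg) ?plt //.
  move=> a b an bn; have ag := wg _ _ (plt ig) an; have bg := wg _ _ (plt ig) bn.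
  by move/(congr1 (nth 0%N p)); rewrite !nth_index ?pmem.
- move=> i j ig jn; have jg := relabel_lt wg ig jn; move: jn.
  by rewrite !mem_nbr_relabel //; apply: (rz_sym lg); apply: plt.
- move=> i ig; rewrite full_relabel // (perm_size (nbr_relabel wg ig)) size_map -ptgt //.
  by apply: (rz_full lg); apply: plt.
- by move=> i ig; rewrite relabel_vl // -ptgt //; apply: (rz_deg lg); apply: plt.
Qed.
End Realizes.
End Relabel.

(** Whatever the colours are, they only influence the order inside each block, so the result is a
    permutation preserving the blocks. *)
Lemma labelling_blocks a s r g (p := (labelling a s r g).2) : (a <= s)%N ->
  [/\ perm_eq p (iota 0 (size g)),
    forall j, (j < size g)%N -> (nth 0%N p j < a)%N = (j < a)%N &
    forall j, (j < size g)%N -> (nth 0%N p j < s)%N = (j < s)%N].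
Proof.
move=> as_; rewrite {}/p /labelling; set hs := individualize _ _ _ => /=.
have shs : size hs = size g.
  have size_color j h : size (color0 a s j h) = size h by elim: h j => //= v h IH j; rewrite IH.
  have size_bump cs i : size (bump cs i) = size cs.
    by elim: cs i => //= x cs IH [|i] //=; rewrite IH.
  have size_refine q cs : size cs = size g -> size (refine q g cs) = size g.
    by elim: q cs => //= q IH cs scs; apply: IH; rewrite size_map size_zip scs minnn.
  have size_ind q cs : size cs = size g -> size (individualize q g cs) = size g.
    elim: q cs => //= q IH cs scs; case: first_tie => // hi; apply: IH.
    by apply: (size_refine 1%N); rewrite size_bump.
  exact/size_ind/size_refine.
set keys := zip _ _; have kE : map snd keys = iota 0 (size g) by apply: unzip2_zip; rewrite shs size_iota.
have sortP ks : perm_eq (sort_keys ks) (map snd ks).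
  rewrite perm_map //; elim: ks => //= x ks IH.
  by rewrite (perm_trans (perm_insert_by _ _ _)) // perm_cons.
set P1 := sort_keys _; set P2 := sort_keys _; set P3 := sort_keys _.
have p1 : perm_eq P1 (take a (iota 0 (size g))) by rewrite -kE -map_take sortP.
have p2 : perm_eq P2 (take (s - a) (drop a (iota 0 (size g)))) by rewrite -kE -map_drop -map_take sortP.
have p3 : perm_eq P3 (drop s (iota 0 (size g))) by rewrite -kE -map_drop sortP.
have p12 : perm_eq (P1 ++ P2) (take s (iota 0 (size g))).
  by rewrite (perm_trans (perm_cat p1 p2)) // -{2}(subnKC as_) takeD.
have p23 : perm_eq (P2 ++ P3) (drop a (iota 0 (size g))).
  rewrite (perm_trans (perm_cat p2 p3)) // -{2}(subnK as_) -drop_drop cat_take_drop.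
  exact: perm_refl.
have block c P Q : perm_eq P (take c (iota 0 (size g))) -> perm_eq Q (drop c (iota 0 (size g))) ->
    forall j, (j < size g)%N -> (nth 0%N (P ++ Q) j < c)%N = (j < c)%N.
  move=> pP pQ j jg; have sP : size P = minn c (size g) by rewrite (perm_size pP) size_take_min size_iota.
  have sQ : size Q = (size g - c)%N by rewrite (perm_size pQ) size_drop size_iota.
  rewrite nth_cat; case: (ltnP j (size P)) => jP.
    have := mem_nth 0%N jP; rewrite (perm_mem pP) take_iota mem_iota.
    by move: (nth _ P j) => x; rewrite sP in jP; lia.
  have jQ : (j - size P < size Q)%N by rewrite sQ sP; lia.
  have := mem_nth 0%N jQ; rewrite (perm_mem pQ) drop_iota mem_iota.
  by move: (nth _ Q _) => x; rewrite sP in jP; lia.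
split.
- by rewrite catA (perm_trans (perm_cat p12 p3)) // cat_take_drop.
- exact: block p1 p23.
- by rewrite catA; apply: block p12 p3.
Qed.

Lemma eq_pgraphP g1 g2 : eq_pgraph g1 g2 -> g1 = g2.
Proof.
have eqs l1 l2 : eq_seqn l1 l2 -> l1 = l2.
  by elim: l1 l2 => [|x l1 IH] [|y l2] //= /andP[]; rewrite eqnE => /eqP-> /IH->.
elim: g1 g2 => [|[b1 l1] g1 IH] [|[b2 l2] g2] //= /andP[/andP[/Bool.eqb_prop-> /eqs->]] /IH->.
by [].
Qed.

Definition in_bst (st : state) t := st \in flat_bst t [::].

Lemma in_bst_node st h b t1 t2 :
  in_bst st (Node h b t1 t2) = [|| in_bst st t1, st \in b | in_bst st t2].
Proof.
have flat t acc : flat_bst t acc = flat_bst t [::] ++ acc.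
  elim: t acc => //= h' b' t1' IH1 t2' IH2 acc.
  by rewrite IH1 [flat_bst t2' acc]IH2 [in RHS]IH1 [flat_bst t2' [::]]IH2 cats0 -!catA.
by rewrite /in_bst /= flat !mem_cat.
Qed.

Lemma in_insert_bst h st t st' : in_bst st' (insert_bst h st t) -> st' = st \/ in_bst st' t.
Proof.
elim: t => [|h' b t1 IH1 t2 IH2] /=; first by rewrite in_bst_node /= inE orbF => /eqP; left.
case: N.compare; rewrite ?in_bst_node.
- case: ifP => _; rewrite !in_bst_node; first by right.
  by rewrite inE => /or3P[->|/orP[/eqP->|->]|->]; rewrite ?orbT; auto.
- by case/or3P => [/IH1[]|->|->]; rewrite ?orbT; auto => ->; auto.
- by case/or3P => [->|->|/IH2[]]; rewrite ?orbT; auto => ->; rewrite ?orbT; auto.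
Qed.

Lemma insert_bst_sub h st t st' : in_bst st' t -> in_bst st' (insert_bst h st t).
Proof.
elim: t => [|h' b t1 IH1 t2 IH2] //=; case: N.compare; rewrite ?in_bst_node.
- by case: ifP => _; rewrite !in_bst_node // inE => /or3P[->|->|->]; rewrite ?orbT.
- by case/or3P => [/IH1->|->|->]; rewrite ?orbT.
- by case/or3P => [->|->|/IH2->]; rewrite ?orbT.
Qed.

Lemma insert_bst_repr h st t : exists2 st', in_bst st' (insert_bst h st t) & st'.1 = st.1.
Proof.
elim: t => [|h' b t1 [st1 i1 E1] t2 [st2 i2 E2]] /=.
  by exists st; rewrite // in_bst_node mem_head orbT.
case: N.compare.
- case: ifP => [/hasP[st' st'b /eq_pgraphP E]|_]; [exists st' | exists st] => //.
    by rewrite in_bst_node st'b orbT.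
  by rewrite in_bst_node mem_head orbT.
- by exists st1; rewrite // in_bst_node i1.
- by exists st2; rewrite // in_bst_node i2 !orbT.
Qed.

Lemma dedupe_sub a s r l st' : st' \in dedupe a s r l ->
  exists2 st, st \in l & st' = relabel (labelling a s r st.1).2 st.
Proof.
rewrite /dedupe -/(in_bst _ _); elim: l => //= st l IH /in_insert_bst[->|/IH[st1 st1l ->]].
  by exists st; rewrite ?mem_head.
by exists st1; rewrite // inE st1l orbT.
Qed.

Lemma dedupe_repr a s r l st : st \in l ->
  exists2 st', st' \in dedupe a s r l & st'.1 = relabel_graph (labelling a s r st.1).2 st.1.
Proof.
rewrite /dedupe; set t := foldr _ _ _ => stl.
suff [st' i E] : exists2 st', in_bst st' t & st'.1 = relabel_graph (labelling a s r st.1).2 st.1.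
  by exists st'.
rewrite /t; elim: l stl {t} => //= st1 l IH; rewrite inE => /orP[/eqP<-|/IH[st' i E]].
  by have [st' i E] := insert_bst_repr (labelling a s r st.1).1
     (relabel (labelling a s r st.1).2 st) (foldr (fun st t => insert_bst (labelling a s r st.1).1
       (relabel (labelling a s r st.1).2 st) t) Leaf l); exists st'.
by exists st'; [apply: insert_bst_sub|].
Qed.

Lemma levels_sound n k a s fl l : (a <= s)%N -> (forall st, st \in l -> sound st) ->
  forall st, st \in levels n k a s fl l -> sound st.
Proof.
move=> as_; elim: fl l => //= r fl IH l ls; apply: IH.
have step st : st \in flatten (map (stepS n k s) l) -> sound st.
  by case/flattenP => _ /mapP[st0 /ls so ->]; apply: stepS_sound.
case: r => [|r] // st /dedupe_sub[[g fs] /step so ->].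
by have [pP _ _] := labelling_blocks r.+1 g as_; apply: relabel_sound.
Qed.

(** * From the cores to the whole search *)

Section Refuted.
Variables (V : finType) (e : rel V) (k : nat) (v0 : V) (S : {pred V}) (x0 : V -> rat).
Hypotheses (e_sym : symmetric e) (e_irr : irreflexive e)
  (e_reg : forall x, #|[pred y | e x y]| = k)
  (ker_full : forall z : V -> rat, (forall x, csum e z x = 0) ->
     (exists x, z x != 0) -> forall x, z x != 0)
  (x0_ker : forall x, csum e x0 x = 0) (x0_full : forall x, x0 x != 0)
  (S_parity : forall x, odd #|[pred y | (y \in S) && e x y]| = (x \in S)).

Notation n := #|V|.

(** Since relabelling preserves the blocks, the first [s] labels are still the vertices of [S]
    afterwards. *)
Lemma levels_reached a s fl l : (a <= s)%N -> (forall st, st \in l -> sound st) ->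
    (exists2 st, st \in l & reached e k v0 S s st) ->
  exists2 st, st \in levels n k a s fl l & reached e k v0 S s st.
Proof.
move=> as_; elim: fl l => //= r fl IH l ls [st stl rst]; apply: IH.
  by move=> st' st'l; apply: (@levels_sound n k a s [:: r] l as_ ls).
have [st1 st1l r1] := stepS_reached e_sym e_irr e_reg ker_full x0_ker x0_full S_parity rst.
have st1f : st1 \in flatten (map (stepS n k s) l) by apply/flattenP; exists (stepS n k s st); rewrite ?map_f.
case: r => [|r]; first by exists st1.
have [st2 st2d st2E] := dedupe_repr a s r.+1 st1f; exists st2 => //.
have s2 : sound st2 by apply: (@levels_sound n k a s [:: r.+1] l as_ ls).
have [so1 [l1 h1 phase]] := r1; have wl := so_lab so1.
have [pP _ pS] := labelling_blocks r.+1 st1.1 as_.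
set p := (labelling a s r.+1 st1.1).2 in pP pS st2E; split=> //.
have lr := h_rz h1; have sg := h_s h1.
have rr : realizes e predT (fun=> k) v0 [seq nth v0 l1 j | j <- p] (relabel_graph p st1.1).
  exact: relabel_realizes.
have psz : size p = size st1.1 by rewrite (perm_size pP) size_iota.
have vlE j : (j < size st1.1)%N -> nth v0 [seq nth v0 l1 j | j <- p] j = nth v0 l1 (nth 0%N p j).
  exact: relabel_vl.
have plt j : (j < size st1.1)%N -> (nth 0%N p j < size st1.1)%N.
  by move=> jg; have := mem_nth 0%N (s := p) (n := j); rewrite psz (perm_mem pP) mem_iota; apply.
have szE := size_relabel pP.
exists [seq nth v0 l1 j | j <- p]; rewrite st2E.
  split; rewrite ?szE //.
  - by move=> j jg; rewrite vlE // (h_core h1) ?plt // pS.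
  - by move=> v /(h_all h1); rewrite (relabel_mem pP lr).
  - move=> i j il jl; have ig := leq_trans il sg; have jg := leq_trans jl sg.
    by rewrite !vlE // mem_nbr_relabel // => /(h_adj h1); rewrite !pS //; apply.
case: phase => [fl'|og]; [left|right].
  move=> j jl; have jg := leq_trans jl sg; rewrite (full_relabel pP) // fl' //.
  by rewrite pS.
move=> j i /andP[sj]; rewrite szE => jg ij; have ig := relabel_lt pP wl jg ij.
move: ij; rewrite mem_nbr_relabel // => /og; rewrite plt // andbT leqNgt pS // -leqNgt sj.
by rewrite pS //; apply.
Qed.

Section Cores.
Variables (a b : nat).
Hypotheses (cardS : #|S| = (a + b)%N)
  (card1 : #|[pred x | (x \in S) && (deg_in e S x == 1%N)]| = a)
  (deg_S : forall x, x \in S -> (deg_in e S x == 1%N) || (deg_in e S x == 3%N)).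

Definition core_shape (g : pgraph) := size g = (a + b)%N /\ well_labelled g.
Definition core_hit (g : pgraph) :=
  exists2 l, realizes e S (core_deg a) v0 l g & {subset S <= l}.

Lemma stepC_shape (st st' : state) : core_shape st.1 -> st' \in stepC a b st -> core_shape st'.1.
Proof.
case=> gs wg; rewrite /stepC; case E: firstopen => [i|]; last by rewrite inE => /eqP->.
have /andP[ig _] := firstopenP E.
case/mapP => -[nn g'] /exts_withP[X [-> Xc]]; rewrite gs; case: nn => [_ ->|nn]; last by lia.
rewrite /= /core_shape size_extend addn0; split=> //; apply: extend_well_labelled => //.
by move=> j /Xc; rewrite mem_cand => /andP[].
Qed.

Lemma stepC_hit (st : state) : core_hit st.1 -> exists2 st', st' \in stepC a b st & core_hit st'.1.
Proof.
case=> l lg Sl; rewrite /stepC; case E: firstopen => [i|]; last first.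
  by exists st; [rewrite mem_head | exists l].
have /andP[ig fi] := firstopenP E.
have [//|||nw [X [lg' gin _ _]]] := @exts_hit V e S (core_deg a) v0 e_sym e_irr l st.1 i 0%N (a + b) lg ig.
- by move=> w wS; rewrite (Sl w wS).
- by rewrite cardS.
exists (extend st.1 i (size nw) X, [::]); first by apply/mapP; exists (size nw, extend st.1 i (size nw) X).
by exists (l ++ nw) => // w /Sl; rewrite mem_cat => ->.
Qed.

Lemma cores_shape m l : (forall st, st \in l -> core_shape st.1) ->
  forall st, st \in cores a b m l -> core_shape st.1.
Proof.
elim: m l => //= m IH l ls; apply: IH => st /dedupe_sub[st1 st1l ->].
have [gs wg] : core_shape st1.1.
  by case/flattenP: st1l => _ /mapP[st0 /ls sh ->]; apply: stepC_shape.
have [pP _ _] := labelling_blocks 3 st1.1 (leq_addr b a).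
by rewrite /core_shape relabel1 (size_relabel pP); split=> //; apply: relabel_well_labelled.
Qed.

Lemma cores_hit m l : (exists2 st, st \in l & core_hit st.1) ->
  exists2 st, st \in cores a b m l & core_hit st.1.
Proof.
elim: m l => //= m IH l [st stl hst]; apply: IH.
have [st1 st1l [l1 lg1 Sl1]] := stepC_hit hst.
have st1f : st1 \in flatten (map (stepC a b) l) by apply/flattenP; exists (stepC a b st); rewrite ?map_f.
have [st2 st2d st2E] := dedupe_repr a (a + b) 3 st1f; exists st2 => //.
have [pP pa _] := labelling_blocks 3 st1.1 (leq_addr b a).
set p := (labelling a (a + b) 3 st1.1).2 in pP pa st2E.
exists [seq nth v0 l1 j | j <- p]; rewrite ?st2E.
  by apply: relabel_realizes => // j jg; rewrite /core_deg !ltbE pa.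
by move=> w /Sl1; rewrite (relabel_mem pP lg1).
Qed.

Lemma core0_hit : core_hit (core0 a b).1.
Proof.
pose l1 := enum [pred x | (x \in S) && (deg_in e S x == 1%N)].
pose l3 := enum [pred x | (x \in S) && (deg_in e S x != 1%N)].
have s1 : size l1 = a by rewrite -cardE.
have s3 : size l3 = b.
  rewrite -cardE; apply: (@addnI a); rewrite -cardS -[in LHS]card1.
  rewrite -[RHS](cardID [pred x | deg_in e S x == 1%N]); congr (_ + _); apply: eq_card => x; rewrite !inE //.
  by rewrite andbC.
have vn i : vx (core0 a b).1 i = if (i < a + b)%N then (false, [::]) else (true, [::]).
  by rewrite /vx nth_nseq.
have nb i : nbr (core0 a b).1 i = [::] by rewrite /nbr vn; case: ifP.
exists (l1 ++ l3); last first.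
  by move=> w wS; rewrite mem_cat !mem_enum !inE wS /= orbN.
split; rewrite ?size_nseq.
- rewrite cat_uniq !enum_uniq andbT; apply/hasP => -[w]; rewrite !mem_enum !inE.
  by move=> /andP[_ /negPf->]; rewrite andbF.
- by rewrite size_cat s1 s3.
- by move=> w; rewrite mem_cat !mem_enum !inE => /orP[] /andP[].
- by move=> i j _; rewrite nb.
- by move=> i j _; rewrite nb.
- by move=> i _; rewrite nb.
- by move=> i j _; rewrite nb.
- by move=> i il; rewrite /full vn il.
move=> i il; rewrite /core_deg ltbE nth_cat s1; case: ltnP => ia.
  have : nth v0 l1 i \in l1 by rewrite mem_nth ?s1.
  by rewrite mem_enum inE => /andP[_ /eqP].
have : nth v0 l3 (i - a) \in l3 by rewrite mem_nth ?s3 // ltn_subLR.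
by rewrite mem_enum inE => /andP[wS w1]; have := deg_S wS; rewrite (negPf w1) => /eqP.
Qed.

Lemma init_sound st : core_shape st.1 -> sound (init_state a b st).
Proof.
case=> gs wg; have sz : size (map (fun v : pvertex => (false, v.2)) st.1) = (a + b)%N by rewrite size_map.
have vxE i : (i < a + b)%N -> vx (map (fun v : pvertex => (false, v.2)) st.1) i = (false, nbr st.1 i).
  by move=> il; rewrite /vx (nth_map (true, [::])) ?gs.
split=> /=; rewrite ?sz.
- by rewrite size_map size_iota.
- apply: (@uniformP _ (a + b)); apply/allP => _ /mapP[i _ ->].
  by rewrite size_cat size_map size_iota.
- move=> i j; rewrite sz => il; rewrite /nbr vxE //= -gs; apply: wg.
  by rewrite gs.
move=> y _; exists y => i il; rewrite (nth_map 0%N) ?size_iota // nth_iota //.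
by rewrite dot_unitf.
Qed.

(** A complete core knows all edges inside [S]; this is what provides [h_adj] although the labels
    are reopened. *)
Lemma init_reached st : core_shape st.1 -> all (fun v : pvertex => v.1) st.1 -> core_hit st.1 ->
  reached e k v0 S (a + b) (init_state a b st).
Proof.
move=> sh af [l lg Sl]; split; first exact: init_sound.
have [gs wg] := sh.
have vxE i : (i < a + b)%N -> vx (init_state a b st).1 i = (false, nbr st.1 i).
  by move=> il; rewrite /vx (nth_map (true, [::])) ?gs.
have sz : size (init_state a b st).1 = (a + b)%N by rewrite size_map.
have nbE i : (i < a + b)%N -> nbr (init_state a b st).1 i = nbr st.1 i by move=> il; rewrite /nbr vxE.
exists l; last first.
  by right=> j i; rewrite sz => /andP[]; lia.
have fg i : (i < a + b)%N -> full st.1 i by move=> il; apply: (allP af); rewrite mem_nth ?gs.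
split=> //; rewrite ?sz //.
- split; rewrite ?sz -?gs; try solve [by case: lg].
  + by move=> i j il; rewrite nbE -?gs //; apply: (rz_lt lg il).
  + by move=> i j il; rewrite nbE -?gs //; apply: (rz_adj lg il).
  + by move=> i il; rewrite nbE -?gs //; apply: (rz_nuniq lg il).
  + move=> i j il; rewrite nbE -?gs // => ij.
    by rewrite nbE -?gs ?(rz_lt lg il ij) //; apply: (rz_sym lg il ij).
  + by move=> i; rewrite gs => il; rewrite /full vxE.
  + by move=> i ig; rewrite /deg_in -(e_reg (nth v0 l i)); apply: eq_card => y; rewrite !inE.
- by move=> i il; rewrite il; apply: (rz_dom lg); rewrite mem_nth // (rz_size lg) gs.
- move=> i j il jl ij; rewrite nbE //.
  by apply: (adj_label lg _ _ _ ij); rewrite ?gs //; apply: (rz_full lg); rewrite ?gs // fg.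
Qed.

Theorem refutedP w fl : refuted a b n k w fl -> False.
Proof.
rewrite /refuted => /andP[/allP cf /allP lv].
have sh st : st \in all_cores a b -> core_shape st.1.
  apply: cores_shape => st0; rewrite inE => /eqP->; rewrite /core_shape size_nseq; split=> // i j ig.
  by rewrite /nbr /vx nth_nseq; case: ifP.
have [st stc hst] : exists2 st, st \in all_cores a b & core_hit st.1.
  by apply: cores_hit; exists (core0 a b); rewrite ?mem_head //; apply: core0_hit.
have isound st0 : st0 \in map (init_state a b) (all_cores a b) -> sound st0.
  by case/mapP => st1 /sh s1 ->; apply: init_sound.
have [|st' st'l [so [l lst phase]]] := @levels_reached a (a + b) fl _ (leq_addr b a) isound.
  by exists (init_state a b st); [apply: map_f | apply: init_reached (sh _ stc) (cf _ stc) hst].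
have /andP[fS] := lv _ st'l.
apply: (deadP e_sym e_irr e_reg ker_full x0_ker x0_full so lst) => j js.
have := allP fS (vx st'.1 j); rewrite /full; apply.
rewrite /vx -(nth_take _ js) mem_nth // size_take_min leq_min js.
exact: leq_trans js (h_s lst).
Qed.
End Cores.
End Refuted.

(** * The odd part of a primitive kernel vector *)

(** Denominators are cleared by [D] and the result is divided by its gcd [g]; a common divisor [p]
    of the quotients would make [p * g] divide [g]. *)
Lemma primitive_int (T : finType) (v : T -> rat) (x1 : T) : v x1 != 0 ->
  exists c (w : T -> int), [/\ c != 0, forall x, v x = c * (w x)%:~R &
    forall p, (1 < p)%N -> exists x, ~~ (p %| `|w x|)%N].
Proof.
move=> v1; pose D : int := \prod_x denq (v x).
have D0 : D != 0 by apply/prodf_neq0 => x _; apply: denq_neq0.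
pose u x : int := numq (v x) * \prod_(y | y != x) denq (v y).
have uE x : (u x)%:~R = v x * D%:~R.
  rewrite /D (bigD1 x) //= /u !intrM mulrA; congr (_ * _).
  by rewrite -[LHS](@divfK _ (denq (v x))%:~R) ?intr_eq0 ?denq_neq0 // divq_num_den.
pose g : nat := \big[gcdn/0%N]_x `|u x|%N.
have gu x : (g %| `|u x|)%N by apply: biggcdn_inf (dvdnn _).
have u1 : u x1 != 0 by rewrite -(intr_eq0 rat) uE mulf_neq0 ?intr_eq0.
have g0 : (0 < g)%N by rewrite (dvdn_gt0 _ (gu x1)) // absz_gt0.
have wE x : u x = (u x %/ g%:Z)%Z * g%:Z by rewrite divzK // dvdzE.
exists (g%:R / D%:~R), (fun x => (u x %/ g%:Z)%Z); split.
- by rewrite mulf_neq0 ?invr_eq0 ?intr_eq0 ?pnatr_eq0 -?lt0n.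
- move=> x; have E := uE x; rewrite {1}wE intrM -pmulrn in E.
  by rewrite -[LHS](@mulfK _ D%:~R) ?intr_eq0 // -E -mulrA mulrC.
move=> p p1; apply/existsP; apply: contraT; rewrite negb_exists => /forallP dv.
have : (p * g %| g)%N.
  apply/dvdn_biggcdP => x _; rewrite wE abszM dvdn_mul //.
  by have := dv x; rewrite negbK.
by move/(dvdn_leq g0); rewrite -{2}[g]mul1n leq_pmul2r // leqNgt p1.
Qed.

(** The two orientations of an edge contribute the same amount. *)
Lemma sym_sum_even (T : finType) (e : rel T) (f : T -> T -> int) :
  symmetric e -> irreflexive e -> (forall x y, f x y = f y x) ->
  exists m, \sum_x \sum_(y | e x y) f x y = 2 * m.
Proof.
move=> e_sym e_irr f_sym.
pose lt (x y : T) := (enum_rank x < enum_rank y)%N.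
exists (\sum_x \sum_(y | e x y && lt x y) f x y).
have -> : \sum_x \sum_(y | e x y) f x y = \sum_x \sum_(y | e x y && lt x y) f x y +
    \sum_x \sum_(y | e x y && lt y x) f x y.
  rewrite -big_split; apply: eq_bigr => x _; rewrite (bigID (lt x)) /=; congr (_ + _).
  apply: eq_bigl => y; case: (boolP (e x y)) => //= xy; rewrite /lt.
  case: ltngtP => // /ord_inj/enum_rank_inj E; by rewrite E e_irr in xy.
have -> : \sum_x \sum_(y | e x y && lt y x) f x y = \sum_x \sum_(y | e x y && lt x y) f x y.
  rewrite (exchange_big_dep xpredT) //=; apply: eq_bigr => x _; apply: eq_big => [y|y _].
    by rewrite e_sym.
  by rewrite f_sym.
by ring.
Qed.

Lemma handshake (T : finType) (e : rel T) d : symmetric e -> irreflexive e ->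
  (forall x, #|[pred y | e x y]| = d) -> ~~ odd (#|T| * d).
Proof.
move=> e_sym e_irr e_reg.
have [m] := sym_sum_even e_sym e_irr (f := fun _ _ => 1) (fun _ _ => erefl).
rewrite (eq_bigr (fun=> d%:Z)) => [|x _]; last by rewrite sumr_const -(e_reg x) natz.
rewrite sumr_const -[d%:Z]natz -mulrnA natz => E.
by rewrite mulnC; move: E; move: (_ * _)%N => N; lia.
Qed.

(** [m] is the number of edges between [S] and its complement, whose [t] vertices have even degree
    into [S], hence at most [k - odd k]. The gap of 6 comes from [outer_even_deficit], the case
    [m = 0] from [outer_connected]. *)
Definition admissible (n k a b : nat) : bool :=
  let t := (n - (a + b))%N in
  let m := ((k - 1) * a + (k - 3) * b)%N in
  [&& ~~ odd a, 4 %| b, 0 < a + b, a + b <= n, (a == 0) || (1 <= k), (b == 0) || (3 <= k),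
      m <= (k - odd k) * t, [|| odd k, m == k * t | m + 6 <= k * t] &
      (m == 0) ==> (t == 0)]%N.

Section OddPart.
Variables (V : finType) (e : rel V) (k : nat) (w : V -> int).
Hypotheses (e_sym : symmetric e) (e_irr : irreflexive e)
  (e_reg : forall x, #|[pred y | e x y]| = k)
  (w_ker : forall x, w x + \sum_(y | e x y) w y = 0) (w_sum : \sum_x w x = 0).

Definition odd_part : {pred V} := [pred x | odd `|w x|].
Notation S := odd_part.
Notation deg := (deg_in e S).

Let s x : int := ((x \in S) : nat)%:Z.
Let h x : int := (w x %/ 2)%Z.

Let natz_sum (P : pred V) (F : V -> nat) :
  ((\sum_(x | P x) F x)%N)%:Z = \sum_(x | P x) (F x)%:Z.
Proof. exact: (big_morph Posz PoszD erefl). Qed.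

Let wE x : w x = s x + 2 * h x.
Proof. by rewrite /s /h inE; have := divz_eq (w x) 2; lia. Qed.

Let degE x : \sum_(y | e x y) s y = (deg x)%:Z.
Proof.
rewrite -[RHS]natz /deg_in -sum1_card natr_sum; rewrite big_mkcond [RHS]big_mkcond.
by apply: eq_bigr => y _; rewrite /s [in RHS]inE andbC; case: e => //; case: (y \in S).
Qed.

Lemma closed_halves x : s x + (deg x)%:Z = - 2 * (h x + \sum_(y | e x y) h y).
Proof.
have := w_ker x; under eq_bigr => y _ do rewrite wE.
by rewrite big_split /= -mulr_sumr degE wE => E; apply/eqP; rewrite -subr_eq0 -[X in _ == X]E; apply/eqP; ring.
Qed.

Lemma odd_parity x : odd (deg x) = (x \in S).
Proof. by have := closed_halves x; rewrite /s; case: (x \in S); lia. Qed.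

Let swap (f f' : V -> int) : \sum_x f x * (\sum_(y | e x y) f' y) = \sum_x f' x * (\sum_(y | e x y) f y).
Proof.
under eq_bigr => x _ do rewrite mulr_sumr; under [RHS]eq_bigr => x _ do rewrite mulr_sumr.
rewrite (exchange_big_dep xpredT) //=; apply: eq_bigr => x _.
by apply: eq_big => [y|y _]; [rewrite e_sym | rewrite mulrC].
Qed.

(* With [w = s + 2h] and [B = A + I], [Bw = 0] gives [s.Bs = 4 h.Bh], and [h.Bh] has the parity
   of the sum of [h], which is [-|S|/2]. *)
Lemma odd_part_mod8 : exists m, \sum_(x in S) (3 + deg x)%:Z = 8 * m.
Proof.
have [m mE] := sym_sum_even e_sym e_irr (f := fun x y => h x * h y) (fun x y => mulrC _ _).
have [q qE] : exists q, \sum_x h x * h x = \sum_x h x + 2 * q.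
  exists (\sum_x (h x * (h x - 1) %/ 2)%Z); rewrite mulr_sumr -big_split; apply: eq_bigr => x _ /=.
  move: (h x) => z; have : (2 %| z * (z - 1))%Z by rewrite dvdzE abszM dvdn2 oddM; lia.
  by move/divzK; rewrite mulrBr mulr1; lia.
have hh : \sum_x h x * (h x + \sum_(y | e x y) h y) = \sum_x h x + 2 * (q + m).
  under eq_bigr => x _ do rewrite mulrDr mulr_sumr.
  by rewrite big_split /= qE mE; ring.
have ss : \sum_x s x * (s x + (deg x)%:Z) = 4 * (\sum_x h x + 2 * (q + m)).
  under eq_bigr => x _ do rewrite closed_halves mulrCA mulrDr.
  rewrite -mulr_sumr big_split /= swap -[4]/(- 2 * - 2 : int) -mulrA -hh; congr (_ * _).
  rewrite -big_split mulr_sumr; apply: eq_bigr => x _ /=.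
  by rewrite degE [s x * _]mulrC -mulrDr closed_halves; ring.
have sw : \sum_x s x + 2 * \sum_x h x = 0.
  by rewrite -[RHS]w_sum mulr_sumr -big_split; apply: eq_bigr => x _; rewrite wE.
(* As [w] sums to zero, [2|S|] equals [-4] times the sum of [h] and cancels the term not divisible
   by 8. This is why 3, that is 1 + 2, is added to the degrees. *)
exists (q + m); rewrite big_mkcond.
have -> : \sum_x (if x \in S then (3 + deg x)%:Z else 0) =
    \sum_x s x * (s x + (deg x)%:Z) + 2 * \sum_x s x.
  rewrite mulr_sumr -big_split; apply: eq_bigr => x _; rewrite /s /=.
  by case: (x \in S) => /=; lia.
by rewrite ss; lia.
Qed.

Lemma deg_le x : (deg x <= k)%N.
Proof.
by rewrite -(e_reg x); apply/subset_leq_card/fintype.subsetP => y; rewrite !inE => /andP[].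
Qed.

Hypothesis k4 : (k <= 4)%N.

Definition count1 := #|[pred x | (x \in S) && (deg x == 1%N)]|.
Definition count3 := #|[pred x | (x \in S) && (deg x == 3%N)]|.

Lemma odd_deg x : x \in S -> (deg x == 1%N) || (deg x == 3%N).
Proof. by have := odd_parity x; have := deg_le x; case: (x \in S) => //; lia. Qed.

Lemma sum_odd_part (f : nat -> nat) :
  (\sum_(x in S) f (deg x) = count1 * f 1%N + count3 * f 3%N)%N.
Proof.
rewrite (bigID (fun x => deg x == 1%N)) /=; congr (_ + _)%N.
  rewrite (eq_bigr (fun=> f 1%N)) => [|x /andP[_ /eqP->]] //.
  by rewrite sum_nat_const; congr (_ * _)%N; apply: eq_card => x; rewrite !inE.
rewrite (eq_bigl (fun x => (x \in S) && (deg x == 3%N))) => [|x]; last first.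
  by case: (boolP (x \in S)) => //= /odd_deg; case: eqP => [->|].
rewrite (eq_bigr (fun=> f 3%N)) => [|x /andP[_ /eqP->]] //.
by rewrite sum_nat_const; congr (_ * _)%N; apply: eq_card => x; rewrite !inE.
Qed.

Lemma card_odd_part : #|S| = (count1 + count3)%N.
Proof. by rewrite -sum1_card (sum_odd_part (fun=> 1%N)) !muln1. Qed.

(** The sum divisible by 8 is [4a + 6b], and counting edges inside [S] makes [a + 3b] even. So [b]
    is even, then [a] is, then 4 divides [b]. *)
Lemma counts_mod : ~~ odd count1 && (4 %| count3)%N.
Proof.
have [m mE] := odd_part_mod8.
have E1 : (\sum_(x in S) (3 + deg x) = count1 * 4 + count3 * 6)%N by apply: (sum_odd_part (addn 3)).
have [q] := sym_sum_even e_sym e_irr (f := fun x y => s x * s y) (fun x y => mulrC _ _).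
under eq_bigr => x _ do rewrite -mulr_sumr degE.
have -> : \sum_x s x * (deg x)%:Z = (\sum_(x in S) deg x)%N%:Z.
  rewrite [RHS]natz_sum /= [RHS]big_mkcond; apply: eq_bigr => x _; rewrite /s.
  by case: (x \in S); rewrite ?mul1r ?mul0r.
rewrite (sum_odd_part id) => qE; move: mE; rewrite -natz_sum E1.
by move: count1 count3 qE => a b; lia.
Qed.

(** Each vertex of [S] has [k] edges, of which 1 or 3 stay inside [S]; the others are counted from
    their ends outside. *)
Lemma outer_sum : (\sum_(x | x \notin S) deg x + count1 + 3 * count3 = k * (count1 + count3))%N.
Proof.
have : (\sum_x deg x = k * #|S|)%N.
  rewrite (eq_bigr (fun x => \sum_(y | (y \in S) && e x y) 1%N)) => [|x _]; last first.
    by rewrite sum1_card.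
  rewrite (exchange_big_dep (mem S)) /=; last by move=> x y _ /andP[].
  rewrite mulnC -sum_nat_const; apply: eq_bigr => y yS; rewrite sum1_card -(e_reg y).
  by apply: eq_card => x; move: yS; rewrite !inE => ->; rewrite e_sym.
rewrite (bigID (mem S)) /= (sum_odd_part id) card_odd_part => <-.
by rewrite muln1 [RHS]addnC -addnA mulnC addnC; congr (_ + _)%N; rewrite mulnC.
Qed.

Lemma card_outer : #|[pred x | x \notin S]| = (#|V| - (count1 + count3))%N.
Proof. by rewrite -card_odd_part -(cardC S) addKn; apply: eq_card. Qed.

Lemma outer_deg x : x \notin S -> (deg x <= k - odd k)%N.
Proof. by have := odd_parity x; have := deg_le x; case: (x \in S) => //; lia. Qed.

(** By parity, a vertex outside [S] with fewer than [k] neighbours in [S] lacks at least two, so it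
    has two neighbours outside [S]; these lack at least two each as well. *)
Lemma outer_even_deficit : ~~ odd k -> (\sum_(x | x \notin S) deg x < k * #|[pred x | x \notin S]|)%N ->
  (\sum_(x | x \notin S) deg x + 6 <= k * #|[pred x | x \notin S]|)%N.
Proof.
move=> ek; rewrite mulnC -sum_nat_const => lt.
have gap x : x \notin S -> (deg x < k)%N -> (deg x + 2 <= k)%N.
  by move=> xS; have := odd_parity x; rewrite (negPf xS); lia.
pose d x := (k - deg x)%N.
have sumE : (\sum_(x | x \notin S) deg x + \sum_(x | x \notin S) d x = \sum_(x | x \notin S) k)%N.
  by rewrite -big_split; apply: eq_bigr => x _ /=; rewrite /d subnKC ?deg_le.
have [x xS dx] : exists2 x, x \notin S & (deg x < k)%N.
  apply/exists_inP; apply: contraLR lt; rewrite negb_exists_in -leqNgt => /forall_inP le.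
  by apply: leq_sum => x xS; have := le x xS; rewrite -leqNgt.
pose N := [pred y | (y \notin S) && e x y].
have cN : (#|N| + deg x = k)%N.
  rewrite /deg_in -(e_reg x) -(cardID (mem S) [pred y | e x y]) addnC; congr (_ + _)%N.
  by apply: eq_card => y; rewrite !inE andbC.
have N2 : (1 < #|N|)%N by have := gap x xS dx; lia.
have degN y : y \in N -> (y \notin S) && (deg y < k)%N.
  rewrite inE => /andP[yS xy]; rewrite yS /= -(e_reg y); apply: proper_card; apply/properP; split.
    by apply/fintype.subsetP => z; rewrite !inE => /andP[].
  by exists x; rewrite inE ?xS // 1?e_sym //; move: xS; rewrite inE => /negPf->.
have /card_gt1P[y [y' [yN y'N yy']]] := N2.
have [/andP[yS dy] /andP[y'S dy']] := (degN y yN, degN y' y'N).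
have nx z : z \in N -> z != x by rewrite inE => /andP[_]; apply: contraTneq => ->; rewrite e_irr.
have : (6 <= \sum_(x | x \notin S) d x)%N.
  rewrite (bigD1 x) //= (bigD1 y) /=; last by rewrite yS nx.
  rewrite (bigD1 y') /=; last by rewrite y'S nx // eq_sym.
  by have := gap x xS dx; have := gap y yS dy; have := gap y' y'S dy'; rewrite /d; lia.
by rewrite -sumE; lia.
Qed.

Hypotheses (ker_full : forall z : V -> rat, (forall x, csum e z x = 0) ->
     (exists x, z x != 0) -> forall x, z x != 0)
  (S_neq0 : exists x, x \in S).

(** Without edges between [S] and the rest, the restriction of [w] to [S] is a nonzero kernel vector
    that vanishes outside [S]. *)
Lemma outer_connected : (\sum_(x | x \notin S) deg x = 0)%N -> #|[pred x | x \notin S]| = 0%N.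
Proof.
move=> sum0; apply: eq_card0 => x1; apply/negP; rewrite inE => /negP x1S.
have deg0 x : x \notin S -> deg x = 0%N.
  by move=> xS; apply/eqP; move/eqP: sum0; rewrite sum_nat_eq0 => /forallP/(_ x)/implyP; apply.
have sep x y : x \notin S -> e x y -> y \notin S.
  move=> /deg0 d0 xy; apply: contra_eqN d0 => yS; rewrite -lt0n.
  by apply/card_gt0P; exists y; apply/andP.
pose z x : rat := if x \in S then (w x)%:~R else 0.
have zker x : csum e z x = 0.
  rewrite /csum /z; case: (boolP (x \in S)) => xS; last first.
    by rewrite big1 ?addr0 // => y /(sep _ _ xS)/negPf->.
  rewrite (eq_bigr (fun y => (w y)%:~R)) => [|y xy].
    by rewrite -rmorph_sum -rmorphD /= w_ker.
  case: (boolP (y \in S)) => // yS; have := sep y x yS; rewrite e_sym xS => /(_ xy).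
  by [].
suff znz : exists x, z x != 0 by have := ker_full zker znz x1; rewrite /z (negPf x1S) eqxx.
case: S_neq0 => x xS; exists x; rewrite /z xS intr_eq0; apply: contraL xS.
by move=> /eqP w0; rewrite inE w0.
Qed.

Lemma counts_admissible : admissible #|V| k count1 count3.
Proof.
rewrite /admissible; have /andP[-> ->] /= := counts_mod.
have tE := card_outer; have sumE := outer_sum.
have c_gt0 : (0 < count1 + count3)%N.
  by rewrite -card_odd_part; case: S_neq0 => x xS; apply/card_gt0P; exists x.
have cV : (count1 + count3 <= #|V|)%N by rewrite -card_odd_part max_card.
have le1 : (count1 == 0%N) || (1 <= k)%N.
  rewrite -implyNb; apply/implyP; rewrite -lt0n => /card_gt0P[x]; rewrite inE => /andP[_ /eqP dx].
  by rewrite -dx deg_le.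
have le3 : (count3 == 0%N) || (3 <= k)%N.
  rewrite -implyNb; apply/implyP; rewrite -lt0n => /card_gt0P[x]; rewrite inE => /andP[_ /eqP dx].
  by rewrite -dx deg_le.
rewrite c_gt0 cV le1 le3 -tE /=.
have -> : ((k - 1) * count1 + (k - 3) * count3 = \sum_(x | x \notin S) deg x)%N.
  apply: (@addIn (count1 + 3 * count3)); rewrite [RHS]addnA sumE.
  have k1 : (count1 == 0)%N || (k == (k - 1) + 1)%N by case/orP: le1 => [->//|]; lia.
  have k3 : (count3 == 0)%N || (k == (k - 3) + 3)%N by case/orP: le3 => [->//|]; lia.
  rewrite mulnDr addnACA; congr (_ + _)%N.
    by case/orP: k1 => /eqP E; [rewrite E !muln0 | rewrite [in RHS]E mulnDl mul1n].
  by case/orP: k3 => /eqP E; [rewrite E !muln0 | rewrite [in RHS]E mulnDl].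
have upper c : (forall x, x \notin S -> deg x <= c)%N ->
    (\sum_(x | x \notin S) deg x <= c * #|[pred x | x \notin S]|)%N.
  by move=> le; rewrite mulnC -sum_nat_const; apply: leq_sum.
rewrite (upper _ outer_deg) /=; apply/andP; split.
  rewrite -implyNb; apply/implyP => ek; have := upper k (fun x _ => deg_le x).
  by rewrite leq_eqVlt => /orP[->//|/(outer_even_deficit ek)->]; rewrite orbT.
by apply/implyP => /eqP/outer_connected->.
Qed.
End OddPart.

(** * Excluding orders by search *)

Definition co_adj (G : sgraph) : rel G := fun x y => (x != y) && ~~ adj x y.

Lemma co_adj_sym (G : sgraph) : symmetric (@co_adj G).
Proof. by move=> x y; rewrite /co_adj eq_sym adj_sym. Qed.

Lemma co_adj_irr (G : sgraph) : irreflexive (@co_adj G).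
Proof. by move=> x; rewrite /co_adj eqxx. Qed.

Lemma regular_lt d (G : sgraph) (x : G) : regular d G ->
  (#|[pred y | co_adj x y]| + d.+1 = #|G|)%N.
Proof.
move=> dG; rewrite -(cardC [pred y | co_adj x y]); congr (_ + _)%N.
have -> : #|[predC [pred y | co_adj x y]]| = #|[predU1 x & [pred y | adj x y]]|.
  by apply: eq_card => y; rewrite !inE negb_and !negbK eq_sym.
by rewrite cardU1 inE adj_irr (dG x).
Qed.

Lemma csum_co_adj (F : fieldType) (G : sgraph) (z : G -> F) x :
  csum (@co_adj G) z x = \sum_y z y - nbr_sum z x.
Proof.
apply/eqP; rewrite eq_sym subr_eq /csum /nbr_sum (bigD1 x) //= -addrA; apply/eqP; congr (_ + _).
rewrite (bigID (adj x)) /= addrC; congr (_ + _); apply: eq_bigl => y.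
  by rewrite /co_adj eq_sym.
by rewrite andbC; case: (boolP (adj x y)) => //=; apply: contraTneq => ->; rewrite adj_irr.
Qed.

Lemma sum_nbr_sum (F : fieldType) d (G : sgraph) (z : G -> F) : regular d G ->
  \sum_x nbr_sum z x = (\sum_x z x) *+ d.
Proof.
move=> dG; rewrite /nbr_sum (exchange_big_dep xpredT) //= -sumrMnl; apply: eq_bigr => y _.
by rewrite sumr_const -(dG y); congr (_ *+ _); apply: eq_card => x; rewrite !inE adj_sym.
Qed.

(** An entry lists [a], [b] and then [w], [fl], the arguments of [refuted]. *)
Definition plan := seq (nat * nat * (nat * seq nat)).

Definition plan_covers (n k : nat) (pl : plan) : bool :=
  all (fun a => all (fun b => admissible n k a b ==> ((a, b) \in map fst pl)) (iota 0 n.+1))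
    (iota 0 n.+1).

Definition plan_ok (n k : nat) (pl : plan) : bool :=
  all (fun p => refuted p.1.1 p.1.2 n k p.2.1 p.2.2) pl.

Lemma search_no_nut d n k pl (G : sgraph) : (0 < d)%N -> n = (k + d.+1)%N -> (k <= 4)%N ->
  plan_covers n k pl -> plan_ok n k pl -> #|G| = n -> regular d G -> rat_nut G -> False.
Proof.
move=> d0 nE k4 cov ok Gn dG [G1 [v [v0 vker vuniq]]].
have e_reg (x : G) : #|[pred y | co_adj x y]| = k.
  by apply: (@addIn d.+1); rewrite (regular_lt x dG) Gn.
have dF (z : G -> rat) : (\sum_x z x) *+ d = 0 -> \sum_x z x = 0.
  by move/eqP; rewrite mulrn_eq0 eqn0Ngt d0 /= => /eqP.
have sumv : \sum_x v x = 0 by apply: dF; rewrite -(sum_nbr_sum _ dG) big1.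
have v_ker x : csum (@co_adj G) v x = 0 by rewrite csum_co_adj sumv vker subr0.
have ker_full (z : G -> rat) : (forall x, csum (@co_adj G) z x = 0) ->
    (exists x, z x != 0) -> forall x, z x != 0.
  move=> zker [y zy] x.
  have zsum : \sum_x z x = 0.
    have : \sum_x csum (@co_adj G) z x = 0 by rewrite big1.
    under eq_bigr => t _ do rewrite csum_co_adj.
    (* The columns of [B] sum to [n - d], which is positive, so a kernel vector of [B] sums to
       zero. *)
    rewrite sumrB sumr_const (sum_nbr_sum _ dG) -mulrnBr; last by rewrite -(regular_lt y dG); lia.
    move/eqP; rewrite mulrn_eq0 => /orP[|/eqP//].
    by rewrite subn_eq0 -(regular_lt y dG) leqNgt ltn_addl.
  have [|c cE] := vuniq z.
    by move=> t; have /eqP := zker t; rewrite csum_co_adj zsum sub0r oppr_eq0 => /eqP.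
  move: zy; rewrite !cE !mulf_eq0 !negb_or => /andP[-> _]; exact: v0.
have /card_gt0P[x1 _] : (0 < #|G|)%N by rewrite ltnW.
have [c [w [c0 wE w2]]] := primitive_int (v0 x1).
have wz (z : int) : c * z%:~R = 0 -> z = 0.
  by move/eqP; rewrite mulf_eq0 (negPf c0) intr_eq0 => /eqP.
have w_ker x : w x + \sum_(y | co_adj x y) w y = 0.
  apply: wz; rewrite -[RHS](v_ker x) intrD rmorph_sum mulrDr mulr_sumr /csum wE.
  by congr (_ + _); apply: eq_bigr => y _; rewrite wE.
have w_sum : \sum_x w x = 0.
  apply: wz; rewrite -[RHS]sumv rmorph_sum mulr_sumr.
  by apply: eq_bigr => y _; rewrite wE.
have S_neq0 : exists x, x \in odd_part w.
  by have [x] := w2 2%N isT; rewrite dvdn2 negbK => xo; exists x; rewrite inE.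
have esym := @co_adj_sym G; have eirr := @co_adj_irr G.
have adm := counts_admissible esym eirr e_reg w_ker w_sum k4 ker_full S_neq0.
move: (adm); rewrite Gn => /and5P[_ _ _ le _].
have /mapP[p ppl pE] : (count1 (@co_adj G) w, count3 (@co_adj G) w) \in map fst pl.
  have /allP cov1 := cov; rewrite Gn in adm.
  have /cov1/allP/(_ (count3 (@co_adj G) w)) : count1 (@co_adj G) w \in iota 0 n.+1.
    by rewrite mem_iota /= ltnS (leq_trans (leq_addr _ _) le).
  rewrite adm mem_iota /= ltnS (leq_trans (leq_addl _ _) le); exact.
have := allP ok _ ppl; rewrite -pE /= -Gn.
apply: (refutedP x1 esym eirr e_reg ker_full v_ker v0).
- exact: (odd_parity w_ker).
- exact: (card_odd_part e_reg w_ker w_sum k4).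
- by [].
- exact: (odd_deg e_reg w_ker w_sum k4).
Qed.

Local Close Scope ring_scope.

(** * Base graphs *)

Fixpoint pos_bits (p : positive) : seq bool :=
  match p with xH => [:: true] | xO q => false :: pos_bits q | xI q => true :: pos_bits q end.
Definition N_bits (c : N) : seq bool := if c is Npos p then pos_bits p else [::].
Fixpoint triangle (m i : nat) (bits : seq bool) : seq (seq bool) :=
  if m is m'.+1 then take i bits :: triangle m' i.+1 (drop i bits) else [::].
Definition code_adj (tr : seq (seq bool)) (i j : nat) : bool :=
  (i != j) && nth false (nth [::] tr (maxn i j)) (minn i j).
Definition code_row n tr i : seq nat := filter (code_adj tr i) (iota 0 n).

Fixpoint digits64 (m : nat) (c : N) : seq Z :=
  if m is m'.+1 then
    let qr := N.div_eucl c 64%num in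
    Z.sub (Z.of_N qr.2) (Z.of_N 32%num) :: digits64 m' qr.1
  else [::].

Definition red13 (z : Z) : Z := Z.modulo z (Zpos 13%positive).

(** A row lists an open neighbourhood; giving its head the place of the centre makes [rowsum] the
    plain sum over the row. Dependent rows leave the forms unchanged. *)
Fixpoint solve13 (rows : seq (seq nat)) (fs : seq (seq Z)) : seq (seq Z) :=
  if rows is r :: rows' then
    if r is j :: r' then
      solve13 rows' (odflt fs (eliminate red13 (map red13 (rowsum fs j r')) fs))
    else solve13 rows' fs
  else fs.

Definition sumZ (l : seq Z) : Z := foldr Z.add Z0 l.

(* [c] lists the bits below the diagonal of the adjacency matrix, row by row, and [w] the entries
   of the kernel vector, shifted by 32, in base 64. *)
Definition base_check (d n : nat) (c w : N) : bool :=
  let tr := triangle n 0 (N_bits c) in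
  let rows := map (code_row n tr) (iota 0 n) in
  let v := digits64 n w in
  [&& 1 < n, all (fun r => size r == d) rows,
    all (fun x => ~~ Z.eqb x Z0) v,
    all (fun r => Z.eqb (sumZ (map (nth Z0 v) r)) Z0) rows,
    has (fun x => ~~ Z.eqb (red13 x) Z0) v &
    all (fun f => size f == 1) (solve13 rows (map (unitf 0 n) (iota 0 n)))].

Section CodeGraph.
Variables (n : nat) (tr : seq (seq bool)).
Definition code_rel : rel 'I_n := fun i j => code_adj tr i j.
Fact code_sym : symmetric code_rel.
Proof. by move=> i j; rewrite /code_rel /code_adj eq_sym maxnC minnC. Qed.
Fact code_irr : irreflexive code_rel.
Proof. by move=> i; rewrite /code_rel /code_adj eqxx. Qed.
Definition code_graph := SGraph code_sym code_irr.
End CodeGraph.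

Local Open Scope ring_scope.

Definition F13Z (z : Z) : 'F_13 := (int_of_Z z)%:~R.
Lemma F13Z0 : F13Z Z0 = 0. Proof. by []. Qed.
Lemma F13Z1 : F13Z (Zpos xH) = 1. Proof. by []. Qed.
Lemma F13ZD x y : F13Z (Z.add x y) = F13Z x + F13Z y.
Proof. by rewrite /F13Z -intrD -rmorphD. Qed.
Lemma F13ZM x y : F13Z (Z.mul x y) = F13Z x * F13Z y.
Proof. by rewrite /F13Z -intrM -rmorphM. Qed.

Lemma F13_eq0 (z : int) : (z%:~R == 0 :> 'F_13) = (13 %| `|z|)%N.
Proof.
have pc : 13 \in [pchar 'F_13] by apply: pchar_Fp.
case: z => m; first by rewrite -pmulrn -(dvdn_pcharf pc).
by rewrite NegzE mulrNz oppr_eq0 -pmulrn -(dvdn_pcharf pc) abszN.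
Qed.

Lemma F13Z_eq0 z : (F13Z z == 0) = (red13 z == Z0).
Proof.
rewrite /F13Z F13_eq0 /red13; have [] := (Z.div_mod z (Zpos 13%positive), Z.mod_pos_bound z (Zpos 13%positive)).
move: (Z.modulo _ _) (Z.div _ _) => r q zE rb; apply/idP/eqP => h; lia.
Qed.

Lemma F13Z_red z : F13Z (red13 z) = F13Z z.
Proof.
rewrite [in RHS](Z.div_mod z (Zpos 13%positive)) // F13ZD F13ZM.
have -> : F13Z (Zpos 13%positive) = 0 by apply/eqP; rewrite F13Z_eq0.
by rewrite mul0r add0r.
Qed.

Lemma red13_neq0 z : red13 z <> Z0 -> F13Z (red13 z) != 0.
Proof. by rewrite F13Z_red F13Z_eq0 => /eqP. Qed.

Notation dot13 := (dot F13Z).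

Lemma solve13_sound rows fs m (z : nat -> 'F_13) :
    all (fun f => size f == m) fs ->
    (forall r j, r \in rows -> j \in r -> (j < size fs)%N) ->
    (forall r, r \in rows -> \sum_(j <- r) z j = 0) ->
    (exists t, forall i, (i < size fs)%N -> z i = dot13 (nth [::] fs i) t) ->
  size (solve13 rows fs) = size fs /\
  exists t, forall i, (i < size fs)%N -> z i = dot13 (nth [::] (solve13 rows fs) i) t.
Proof.
elim: rows fs m => [|r rows IH] fs m //= sfs lt zr tE.
have lt' r' j : r' \in rows -> j \in r' -> (j < size fs)%N by move=> r'r; apply: lt; rewrite inE r'r orbT.
have zr' r' : r' \in rows -> \sum_(j <- r') z j = 0 by move=> r'r; apply: zr; rewrite inE r'r orbT.
case: r lt zr => [|j r] lt zr; first exact: IH sfs lt' zr' tE.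
have jfs : (j < size fs)%N by apply: (lt (j :: r)); rewrite mem_head.
have rfs i : i \in r -> (i < size fs)%N by move=> ir; apply: (lt (j :: r)); rewrite ?mem_head // inE ir orbT.
set c := map red13 _; have sc : size c = m by rewrite size_map (size_rowsum jfs rfs sfs).
case E: eliminate => [fs'|] /=; last exact: IH sfs lt' zr' tE.
have [t zt] := tE.
have ct : dot13 c t = 0.
  rewrite dot_map_red; last exact: F13Z_red.
  rewrite dot_rowsum; last exact: F13ZD.
  rewrite -zt // -[RHS](zr (j :: r)) ?mem_head // big_cons; congr (_ + _).
  by apply: eq_big_seq => i /rfs/zt.
have c0 i : nth Z0 c i <> Z0 -> F13Z (nth Z0 c i) != 0.
  case: (ltnP i (size c)) => ic; last by rewrite nth_default.
  have -> : nth Z0 c i = red13 (nth Z0 (rowsum fs j r) i).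
    by rewrite /c (nth_map Z0) // -(size_map red13).
  exact: red13_neq0.
rewrite -sc in sfs.
have [sE ufs [t' t'E]] := eliminate_sound F13Z0 F13Z1 F13ZD F13ZM F13Z_red c0 sfs E ct.
rewrite -sE; apply: IH ufs _ zr' _; rewrite sE //.
by exists t' => i ifs; rewrite t'E zt.
Qed.

Definition regular_nut (d n : nat) : Prop :=
  exists G : sgraph, [/\ #|G| = n, regular d G & rat_nut G].

Section BaseCheck.
Variables (n : nat) (tr : seq (seq bool)).
Notation G := (code_graph n tr).

Let ext (A : zmodType) (z : G -> A) (j : nat) : A := oapp z 0 (insub j).

Let extE (A : zmodType) (z : G -> A) (i : G) : ext z (i : 'I_n) = z i.
Proof. by rewrite /ext valK. Qed.

Lemma big_code_row (A : Type) idx (op : A -> A -> A) (z : nat -> A) (i : 'I_n) :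
  \big[op/idx]_(j <- code_row n tr i) z j = \big[op/idx]_(y : G | adj (i : G) y) z (y : 'I_n).
Proof.
have E : iota 0 n = index_iota 0 n by rewrite /index_iota subn0.
by rewrite /code_row big_filter E big_mkord.
Qed.

Lemma code_row_lt i j : j \in code_row n tr i -> (j < n)%N.
Proof. by rewrite mem_filter mem_iota => /andP[]. Qed.

Lemma card_code_nbr (i : 'I_n) : #|[pred y : G | adj (i : G) y]| = size (code_row n tr i).
Proof. by rewrite -sum1_size -sum1_card -(big_code_row _ _ (fun=> 1%N)). Qed.

Let rows := map (code_row n tr) (iota 0 n).

Let mem_rows r : r \in rows -> exists i : 'I_n, r = code_row n tr i.
Proof. by case/mapP => i; rewrite mem_iota => /= il ->; exists (Ordinal il). Qed.

(** A single parameter survives the elimination, so the kernel modulo 13 is at most a line, whose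
    direction is read off from the coefficients left. *)
Lemma solve13_rank1 : (0 < n)%N -> all (fun f => size f == 1%N) (solve13 rows (map (unitf 0 n) (iota 0 n))) ->
  exists c : 'I_n -> 'F_13, forall z : G -> 'F_13, (forall x, nbr_sum z x = 0) ->
    exists t, forall i : 'I_n, z i = c i * t.
Proof.
move=> n0; set fs := map _ _; set fs' := solve13 _ _ => one.
have sfs : size fs = n by rewrite size_map size_iota.
exists (fun i => F13Z (nth Z0 (nth [::] fs' i) 0)) => z zker.
have [| |||s' [t tE]] := @solve13_sound rows fs n (ext z).
- by apply/allP => _ /mapP[i _ ->]; rewrite size_cat size_map size_iota.
- by move=> r j /mem_rows[i ->] /code_row_lt; rewrite sfs.
- move=> r /mem_rows[i ->]; rewrite big_code_row -[RHS](zker i).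
  by apply: eq_bigr => y _; rewrite extE.
- exists (ext z) => i; rewrite sfs => il; rewrite (nth_map 0%N) ?size_iota // nth_iota //.
  by rewrite dot_unitf.
exists (t 0%N) => i; rewrite -[z i]extE tE ?sfs //.
have : size (nth [::] fs' i) == 1%N by apply: (allP one); rewrite mem_nth // s' sfs.
by case: (nth _ _ _) => [|a [|]] //= _; rewrite addr0.
Qed.

Lemma code_nut (v : nat -> Z) : (1 < n)%N -> (forall i : 'I_n, v i <> Z0) ->
    (forall i : 'I_n, sumZ (map v (code_row n tr i)) = Z0) ->
    (exists i : 'I_n, red13 (v i) <> Z0) ->
    all (fun f => size f == 1%N) (solve13 rows (map (unitf 0 n) (iota 0 n))) ->
  rat_nut G.
Proof.
move=> n1 v0 vker [i0 vi0] one; split; first by rewrite card_ord.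
have vsum (F : fieldType) (phi : Z -> F) : phi Z0 = 0 ->
    (forall x y, phi (Z.add x y) = phi x + phi y) -> forall x : G, nbr_sum (fun i : G => phi (v (i : 'I_n))) x = 0.
  move=> phi0 phiD x; rewrite /nbr_sum -(big_code_row _ _ (fun j => phi (v j))) -[RHS]phi0 -(vker x).
  by elim: (code_row _ _ _) => [|j r IH]; rewrite ?big_nil ?big_cons //= phiD IH.
have [c rank1] := solve13_rank1 (ltnW n1) one.
(* The known kernel vector is nonzero modulo 13 at [i0], so the direction [c] is too. *)
have ci0 : c i0 != 0.
  have [t /(_ i0) E] := rank1 _ (vsum _ _ F13Z0 F13ZD).
  have : F13Z (v i0) != 0 by rewrite F13Z_eq0; apply/eqP.
  by rewrite E mulf_eq0 negb_or => /andP[].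
exists (fun i : G => ratZ (v (i : 'I_n))); split.
- by move=> x; apply: ratZ_neq0.
- exact: vsum ratZ0 ratZD.
move=> z zker; pose v' (i : G) := ratZ (v (i : 'I_n)); have vi0' : v' i0 != 0 by apply: ratZ_neq0.
exists (z i0 / v' i0) => x; apply/eqP; rewrite -/(v' x) -subr_eq0; apply: contraT => nz.
(* Normalized to vanish at [i0]: its primitive multiple then vanishes modulo 13 altogether, since
   [c] does not at [i0]. *)
pose u y := z y - z i0 / v' i0 * v' y.
have uker y : nbr_sum u y = 0.
  rewrite /nbr_sum sumrB -mulr_sumr -/(nbr_sum z y) -/(nbr_sum v' y) zker.
  by rewrite (vsum _ _ ratZ0 ratZD) mulr0 subr0.
have [b [w [b0 wE /(_ 13%N isT)[y wy]]]] := @primitive_int _ u x nz.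
have wker y' : \sum_(t | adj y' t) w t = 0.
  have := uker y'; rewrite /nbr_sum; under eq_bigr => t _ do rewrite wE.
  by rewrite -mulr_sumr -rmorph_sum => /eqP; rewrite mulf_eq0 (negPf b0) intr_eq0 => /eqP.
have wi0 : w i0 = 0.
  have /eqP := wE i0; rewrite /u divfK // subrr eq_sym mulf_eq0 (negPf b0) intr_eq0.
  by move/eqP.
have [|t tE] := rank1 (fun y => (w y)%:~R).
  by move=> y'; rewrite /nbr_sum -rmorph_sum wker.
have t0 : t = 0.
  by have /eqP := tE i0; rewrite wi0 eq_sym mulf_eq0 (negPf ci0) => /eqP.
by move: wy; rewrite -F13_eq0 tE t0 mulr0 eqxx.
Qed.
End BaseCheck.

Lemma size_digits64 m c : size (digits64 m c) = m.
Proof. by elim: m c => //= m IH c; rewrite IH. Qed.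

Lemma base_checkP d n c w : base_check d n c w -> regular_nut d n.
Proof.
rewrite /base_check; set tr := triangle _ _ _; set v := digits64 n w.
have sv : size v = n by apply: size_digits64.
case/and5P => n1 /allP reg /allP v0 /allP vker /andP[/hasP[z zv zr] one].
exists (code_graph n tr); split; first by rewrite card_ord.
  by move=> x; rewrite card_code_nbr; apply/eqP/reg/map_f; rewrite mem_iota /=.
apply: (code_nut (v := nth Z0 v)) one => //.
- by move=> i; have := v0 (nth Z0 v i); rewrite mem_nth ?sv // => /(_ isT)/Z.eqb_spec.
- by move=> i; apply/Z.eqb_spec/(vker _)/map_f; rewrite mem_iota /=.
- have il : (index z v < n)%N by rewrite -sv index_mem.
  exists (Ordinal il); rewrite /= nth_index // => E; by rewrite E in zr.
Qed.

Local Close Scope ring_scope.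

(** * The orders of regular nut graphs *)

(** Together with the orders that [in_base] adds, each table contains a full period [2d] of the
    construction, restricted to even orders for odd [d]. *)
Definition base5 : seq (nat * (N * N)) :=
  [:: (10, (0xd5ea469f333, 0x8a28a28a275d75d)%num);
    (12, (0x3263193834c69a94d, 0x89e85f7e185f7e189e)%num);
    (14, (0x1c930582d224a5629a624c8, 0x8a291d85e71f8df8617de)%num);
    (16, (0x2e415061862a80b020c408470386cd, 0x8a289d8e371f69d95e85e7e4)%num);
    (18, (0x413820b820f1c0150048130644411e1a850007, 0x86185f7df7df7de79e8618628a2)%num)].

Definition base6 : seq (nat * (N * N)) :=
  [:: (12, (0x16d3ca7ab546cb1ad, 0x86186186186179e79e)%num);
    (13, (0x57be25c4338b98a3eca, 0x2189e86279f7df762861)%num);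
    (14, (0x19691e8cec0e47bccb0aa82, 0x89c79f8a385f89f7e189d)%num);
    (15, (0x129a4a2a516594920f1736ef800, 0x228a28a27df7df7df7df7df)%num);
    (16, (0xe070382aa1b10c9292c4bd4950e710, 0x8e18617df7e18617df7df7df)%num);
    (17, (0x3fe0705643581e40c298d43c08006a67, 0x2375f7df7df7e28a286185f7df)%num);
    (18, (0x91a46258122a3154c24c1b512a208046bd0852, 0x86179e86186186186186179e79e)%num);
    (19, (0x18785852a4a1214b02d7023010814033a35ccc800c, 0x2286179e79e8a27df8617df7df8a2)%num);
    (20, (0x262824c105304198301c1002a80e88348b116d2696851400, 0x86186185f7df7df86186185f7df7df)%num);
    (21, (0xf30003298134761449288a2231112411820c0c84102031225b2, 0x227df7df8a27df7df7df8a28a27df7df)%num);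
    (22, (0x1206161092826051180a2466189942a0950144688900a0418244ad2100, 0x85f8dd72485f7a27e176385f7a27e18dd)%num);
    (23, (0x19e04a0428508150a49250c2405180a2105420ac0540ab2231150a02100032, 0x228a28e386171c7df8617df8a269a7df8e3)%num)].

Definition base7 : seq (nat * (N * N)) :=
  [:: (12, (0x1adf4e6e9df9e1ecd, 0x8618a27df79e8617df)%num);
    (14, (0x1de2ed24d8cf6c9c56b9693, 0x92492475d75d92475d75d)%num);
    (16, (0x1357b521a6ae18f0e38624623e624f, 0x8a379f7e17df7de89e8627e1)%num);
    (18, (0x16a0c950cc948c2c2d05e082c94c6a95c489ecc, 0x89e7e185f85f7e17e17a27248dd)%num);
    (20, (0x282e2414c505310a98e313c26509884e82c15050ab934e40, 0x89e89e89e89e7e17e185f85f7a27a2)%num);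
    (22, (0x4d049124906324a1648024cc25919844881a4821a1c08691540541a2f4, 0x8e37e472385d85c71b8a18de86185f91c)%num);
    (24, (0x1082ca2141d08525460b295c403a880e2207110410882100840614b386693c1020852, 0x8618617df7df86186179e79e7df7df8a28a2)%num)].

Definition base8 : seq (nat * (N * N)) :=
  [:: (12, (0x39ef3dc76befdf7ad, 0x85f85f85f85f7e17e1)%num);
    (14, (0x3fc03fd1fb3ecf6f4edb780, 0x8e17df7df8618617df7df)%num);
    (15, (0x1e19ec59ca4e3d97b478daf3b53, 0x2279e75d79e7df9248a2861)%num);
    (16, (0x4daa9f525d72eaba565d1e80c1a73f, 0x85f85f7e17e18dd8dd7e17e1)%num);
    (17, (0xf3ce2cd94cb547a88d8ce44e8d9c6adcc, 0x228618a28618a27df79e7df75d)%num);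
    (18, (0x72d4794aeb422c60b8a5472ce58b2070e3ef70, 0x8618618617df7df7df86185f7df)%num);
    (19, (0x6799a04f508ff033a13101e02cfa5f1f8f4840adc0, 0x227df7df86179e8617df8617df8a2)%num);
    (20, (0x2d3885e70578c69c669c722940a68528510ac57252a2a65, 0x86186186186186186186185d75d75d)%num);
    (21, (0x3210e7011e21075a4c493429303b18e8730a8aa314e12b6af0007, 0x218618618618617df7de79e7df7e1861)%num);
    (22, (0x3fc003c003c015e003ac08e304791b4672c9eb2d5b88701402012618d2, 0x8638618617df7df8618617df7df7df7df)%num);
    (23, (0x7807803c3c003fe82ba4156505d10ae8172a6e53995ce9022040108a104012, 0x237de8a28a27df7df7df7df7df7df861861)%num);
    (24, (0x34a8c06b18852e2200117401970116666c83b60bb2008b022c194a3306c5020227288, 0x86186186186185d75d86186186186185d75d)%num);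
    (25, (0xf000f003c30243c2412d090b484a82a1c1453051c0a86119823308cc66530a7094c2040a112, 0x248618618a28a27df7df75d75d7df7df861861)%num);
    (26, (0xf00f0f0f00422782c44b41130d089a48640a8c9143245912a14302c2290948414028824154aa940, 0x85f8618617df7df8618618618617df7df7df7df)%num);
    (27, (0x57228087c18053a0c0d041612082c4104a04604c6206c444c30505108c14060418828406b297a5030a31598, 0x218617df7e38e386185d75d75d75f7df8618628a2)%num);
    (29, (0x333c0000440a8308854131a60092590062342091290410226601198891044221042408181ca26d10a145284c0c861922b50840, 0x228e38617df8a286175d86179e8a279e79e7df7df861)%num)].

Definition base9 : seq (nat * (N * N)) :=
  [:: (16, (0x73aa6f39b9e7adab67cdb7837272ab, 0x8e189f7a172189e86275f85f)%num);
    (18, (0xa5765ab98bb25736f29f14ed5cb343848c0cff, 0x86179e86186179e86186179e861)%num);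
    (20, (0x638b8d7163d4d9e2ee09b817405c22ff06e1b0d04edb780, 0x86186186186186186179e79e7df7df)%num);
    (22, (0x7e070058c1c5c43ca88e6f043e82bc8207885706a8d61e559111917ae8, 0x8df7df7df7e28a279e7a28a286185e79e)%num);
    (24, (0xb469212c9606b05815a0c114c4a389886264313493496285aa0d6a3447198ca91462d, 0x86186186186186186179e79e79e79e861861)%num);
    (26, (0x1f81c01c7038049a8e093c3826b1cc046cc056d00ed830188840885a4b492e49790d284a2860c6200, 0x86279e79f7df8a28a28a28a289f7df7df7de79e)%num);
    (28, (0x3803f000ac03063900c58c814603593014b340d2cc06d8116d016d80230885060c220042811840c991326c0b4ab7288, 0x8e28a28a289e79e86185f7df7df7e18617df7de79e)%num);
    (30, (0x30c2c221c606111c206111848c026161109500438500634810c5204328021830a1861621a580d2c8d0cc4c313109901a22d46a4a92400, 0x8a28a289f7df7df7df7df7df7df7df8a28a289f7df7df)%num);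
    (32, (0x4900970292016a4048078920421c484501e808a13c02a0c701506b0a410390824360090d004a6d00c4a109a0425021e84390c461210802814050a448a112, 0x8618618618617df7df92492479e79e8a28a271c71c7df7df)%num)].

Definition base10 : seq (nat * (N * N)) :=
  [:: (15, (0x1edd5be6df0df9ff7fe7ae7e717, 0x238e379e7a38e379e79e79e)%num);
    (16, (0xeaedd59d766bb3f4ef9b6d35cbaf7f, 0x85f85f7e17e185f85f85f85f)%num);
    (17, (0x8e3ffc0f8f5c7d477b8fd5e77dbdbb6710, 0x238e28a279e79d75d8a289f7df)%num);
    (18, (0x147da8be5d31eb27edd5ee8f3db72a15ad4fb4c, 0x86186179e79e7df7df8a28e37df)%num);
    (19, (0x667fac575cab65f38fb712b214cf4dbd7ebe18612d, 0x248e38e37df6db71c75d92479e8e3)%num);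
    (20, (0x29d5646ab87a56b5a94f66db9d0e20d295c2f4b87bf7d212, 0x86186186186175d8e37df7df7df7df)%num);
    (21, (0x3fc33b438f296515c52aca5e2af956299164741a9373bd2b611f, 0x228a28e38a279e86186179e75d79e7df)%num);
    (22, (0x5217a612b58594e8e2dcfae8f5d4c42c8949c26c1a6e9dc53a3c085a53, 0x89e7a289e85f85f85f85f7a285f763763)%num);
    (23, (0x11f81c0e00ff46aaa6638c4e3851c961e463a4558b171ca8b9b3aee0b4ab0007, 0x2375b6db71c72492492491e79e8618628a2)%num);
    (24, (0x421d6cc03e9902fa4835f3bc40f6891d224e1121aca71d1e56f281502a8a4558b0e52, 0x8618618618617df7df7df7df8618617df7df)%num);
    (25, (0x6a1a196a1a389624725811d2c0cc15d902f9249f426eaa6cacd0bb415a152685208081003ff, 0x238e38e379e79e7a38e38e379e79e79e79e79e)%num);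
    (26, (0x97c4216bc8129602aa3815512da621e5920d6804bc05107a20ba135032a529a1572bb42e1d8841ec0, 0x8618618a28a27df8617df75d86179e86186175d)%num);
    (27, (0x6cc0199b10162c8819102055e0443b88147fd28a2d61852c31a910948884c19e1e7157184b89f27c08007288, 0x238e37df7e38e379e79f7df8a289f7df71c721861)%num);
    (28, (0x7c00fbe0003e007fe06e14486e90489d3012744072a2418c063180cc40360116031e20708380280101f9fcdd3ce65, 0x86385f7df7df7df7df7e18618617df7df7e1861861)%num);
    (29, (0x207000fff1c00011073224454cc30636224a5484b42912d424e1c05c54271885c005a00620064b09650b2874ae99a222267288, 0x238e28a27df7e28a279e79e79e86186186179e79f7df)%num);
    (30, (0x1a251c40d12aa22990e307021511408c60220710f102617004c5401a0889588c859894a546263117119823c41c21f444c110c4840e717, 0x8a289d75d8a28a28a28a28a28a28a289d75d75d75d75d)%num);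
    (31, (0x1800007fc03c03c003fc00290cb0c4318709846942423c21194594328b28ea0ea552543111062229888c444014202c029014a9742f8b4d1020840, 0x2862886186179e79e79e79e8a28a27df7df79e79e8a28a2)%num);
    (32, (0x18410e54308258a8e00b62a5007916c3800a49601052d00411e0028b08ca1211d04865406328290914302384884244463acc7311d8ac14028824154aa940, 0x85f85f85f85f85f85f7e17e185f85f8dd8dd7e17e185f85f)%num);
    (33, (0xf801f000007fff00000f80e940b0454a818c14a81992912264a4589201938201b30403e6008b900c1e7060460c11a208f008b01253490e4c74c298c0604000000, 0x217db7df7df7e18618617df7df7e28a28a27df7df7e1861861)%num);
    (34, (0x160d8410490e482080a49056050c20b8418700a424b0058930426c32091d024ce0018cd008099640463a06161092920909042439a816542a0a1050649586a904204e8d0000492, 0x86169a7df8e371c861aeb9e79a68619a679e5d79a661869a69a)%num)].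

Definition base11 : seq (nat * (N * N)) :=
  [:: (16, (0x3bf77d7f9f5fd72fd97e6bfbde5f5d, 0x91d75e91f85e7628df76191f)%num);
    (18, (0x1fc56f70bf54bb5c69e34e0eebddf3e7ae7f79f, 0x86185f7df7df7de79e8618628a2)%num);
    (20, (0x2a575c4afb1abe85d7fd65be8efa35d3a2e55158aad1e73f, 0x85f85f89e89e85f85f85f85f85f85f)%num);
    (22, (0x7e0f83e007daac93d192b4745a2a5e0b2bd4ab6d5ad5daada6d6c5d59a, 0x96569a69a69a69a69a965965965965965)%num);
    (24, (0x5b7214f3b02d315a632a58a3355132b5a53a5a3133233325ddaed3a370e1d2923332c, 0x8e37df8a275d79e8618618a28617df7df79e)%num);
    (26, (0xb781317b423218f0e465a588e3864d349a65d018ea0250f1a0f447489aa3b5378cb4d3d0e09a7002d, 0x89e6677247248dd8dd7e185f7a289e6e572489e)%num);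
    (28, (0x3a11213e42243718818d84484ee32893c61165184588e20e9ae8535c1c5706ab00e645c8b723990691c278b4081063f, 0x8e38e38a28a28a28a27df7df79e79e7df7df75d75d)%num);
    (30, (0x322074e19113a311132a3022e14700ba5105a52d15a52c694a59a52d6d2968159a02f1449c524f2a4d2c2230898048811124828382265, 0x8a28a289f7df7df7df7df7de79e79e861861861861861)%num);
    (32, (0x2c9421e4192c079246903cb21483ea40a7844905e11241f08128f0f40581a80b06820c1412410c83b1816460d230eab4352c569294a92425814812618c0, 0x85f85f7637638dd8dd7e17e17e17e189e89e7e17e189e89e)%num);
    (34, (0x1000ffc0001f0001f801f07c0007fe00018a56a80e52b148a52b9314a552c52b5400aa1d102a3c2244788915c540ed824138082a030120812093204482a02a01400d1616ae800, 0xd1b6c792492491d75d75d8e38e38de79e79e8a28a289f7df7df)%num);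
    (36, (0x28e09161150d022c254348838a29244941401d0682803a492802cb0540345a00a5072104a0e441a0b12850d8af80055b000f4c023a4010474088e902b241d12088011004422011722e8b4d081062d, 0x8618617df7df8618618618617df7df79e79e79e79e8618618a28a2)%num)].

Lemma regular_nut_fowler d n : 1 < d -> regular_nut d n -> regular_nut d (n + (d + d)).
Proof.
move=> d1 [G [Gn dG nG]]; have [G1 _] := nG.
have /card_gt0P[v0 _] : 0 < #|G| by rewrite ltnW.
exists (fowler v0); split; last exact: (fowler_rat_nut v0 d1 dG nG).
  by rewrite (fowler_card (dG v0)) Gn.
exact: fowler_regular (ltnW d1) dG.
Qed.

Definition base_ok d tbl := all (fun t : nat * (N * N) => base_check d t.1 t.2.1 t.2.2) tbl.

(** The second alternative serves order 28 for [d = 8], which is 12 + 16. *)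
Definition in_base d (tbl : seq (nat * (N * N))) n :=
  (n \in map fst tbl) || ((d + d <= n) && (n - (d + d) \in map fst tbl)).

Lemma base_regular_nut d tbl n : 1 < d -> base_ok d tbl -> in_base d tbl n -> regular_nut d n.
Proof.
move=> d1 /allP ok; have base m : m \in map fst tbl -> regular_nut d m.
  by case/mapP => t /ok h ->; apply: base_checkP h.
case/orP => [/base//|/andP[le /base h]].
by rewrite -(subnK le); apply: regular_nut_fowler.
Qed.

(** [P] is evenness of the order when [d] is odd and trivial otherwise. *)
Lemma regular_nut_step d (P : pred nat) lo : 1 < d ->
    (forall n, P n -> lo + (d + d) <= n -> P (n - (d + d))) ->
    (forall n, P n -> lo <= n < lo + (d + d) -> regular_nut d n) ->
  forall n, P n -> lo <= n -> regular_nut d n.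
Proof.
move=> d1 step base n; elim/ltn_ind: n => n IH Pn ln.
case: (ltnP n (lo + (d + d))) => nl; first by apply: base; rewrite ?ln.
rewrite -(subnK (leq_trans (leq_addl _ _) nl)); apply: regular_nut_fowler => //.
by apply: IH; [lia | apply: step | lia].
Qed.

Lemma regular_nut_ge d tbl lo : 1 < d -> base_ok d tbl ->
  all (in_base d tbl) (iota lo (d + d)) -> forall n, lo <= n -> regular_nut d n.
Proof.
move=> d1 ok /allP base n; apply: (regular_nut_step (P := predT)) => // m _ ml.
by apply: (base_regular_nut d1 ok); apply: base; rewrite mem_iota.
Qed.

Lemma regular_nut_even_ge d tbl lo : 1 < d -> base_ok d tbl ->
  all (fun k => in_base d tbl (2 * k)) (iota lo d) -> forall k, lo <= k -> regular_nut d (2 * k).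
Proof.
move=> d1 ok /allP base k lk; apply: (@regular_nut_step d (fun n => ~~ odd n) (2 * lo)) => //.
- by move=> n; lia.
- move=> n en nl; have -> : n = 2 * n./2 by lia.
  by apply: (base_regular_nut d1 ok); apply: base; rewrite mem_iota; lia.
- by rewrite mul2n odd_double.
- by rewrite leq_pmul2l.
Qed.

Lemma regular_nut_handshake d n : regular_nut d n -> ~~ odd (n * d) /\ (0 < d -> d < n).
Proof.
case=> G [<- dG [G1 _]]; split; first exact: handshake (@adj_sym G) (@adj_irr G) dG.
have /card_gt0P[x _] : 0 < #|G| by rewrite ltnW.
by move=> _; rewrite -(regular_lt x dG) leq_addl.
Qed.

(** One setting for all admissible pairs; orders 13 and 14 with [k = 4] have plans of their own
    below. *)
Definition small_plan n k : plan :=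
  [seq (ab, (5, nseq 12 2)) | ab <- [seq (a, b) | a <- iota 0 n.+1, b <- iota 0 n.+1] &
     admissible n k ab.1 ab.2].

Definition plan13 : plan :=
  [:: ((2, 0), (6, nseq 8 2)); ((0, 4), (6, nseq 8 2)); ((2, 4), (6, nseq 8 2));
      ((4, 0), (6, nseq 7 3)); ((6, 0), (6, nseq 6 2));
      ((0, 8), (7, [:: 2; 2; 2; 2; 0; 0; 0; 0])); ((4, 4), (6, [:: 2; 2; 2; 2; 2; 0; 0; 0]))].

Definition plan14 : plan :=
  [:: ((2, 0), (6, nseq 8 2)); ((0, 4), (6, nseq 8 2)); ((2, 4), (6, nseq 8 2));
      ((4, 0), (6, nseq 8 3)); ((6, 0), (6, nseq 8 2));
      ((0, 8), (7, [:: 2; 2; 2; 2; 2; 0; 0; 0])); ((4, 4), (6, [:: 2; 2; 2; 2; 2; 0; 0; 0]));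
      ((8, 0), (6, [:: 2; 2; 2; 2; 2; 0; 0; 0]))].

Definition excluded n k pl := (k <= 4) && plan_covers n k pl && plan_ok n k pl.

Lemma excludedP d n k pl : excluded n k pl -> 0 < d -> n = k + d.+1 -> regular_nut d n -> False.
Proof.
move=> /andP[/andP[k4 cov] ok] d0 nE [G [Gn dG nG]].
exact: search_no_nut d0 nE k4 cov ok Gn dG nG.
Qed.

(** Pairs of an order and the degree [k = n - 1 - d] of the complement. Together with orders 13 and
    14 for [k = 4] they are the orders above [d] missing from the claim for [d] from 5 to 11, the
    handshake lemma taking care of odd orders when [d] is odd. *)
Definition small_cases : seq (nat * nat) :=
  [seq (n, 0) | n <- iota 6 7] ++ [seq (n, 1) | n <- [:: 8; 10; 12]] ++
  [seq (n, 2) | n <- iota 8 7] ++ [:: (10, 3); (14, 3); (11, 4)].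

Lemma small_cases_excluded : all (fun c => excluded c.1 c.2 (small_plan c.1 c.2)) small_cases.
Proof. vm_cast_no_check (erefl true). Qed.

Lemma large13_excluded : excluded 13 4 plan13.
Proof. vm_cast_no_check (erefl true). Qed.
Lemma large14_excluded : excluded 14 4 plan14.
Proof. vm_cast_no_check (erefl true). Qed.

Lemma small_excluded n k : (n, k) \in small_cases -> excluded n k (small_plan n k).
Proof. by move=> c; have := allP small_cases_excluded (n, k) c. Qed.

Definition excluded_order d n :=
  (n <= d) || ((n, n - d.+1) \in (13, 4) :: (14, 4) :: small_cases).

Lemma excluded_orderP d n : 0 < d -> excluded_order d n -> ~ regular_nut d n.
Proof.
move=> d0 ex nd; have [_ /(_ d0) dn] := regular_nut_handshake nd.
have nE : n = (n - d.+1) + d.+1 by rewrite subnK.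
move: ex; rewrite /excluded_order leqNgt dn /= 2!in_cons => /or3P[/eqP[E1 E2]|/eqP[E1 E2]|c].
- by rewrite E2 E1 in nE; rewrite E1 in nd; apply: excludedP large13_excluded d0 nE nd.
- by rewrite E2 E1 in nE; rewrite E1 in nd; apply: excludedP large14_excluded d0 nE nd.
- have ex := small_excluded c. exact: (excludedP ex d0 nE nd).
Qed.

Lemma base_graphs_ok : [&& base_ok 5 base5, base_ok 6 base6, base_ok 7 base7, base_ok 8 base8,
  base_ok 9 base9, base_ok 10 base10 & base_ok 11 base11].
Proof. vm_cast_no_check (erefl true). Qed.

Definition even_tables d lo tbl :=
  all (fun n => odd n || excluded_order d n) (iota 0 (2 * lo)) &&
  all (fun k => in_base d tbl (2 * k)) (iota lo d).

Definition tables d lo tbl :=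
  all (excluded_order d) (iota 0 lo) && all (in_base d tbl) (iota lo (d + d)).

Lemma tables_ok : [&& even_tables 5 5 base5, tables 6 12 base6, even_tables 7 6 base7,
  even_tables 9 8 base9, tables 10 15 base10 & even_tables 11 8 base11].
Proof. vm_cast_no_check (erefl true). Qed.

Lemma lt14 n : n < 14 -> n != 12 -> n \in 13 :: iota 0 12.
Proof. by rewrite inE mem_iota; lia. Qed.

Lemma tables8_ok : all (excluded_order 8) (13 :: iota 0 12) &&
  all (in_base 8 base8) (12 :: iota 14 16).
Proof. vm_cast_no_check (erefl true). Qed.

Local Open Scope nat_scope.
Local Open Scope classical_set_scope.

Lemma nut_ordersP (R : realType) d n : nut_orders R d n <-> regular_nut d n.
Proof.
by split=> -[G [Gn dG nG]]; exists G; split=> //; apply/(nut_graph_rat R).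
Qed.

Lemma nut_orders_even (R : realType) d lo tbl : odd d -> 1 < d -> base_ok d tbl ->
    even_tables d lo tbl ->
  nut_orders R d = [set 2 * k | k in [set k | lo <= k]].
Proof.
move=> dodd d1 ok /andP[/allP low cov]; apply/seteqP; split=> n.
  move=> /nut_ordersP nd; have [en _] := regular_nut_handshake nd.
  have {}en : ~~ odd n by move: en; rewrite oddM dodd andbT.
  have ln : 2 * lo <= n.
    rewrite leqNgt; apply/negP => nl; have := low n; rewrite mem_iota nl (negPf en).
    by move/(_ isT)/(excluded_orderP (ltnW d1)).
  by exists n./2; rewrite /= ?mul2n ?even_halfK // -leq_double -mul2n even_halfK.
case=> k lk <-; apply/nut_ordersP; exact: regular_nut_even_ge d1 ok cov _ lk.
Qed.

Lemma nut_orders_ge (R : realType) d lo tbl : 1 < d -> base_ok d tbl -> tables d lo tbl ->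
  nut_orders R d = [set k | lo <= k].
Proof.
move=> d1 ok /andP[/allP low cov]; apply/seteqP; split=> n.
  move=> /nut_ordersP nd; rewrite /= leqNgt; apply/negP => nl.
  have := low n; rewrite mem_iota nl => /(_ isT)/(excluded_orderP (ltnW d1)); exact.
by move=> ln; apply/nut_ordersP; apply: regular_nut_ge d1 ok cov _ ln.
Qed.

Theorem theorem3 (R : realType) :
  nut_orders R 5 = [set 2 * k | k in [set k | 5 <= k]] /\
  nut_orders R 6 = [set k | 12 <= k] /\
  nut_orders R 7 = [set 2 * k | k in [set k | 6 <= k]] /\
  nut_orders R 8 = [set 12] `|` [set k | 14 <= k] /\
  nut_orders R 9 = [set 2 * k | k in [set k | 8 <= k]] /\
  nut_orders R 10 = [set k | 15 <= k] /\
  nut_orders R 11 = [set 2 * k | k in [set k | 8 <= k]].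
Proof.
have /and5P[b5 b6 b7 b8 /and3P[b9 b10 b11]] := base_graphs_ok.
have /and5P[t5 t6 t7 t9 /andP[t10 t11]] := tables_ok.
have /andP[/allP ex8 /allP in8] := tables8_ok.
split; first exact: (nut_orders_even R (d := 5) isT isT b5 t5).
split; first exact: (nut_orders_ge R (d := 6) isT b6 t6).
split; first exact: (nut_orders_even R (d := 7) isT isT b7 t7).
split; last first.
  split; first exact: (nut_orders_even R (d := 9) isT isT b9 t9).
  split; first exact: (nut_orders_ge R (d := 10) isT b10 t10).
  exact: (nut_orders_even R (d := 11) isT isT b11 t11).
apply/seteqP; split=> n.
  move=> /nut_ordersP nd /=; case: (ltnP n 14) => [nl|]; [left|by right].
  apply/eqP; apply: contraT => n12; exfalso; apply: (@excluded_orderP 8 n) nd.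
    by [].
  exact/ex8/lt14.
case=> [->|/= ln]; apply/nut_ordersP; first exact: (base_regular_nut (d := 8) isT b8 (in8 _ (mem_head _ _))).
apply: (regular_nut_ge (d := 8) (lo := 14) isT b8 _ ln); apply/allP => m ml; apply: in8.
by rewrite inE ml orbT.
Qed.
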